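(* In the setting below, every $g\in G^1\setminus B^1$ can be written as $g=u\,l\,n_{e_4}\,u'$ with $u\in U_J(K,L)\cap\operatorname{Fix}(\sigma)$, $l\in L_J(K,L)\cap\operatorname{Fix}(\sigma)$ and $u'\in U^-_{w_{e_4},J}\cap\operatorname{Fix}(\sigma)$.
   Context: Setting: Let $k\subseteq\ell$ be fields of characteristic $2$ with $\ell^2\subseteq k$. Let $\delta\in k$ be such that $x^2+x+\delta$ is irreducible over $\ell$, $\gamma$ a root, $K=k(\gamma)$, $L=\ell(\gamma)$ (so $L^2\subseteq K\subseteq L$), and $t\mapsto\overline{t}$ the nontrivial automorphism of $L/\ell$. Let $\Phi\subset\mathbb{R}^4$ be the root system of type $\mathsf{F}_4$ w.r.t. an orthonormal basis $e_1,\dots,e_4$: long roots $\pm e_i\pm e_j$ ($i<j$), short roots $\pm e_i$ and $\frac12(\pm e_1\pm e_2\pm e_3\pm e_4)$; fundamental roots $\alpha_1=\frac12(-e_1-e_2-e_3+e_4)$, $\alpha_2=e_3$, $\alpha_3=e_2-e_3$, $\alpha_4=e_1-e_2$; positive/negative roots $\Phi^\pm$. Let $\mathsf{F}_4(L)$ be the adjoint Chevalley group over $L$ with root elements $u_r(t)$, $n_r(t)=u_r(t)u_{-r}(t^{-1})u_r(t)$, $h_r(t)=n_r(t)n_r(1)$, torus $T(L)=\langle h_r(t)\rangle$. For $r\in\Phi$ let $U_r=\{u_r(t)\mid t\in K\}$ if $r$ is long and $U_r=\{u_r(t)\mid t\in L\}$ if $r$ is short; $\mathsf{F}_4(K,L)=\langle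 U_r\mid r\in\Phi\rangle$ (the mixed group), $T(K,L)=\{h\in T(L)\mid r(h)\in K$ for all long $r\}$ where $hu_r(t)h^{-1}=u_r(r(h)t)$, $N(K,L)=\langle n_r(t)\mid t\in K^\times\rangle T(K,L)$, and $W=N(K,L)/T(K,L)$, identified with the Weyl group of $\Phi$. Let $J=\{\alpha_2,\alpha_3,\alpha_4\}$, $\Phi_J=\Phi\cap\operatorname{span}J$ (the roots with zero $e_4$-coordinate), $W_J=\langle w_{\alpha_2},w_{\alpha_3},w_{\alpha_4}\rangle$. In $\mathsf{F}_4(L)$ let $U_J=\langle u_r(t)\mid r\in\Phi^+\setminus\Phi_J\rangle$, $U_J^-=\langle u_r(t)\mid r\in\Phi^-\setminus\Phi_J\rangle$, $L_J=\langle T(L),u_r(t)\mid r\in\Phi_J\rangle$, $P_J=U_JL_J$, and put $U_J(K,L)=U_J\cap\mathsf{F}_4(K,L)$, $U_J^-(K,L)=U_J^-\cap\mathsf{F}_4(K,L)$, $L_J(K,L)=L_J\cap\mathsf{F}_4(K,L)$, $P_J(K,L)=P_J\cap\mathsf{F}_4(K,L)$. Let $\alpha,\beta\in k^\times$ be such that $q(y_1,y_2,y_3,y_4)=y_1^2+\alpha y_2\overline{y_2}+\beta y_3\overline{y_3}+\alpha\beta y_4\overline{y_4}$ is anisotropic on $\ell\oplus K^3$. Also write $\sigma$ for the orthogonal map of $\mathbb{R}^4$ fixing $e_4$ and negating $e_1,e_2,e_3$; it preserves $\Phi$ and equals the longest element $w_0^J$ of $W_J$. Assume $\sigma\colon\mathsf{F}_4(K,L)\to\mathsf{F}_4(K,L)$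 is an automorphism with $\sigma^2=1$ and $\sigma(u_r(t))=u_{\sigma(r)}(c_r\overline{t})$ for all $r\in\Phi$ and admissible $t$, for constants $c_r\in K^\times$ with $c_{\alpha_1}=\alpha^{-1}\beta^{-1}$, $c_{\alpha_2}=\alpha\beta$, $c_{\alpha_3}=\alpha^{-1}$, $c_{\alpha_4}=\alpha\beta^{-1}$. Let $\operatorname{Fix}(\sigma)$ be the fixed points of $\sigma$, $U^1=U_J(K,L)\cap\operatorname{Fix}(\sigma)$, $V^1=U_J^-(K,L)\cap\operatorname{Fix}(\sigma)$, $G^1=\langle U^1,V^1\rangle$, $B^1=P_J(K,L)\cap G^1$; $n_{e_4}=u_{e_4}(1)u_{-e_4}(1)u_{e_4}(1)$, $w_{e_4}$ the reflection in $e_4$, and $U^-_{w_{e_4},J}=\langle U_r\mid r\in\Phi^+\setminus\Phi_J,\ w_{e_4}(r)\in\Phi^-\rangle$. *)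

(* Defs.v *)
From HB Require Import structures.
From mathcomp Require Import all_boot all_order all_algebra.

Set Implicit Arguments.
Unset Strict Implicit.
Unset Printing Implicit Defensive.

Import Order.TTheory GRing.Theory Num.Theory.
Local Open Scope ring_scope.

(* The root system F4 in R^4, in DOUBLED coordinates w.r.t. e1,...,e4:       *)
(* long roots  +-e_i+-e_j  (entries +-2), short roots +-e_i (entry +-2) and *)
(* 1/2(+-e1+-e2+-e3+-e4) (entries +-1).  The k-th entry is root number k.   *)
Definition F4_roots : seq (seq int) := [::
  [:: 2; 2; 0; 0];
  [:: 2; -2; 0; 0];
  [:: -2; 2; 0; 0];
  [:: -2; -2; 0; 0];
  [:: 2; 0; 2; 0];
  [:: 2; 0; -2; 0];
  [:: -2; 0; 2; 0];
  [:: -2; 0; -2; 0];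
  [:: 2; 0; 0; 2];
  [:: 2; 0; 0; -2];
  [:: -2; 0; 0; 2];
  [:: -2; 0; 0; -2];
  [:: 0; 2; 2; 0];
  [:: 0; 2; -2; 0];
  [:: 0; -2; 2; 0];
  [:: 0; -2; -2; 0];
  [:: 0; 2; 0; 2];
  [:: 0; 2; 0; -2];
  [:: 0; -2; 0; 2];
  [:: 0; -2; 0; -2];
  [:: 0; 0; 2; 2];
  [:: 0; 0; 2; -2];
  [:: 0; 0; -2; 2];
  [:: 0; 0; -2; -2];
  [:: 2; 0; 0; 0];
  [:: -2; 0; 0; 0];
  [:: 0; 2; 0; 0];
  [:: 0; -2; 0; 0];
  [:: 0; 0; 2; 0];
  [:: 0; 0; -2; 0];
  [:: 0; 0; 0; 2];
  [:: 0; 0; 0; -2];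
  [:: 1; 1; 1; 1];
  [:: 1; 1; 1; -1];
  [:: 1; 1; -1; 1];
  [:: 1; 1; -1; -1];
  [:: 1; -1; 1; 1];
  [:: 1; -1; 1; -1];
  [:: 1; -1; -1; 1];
  [:: 1; -1; -1; -1];
  [:: -1; 1; 1; 1];
  [:: -1; 1; 1; -1];
  [:: -1; 1; -1; 1];
  [:: -1; 1; -1; -1];
  [:: -1; -1; 1; 1];
  [:: -1; -1; 1; -1];
  [:: -1; -1; -1; 1];
  [:: -1; -1; -1; -1]]%Z.

Definition F4root := 'I_48.

Definition rvec (r : F4root) : seq int := nth [::] F4_roots r.
Definition rcoord (r : F4root) (i : nat) : int := nth 0 (rvec r) i.

Definition root_of (v : seq int) (d : F4root) : F4root :=
  odflt d [pick i : F4root | rvec i == v].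

Definition simple_vec (i : 'I_4) : seq int :=
  nth [::] [:: [:: -1; -1; -1; 1]; [:: 0; 0; 2; 0]; [:: 0; 2; -2; 0];
               [:: 2; -2; 0; 0]]%Z i.
Definition alpha (i : 'I_4) : F4root := root_of (simple_vec i) ord0.

Definition positive_root (r : F4root) : Prop :=
  exists c : 'I_4 -> nat, forall k : 'I_4,
    rcoord r k = \sum_(i < 4) (c i)%:Z * nth 0 (simple_vec i) k.
Definition negative_root (r : F4root) : Prop :=
  exists c : 'I_4 -> nat, forall k : 'I_4,
    rcoord r k = - \sum_(i < 4) (c i)%:Z * nth 0 (simple_vec i) k.

(* long roots: squared length 2, i.e. doubled squared length 8 *)
Definition long_root (r : F4root) : bool :=
  \sum_(i < 4) rcoord r i ^+ 2 == 8.

Definition in_PhiJ (r : F4root) : bool := rcoord r 3 == 0.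

Definition opp_root (r : F4root) : F4root := root_of [seq - x | x <- rvec r] r.
Definition sigma_root (r : F4root) : F4root :=
  root_of [:: - rcoord r 0; - rcoord r 1; - rcoord r 2; rcoord r 3] r.
Definition w_e4 (r : F4root) : F4root :=
  root_of [:: rcoord r 0; rcoord r 1; rcoord r 2; - rcoord r 3] r.
Definition e4 : F4root := root_of [:: 0; 0; 0; 2]%Z ord0.

(* The adjoint representation of the (complex) Lie algebra of type F4 on    *)
(* its Chevalley lattice.  Basis: indices 0..47 are the Chevalley basis     *)
(* vectors X_r (r = root number k), indices 48..51 are H_{alpha_1..4}.      *)
(* adX k = matrix of ad(X_r) (column j = image of basis vector j) and       *)
(* adX2 k = matrix of ad(X_r)^2/2, given as sparse lists (row, col, entry). *)
(* These are integral and ad(X_r)^3 = 0, so the root element of the         *)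
(* adjoint Chevalley group is u_r(t) = exp(t ad X_r) = 1 + t adX + t^2 adX2 *)
Definition adX_data : seq (seq (nat * nat * int)) := [::
  [:: (0, 48, 2%Z); (0, 50, -1%Z); (4, 14, -1%Z); (5, 15, -1%Z); (8, 18, 1%Z); (9, 19, 1%Z); (12, 6, 1%Z); (13, 7, 1%Z); (16, 10, -1%Z); (17, 11, -1%Z); (24, 27, 1%Z); (26, 25, -1%Z); (32, 44, 1%Z); (33, 45, 1%Z); (34, 46, -1%Z); (35, 47, -1%Z); (49, 3, 1%Z); (50, 3, 2%Z); (51, 3, 1%Z)];
  [:: (1, 50, 1%Z); (1, 51, -2%Z); (4, 12, -1%Z); (5, 13, -1%Z); (8, 16, 1%Z); (9, 17, 1%Z); (14, 6, 1%Z); (15, 7, 1%Z); (18, 10, -1%Z); (19, 11, -1%Z); (24, 26, -1%Z); (27, 25, 1%Z); (36, 40, -1%Z); (37, 41, 1%Z); (38, 42, -1%Z); (39, 43, 1%Z); (51, 2, 1%Z)];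
  [:: (2, 50, -1%Z); (2, 51, 2%Z); (6, 14, 1%Z); (7, 15, 1%Z); (10, 18, -1%Z); (11, 19, -1%Z); (12, 4, -1%Z); (13, 5, -1%Z); (16, 8, 1%Z); (17, 9, 1%Z); (25, 27, 1%Z); (26, 24, -1%Z); (40, 36, -1%Z); (41, 37, 1%Z); (42, 38, -1%Z); (43, 39, 1%Z); (51, 1, -1%Z)];
  [:: (3, 48, -2%Z); (3, 50, 1%Z); (6, 12, 1%Z); (7, 13, 1%Z); (10, 16, -1%Z); (11, 17, -1%Z); (14, 4, -1%Z); (15, 5, -1%Z); (18, 8, 1%Z); (19, 9, 1%Z); (25, 26, -1%Z); (27, 24, 1%Z); (44, 32, 1%Z); (45, 33, 1%Z); (46, 34, -1%Z); (47, 35, -1%Z); (49, 0, -1%Z); (50, 0, -2%Z); (51, 0, -1%Z)];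
  [:: (0, 13, -1%Z); (1, 15, -1%Z); (4, 48, 2%Z); (4, 49, -2%Z); (4, 50, 1%Z); (4, 51, -1%Z); (8, 22, -1%Z); (9, 23, 1%Z); (12, 2, 1%Z); (14, 3, 1%Z); (20, 10, -1%Z); (21, 11, 1%Z); (24, 29, -1%Z); (28, 25, 1%Z); (32, 42, 1%Z); (33, 43, 1%Z); (36, 46, -1%Z); (37, 47, -1%Z); (49, 7, 1%Z); (50, 7, 1%Z); (51, 7, 1%Z)];
  [:: (0, 12, -1%Z); (1, 14, -1%Z); (5, 49, 2%Z); (5, 50, -1%Z); (5, 51, -1%Z); (8, 20, -1%Z); (9, 21, 1%Z); (13, 2, 1%Z); (15, 3, 1%Z); (22, 10, -1%Z); (23, 11, 1%Z); (24, 28, -1%Z); (29, 25, 1%Z); (34, 40, -1%Z); (35, 41, 1%Z); (38, 44, -1%Z); (39, 45, 1%Z); (50, 6, 1%Z); (51, 6, 1%Z)];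
  [:: (2, 13, 1%Z); (3, 15, 1%Z); (6, 49, -2%Z); (6, 50, 1%Z); (6, 51, 1%Z); (10, 22, -1%Z); (11, 23, 1%Z); (12, 0, -1%Z); (14, 1, -1%Z); (20, 8, -1%Z); (21, 9, 1%Z); (25, 29, 1%Z); (28, 24, -1%Z); (40, 34, -1%Z); (41, 35, 1%Z); (44, 38, -1%Z); (45, 39, 1%Z); (50, 5, -1%Z); (51, 5, -1%Z)];
  [:: (2, 12, 1%Z); (3, 14, 1%Z); (7, 48, -2%Z); (7, 49, 2%Z); (7, 50, -1%Z); (7, 51, 1%Z); (10, 20, -1%Z); (11, 21, 1%Z); (13, 0, -1%Z); (15, 1, -1%Z); (22, 8, -1%Z); (23, 9, 1%Z); (25, 28, 1%Z); (29, 24, -1%Z); (42, 32, 1%Z); (43, 33, 1%Z); (46, 36, -1%Z); (47, 37, -1%Z); (49, 4, -1%Z); (50, 4, -1%Z); (51, 4, -1%Z)];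
  [:: (0, 17, 1%Z); (1, 19, 1%Z); (4, 21, -1%Z); (5, 23, -1%Z); (8, 51, -1%Z); (16, 2, -1%Z); (18, 3, -1%Z); (20, 6, 1%Z); (22, 7, 1%Z); (24, 31, 1%Z); (30, 25, -1%Z); (32, 41, 1%Z); (34, 43, -1%Z); (36, 45, 1%Z); (38, 47, -1%Z); (48, 11, 1%Z); (49, 11, 2%Z); (50, 11, 3%Z); (51, 11, 2%Z)];
  [:: (0, 16, 1%Z); (1, 18, 1%Z); (4, 20, 1%Z); (5, 22, 1%Z); (9, 48, 2%Z); (9, 51, -1%Z); (17, 2, -1%Z); (19, 3, -1%Z); (21, 6, -1%Z); (23, 7, -1%Z); (24, 30, 1%Z); (31, 25, -1%Z); (33, 40, -1%Z); (35, 42, -1%Z); (37, 44, 1%Z); (39, 46, 1%Z); (48, 10, -1%Z); (49, 10, -1%Z); (50, 10, -1%Z)];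
  [:: (2, 17, -1%Z); (3, 19, -1%Z); (6, 21, -1%Z); (7, 23, -1%Z); (10, 48, -2%Z); (10, 51, 1%Z); (16, 0, 1%Z); (18, 1, 1%Z); (20, 4, 1%Z); (22, 5, 1%Z); (25, 31, -1%Z); (30, 24, 1%Z); (40, 33, -1%Z); (42, 35, -1%Z); (44, 37, 1%Z); (46, 39, 1%Z); (48, 9, 1%Z); (49, 9, 1%Z); (50, 9, 1%Z)];
  [:: (2, 16, -1%Z); (3, 18, -1%Z); (6, 20, 1%Z); (7, 22, 1%Z); (11, 51, 1%Z); (17, 0, 1%Z); (19, 1, 1%Z); (21, 4, -1%Z); (23, 5, -1%Z); (25, 30, -1%Z); (31, 24, 1%Z); (41, 32, 1%Z); (43, 34, -1%Z); (45, 36, 1%Z); (47, 38, -1%Z); (48, 8, -1%Z); (49, 8, -2%Z); (50, 8, -3%Z); (51, 8, -2%Z)];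
  [:: (0, 5, 1%Z); (2, 7, -1%Z); (4, 1, 1%Z); (6, 3, -1%Z); (12, 48, 2%Z); (12, 49, -2%Z); (12, 51, 1%Z); (16, 22, 1%Z); (17, 23, -1%Z); (20, 18, 1%Z); (21, 19, -1%Z); (26, 29, -1%Z); (28, 27, 1%Z); (32, 38, -1%Z); (33, 39, 1%Z); (40, 46, -1%Z); (41, 47, 1%Z); (49, 15, 1%Z); (50, 15, 1%Z)];
  [:: (0, 4, 1%Z); (2, 6, -1%Z); (5, 1, 1%Z); (7, 3, -1%Z); (13, 49, 2%Z); (13, 50, -2%Z); (13, 51, 1%Z); (16, 20, 1%Z); (17, 21, -1%Z); (22, 18, 1%Z); (23, 19, -1%Z); (26, 28, -1%Z); (29, 27, 1%Z); (34, 36, 1%Z); (35, 37, 1%Z); (42, 44, -1%Z); (43, 45, -1%Z); (50, 14, 1%Z)];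
  [:: (1, 5, 1%Z); (3, 7, -1%Z); (4, 0, 1%Z); (6, 2, -1%Z); (14, 49, -2%Z); (14, 50, 2%Z); (14, 51, -1%Z); (18, 22, 1%Z); (19, 23, -1%Z); (20, 16, 1%Z); (21, 17, -1%Z); (27, 29, 1%Z); (28, 26, -1%Z); (36, 34, 1%Z); (37, 35, 1%Z); (44, 42, -1%Z); (45, 43, -1%Z); (50, 13, -1%Z)];
  [:: (1, 4, 1%Z); (3, 6, -1%Z); (5, 0, 1%Z); (7, 2, -1%Z); (15, 48, -2%Z); (15, 49, 2%Z); (15, 51, -1%Z); (18, 20, 1%Z); (19, 21, -1%Z); (22, 16, 1%Z); (23, 17, -1%Z); (27, 28, 1%Z); (29, 26, -1%Z); (38, 32, -1%Z); (39, 33, 1%Z); (46, 40, -1%Z); (47, 41, 1%Z); (49, 12, -1%Z); (50, 12, -1%Z)];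
  [:: (0, 9, -1%Z); (2, 11, 1%Z); (8, 1, -1%Z); (10, 3, 1%Z); (12, 21, 1%Z); (13, 23, 1%Z); (16, 50, -1%Z); (16, 51, 1%Z); (20, 14, -1%Z); (22, 15, -1%Z); (26, 31, -1%Z); (30, 27, 1%Z); (32, 37, -1%Z); (34, 39, 1%Z); (40, 45, -1%Z); (42, 47, 1%Z); (48, 19, 1%Z); (49, 19, 2%Z); (50, 19, 3%Z); (51, 19, 1%Z)];
  [:: (0, 8, -1%Z); (2, 10, 1%Z); (9, 1, -1%Z); (11, 3, 1%Z); (12, 20, -1%Z); (13, 22, -1%Z); (17, 48, 2%Z); (17, 50, -1%Z); (17, 51, 1%Z); (21, 14, 1%Z); (23, 15, 1%Z); (26, 30, -1%Z); (31, 27, 1%Z); (33, 36, -1%Z); (35, 38, -1%Z); (41, 44, 1%Z); (43, 46, 1%Z); (48, 18, -1%Z); (49, 18, -1%Z); (50, 18, -1%Z); (51, 18, -1%Z)];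
  [:: (1, 9, -1%Z); (3, 11, 1%Z); (8, 0, -1%Z); (10, 2, 1%Z); (14, 21, 1%Z); (15, 23, 1%Z); (18, 48, -2%Z); (18, 50, 1%Z); (18, 51, -1%Z); (20, 12, -1%Z); (22, 13, -1%Z); (27, 31, 1%Z); (30, 26, -1%Z); (36, 33, -1%Z); (38, 35, -1%Z); (44, 41, 1%Z); (46, 43, 1%Z); (48, 17, 1%Z); (49, 17, 1%Z); (50, 17, 1%Z); (51, 17, 1%Z)];
  [:: (1, 8, -1%Z); (3, 10, 1%Z); (9, 0, -1%Z); (11, 2, 1%Z); (14, 20, -1%Z); (15, 22, -1%Z); (19, 50, 1%Z); (19, 51, -1%Z); (21, 12, 1%Z); (23, 13, 1%Z); (27, 30, 1%Z); (31, 26, -1%Z); (37, 32, -1%Z); (39, 34, 1%Z); (45, 40, -1%Z); (47, 42, 1%Z); (48, 16, -1%Z); (49, 16, -2%Z); (50, 16, -3%Z); (51, 16, -1%Z)];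
  [:: (4, 9, -1%Z); (6, 11, -1%Z); (8, 5, 1%Z); (10, 7, 1%Z); (12, 17, 1%Z); (14, 19, 1%Z); (16, 13, -1%Z); (18, 15, -1%Z); (20, 49, -2%Z); (20, 50, 1%Z); (28, 31, 1%Z); (30, 29, -1%Z); (32, 35, 1%Z); (36, 39, 1%Z); (40, 43, -1%Z); (44, 47, -1%Z); (48, 23, 1%Z); (49, 23, 2%Z); (50, 23, 2%Z); (51, 23, 1%Z)];
  [:: (4, 8, 1%Z); (6, 10, 1%Z); (9, 5, -1%Z); (11, 7, -1%Z); (12, 16, -1%Z); (14, 18, -1%Z); (17, 13, 1%Z); (19, 15, 1%Z); (21, 48, 2%Z); (21, 49, -2%Z); (21, 50, 1%Z); (28, 30, -1%Z); (31, 29, 1%Z); (33, 34, -1%Z); (37, 38, 1%Z); (41, 42, -1%Z); (45, 46, 1%Z); (48, 22, -1%Z); (49, 22, -1%Z); (50, 22, -2%Z); (51, 22, -1%Z)];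
  [:: (5, 9, -1%Z); (7, 11, -1%Z); (8, 4, 1%Z); (10, 6, 1%Z); (13, 17, 1%Z); (15, 19, 1%Z); (16, 12, -1%Z); (18, 14, -1%Z); (22, 48, -2%Z); (22, 49, 2%Z); (22, 50, -1%Z); (29, 31, 1%Z); (30, 28, -1%Z); (34, 33, -1%Z); (38, 37, 1%Z); (42, 41, -1%Z); (46, 45, 1%Z); (48, 21, 1%Z); (49, 21, 1%Z); (50, 21, 2%Z); (51, 21, 1%Z)];
  [:: (5, 8, 1%Z); (7, 10, 1%Z); (9, 4, -1%Z); (11, 6, -1%Z); (13, 16, -1%Z); (15, 18, -1%Z); (17, 12, 1%Z); (19, 14, 1%Z); (23, 49, 2%Z); (23, 50, -1%Z); (29, 30, -1%Z); (31, 28, 1%Z); (35, 32, 1%Z); (39, 36, 1%Z); (43, 40, -1%Z); (47, 44, -1%Z); (48, 20, -1%Z); (49, 20, -2%Z); (50, 20, -2%Z); (51, 20, -1%Z)];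
  [:: (0, 26, 2%Z); (1, 27, -2%Z); (4, 28, -2%Z); (5, 29, -2%Z); (8, 30, 2%Z); (9, 31, 2%Z); (24, 48, 1%Z); (24, 51, -1%Z); (26, 2, 1%Z); (27, 3, -1%Z); (28, 6, 1%Z); (29, 7, 1%Z); (30, 10, -1%Z); (31, 11, -1%Z); (32, 40, -1%Z); (33, 41, 1%Z); (34, 42, 1%Z); (35, 43, 1%Z); (36, 44, -1%Z); (37, 45, -1%Z); (38, 46, -1%Z); (39, 47, 1%Z); (49, 25, 1%Z); (50, 25, 2%Z); (51, 25, 2%Z)];
  [:: (2, 26, 2%Z); (3, 27, -2%Z); (6, 28, 2%Z); (7, 29, 2%Z); (10, 30, -2%Z); (11, 31, -2%Z); (25, 48, -1%Z); (25, 51, 1%Z); (26, 0, 1%Z); (27, 1, -1%Z); (28, 4, -1%Z); (29, 5, -1%Z); (30, 8, 1%Z); (31, 9, 1%Z); (40, 32, -1%Z); (41, 33, 1%Z); (42, 34, 1%Z); (43, 35, 1%Z); (44, 36, -1%Z); (45, 37, -1%Z); (46, 38, -1%Z); (47, 39, 1%Z); (49, 24, -1%Z); (50, 24, -2%Z); (51, 24, -2%Z)];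
  [:: (0, 24, -2%Z); (2, 25, -2%Z); (12, 28, -2%Z); (13, 29, -2%Z); (16, 30, -2%Z); (17, 31, -2%Z); (24, 1, 1%Z); (25, 3, 1%Z); (26, 48, 1%Z); (26, 50, -1%Z); (26, 51, 1%Z); (28, 14, 1%Z); (29, 15, 1%Z); (30, 18, 1%Z); (31, 19, 1%Z); (32, 36, 1%Z); (33, 37, 1%Z); (34, 38, -1%Z); (35, 39, 1%Z); (40, 44, -1%Z); (41, 45, 1%Z); (42, 46, -1%Z); (43, 47, -1%Z); (49, 27, 1%Z); (50, 27, 2%Z)];
  [:: (1, 24, 2%Z); (3, 25, 2%Z); (14, 28, 2%Z); (15, 29, 2%Z); (18, 30, 2%Z); (19, 31, 2%Z); (24, 0, -1%Z); (25, 2, -1%Z); (27, 48, -1%Z); (27, 50, 1%Z); (27, 51, -1%Z); (28, 12, -1%Z); (29, 13, -1%Z); (30, 16, -1%Z); (31, 17, -1%Z); (36, 32, 1%Z); (37, 33, 1%Z); (38, 34, -1%Z); (39, 35, 1%Z); (44, 40, -1%Z); (45, 41, 1%Z); (46, 42, -1%Z); (47, 43, -1%Z); (49, 26, -1%Z); (50, 26, -2%Z)];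
  [:: (4, 24, 2%Z); (6, 25, -2%Z); (12, 26, 2%Z); (14, 27, -2%Z); (20, 30, 2%Z); (21, 31, -2%Z); (24, 5, 1%Z); (25, 7, -1%Z); (26, 13, 1%Z); (27, 15, -1%Z); (28, 48, 1%Z); (28, 49, -2%Z); (28, 50, 1%Z); (30, 22, 1%Z); (31, 23, -1%Z); (32, 34, 1%Z); (33, 35, 1%Z); (36, 38, 1%Z); (37, 39, -1%Z); (40, 42, 1%Z); (41, 43, -1%Z); (44, 46, -1%Z); (45, 47, -1%Z); (49, 29, 1%Z)];
  [:: (5, 24, 2%Z); (7, 25, -2%Z); (13, 26, 2%Z); (15, 27, -2%Z); (22, 30, 2%Z); (23, 31, -2%Z); (24, 4, 1%Z); (25, 6, -1%Z); (26, 12, 1%Z); (27, 14, -1%Z); (29, 48, -1%Z); (29, 49, 2%Z); (29, 50, -1%Z); (30, 20, 1%Z); (31, 21, -1%Z); (34, 32, 1%Z); (35, 33, 1%Z); (38, 36, 1%Z); (39, 37, -1%Z); (42, 40, 1%Z); (43, 41, -1%Z); (46, 44, -1%Z); (47, 45, -1%Z); (49, 28, -1%Z)];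
  [:: (8, 24, -2%Z); (10, 25, 2%Z); (16, 26, 2%Z); (18, 27, -2%Z); (20, 28, -2%Z); (22, 29, -2%Z); (24, 9, -1%Z); (25, 11, 1%Z); (26, 17, 1%Z); (27, 19, -1%Z); (28, 21, 1%Z); (29, 23, 1%Z); (30, 48, -1%Z); (32, 33, -1%Z); (34, 35, 1%Z); (36, 37, 1%Z); (38, 39, 1%Z); (40, 41, -1%Z); (42, 43, -1%Z); (44, 45, -1%Z); (46, 47, 1%Z); (48, 31, 2%Z); (49, 31, 3%Z); (50, 31, 4%Z); (51, 31, 2%Z)];
  [:: (9, 24, -2%Z); (11, 25, 2%Z); (17, 26, 2%Z); (19, 27, -2%Z); (21, 28, 2%Z); (23, 29, 2%Z); (24, 8, -1%Z); (25, 10, 1%Z); (26, 16, 1%Z); (27, 18, -1%Z); (28, 20, -1%Z); (29, 22, -1%Z); (31, 48, 1%Z); (33, 32, -1%Z); (35, 34, 1%Z); (37, 36, 1%Z); (39, 38, 1%Z); (41, 40, -1%Z); (43, 42, -1%Z); (45, 44, -1%Z); (47, 46, 1%Z); (48, 30, -2%Z); (49, 30, -3%Z); (50, 30, -4%Z); (51, 30, -2%Z)];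
  [:: (0, 35, 2%Z); (4, 37, 2%Z); (8, 38, 2%Z); (12, 41, -2%Z); (16, 42, -2%Z); (20, 44, 2%Z); (24, 39, -1%Z); (26, 43, 1%Z); (28, 45, 1%Z); (30, 46, -1%Z); (32, 48, 1%Z); (32, 49, -1%Z); (33, 31, 1%Z); (34, 29, -1%Z); (35, 23, -1%Z); (36, 27, -1%Z); (37, 19, 1%Z); (38, 15, 1%Z); (40, 25, 1%Z); (41, 11, -1%Z); (42, 7, -1%Z); (44, 3, -1%Z); (48, 47, 1%Z); (49, 47, 3%Z); (50, 47, 4%Z); (51, 47, 2%Z)];
  [:: (0, 34, 2%Z); (4, 36, 2%Z); (9, 39, -2%Z); (12, 40, 2%Z); (17, 43, -2%Z); (21, 45, -2%Z); (24, 38, 1%Z); (26, 42, 1%Z); (28, 44, 1%Z); (31, 47, -1%Z); (32, 30, 1%Z); (33, 48, 2%Z); (33, 49, -1%Z); (34, 22, 1%Z); (35, 29, -1%Z); (36, 18, 1%Z); (37, 27, -1%Z); (39, 15, -1%Z); (40, 10, 1%Z); (41, 25, -1%Z); (43, 7, -1%Z); (45, 3, -1%Z); (48, 46, -1%Z)];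
  [:: (0, 33, -2%Z); (5, 39, -2%Z); (8, 36, -2%Z); (13, 43, 2%Z); (16, 40, 2%Z); (22, 46, -2%Z); (24, 37, 1%Z); (26, 41, -1%Z); (29, 47, 1%Z); (30, 44, 1%Z); (32, 28, -1%Z); (33, 21, 1%Z); (34, 49, 1%Z); (34, 50, -1%Z); (35, 31, -1%Z); (36, 14, -1%Z); (38, 27, 1%Z); (39, 19, -1%Z); (40, 6, 1%Z); (42, 25, -1%Z); (43, 11, 1%Z); (46, 3, 1%Z); (48, 45, 1%Z); (49, 45, 2%Z); (50, 45, 4%Z); (51, 45, 2%Z)];
  [:: (0, 32, -2%Z); (5, 38, 2%Z); (9, 37, -2%Z); (13, 42, 2%Z); (17, 41, -2%Z); (23, 47, 2%Z); (24, 36, 1%Z); (26, 40, 1%Z); (29, 46, 1%Z); (31, 45, 1%Z); (32, 20, -1%Z); (33, 28, -1%Z); (34, 30, -1%Z); (35, 48, 1%Z); (35, 49, 1%Z); (35, 50, -1%Z); (37, 14, -1%Z); (38, 18, 1%Z); (39, 27, -1%Z); (41, 6, -1%Z); (42, 10, 1%Z); (43, 25, -1%Z); (47, 3, 1%Z); (48, 44, -1%Z); (49, 44, -1%Z)];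
  [:: (1, 39, -2%Z); (4, 33, -2%Z); (8, 34, 2%Z); (14, 45, 2%Z); (18, 46, -2%Z); (20, 40, 2%Z); (24, 35, -1%Z); (27, 47, 1%Z); (28, 41, 1%Z); (30, 42, 1%Z); (32, 26, -1%Z); (33, 17, 1%Z); (34, 13, -1%Z); (36, 49, -1%Z); (36, 50, 1%Z); (36, 51, -1%Z); (37, 31, -1%Z); (38, 29, -1%Z); (39, 23, -1%Z); (40, 2, 1%Z); (44, 25, 1%Z); (45, 11, -1%Z); (46, 7, 1%Z); (48, 43, 1%Z); (49, 43, 2%Z); (50, 43, 2%Z); (51, 43, 2%Z)];
  [:: (1, 38, 2%Z); (4, 32, -2%Z); (9, 35, 2%Z); (14, 44, 2%Z); (19, 47, -2%Z); (21, 41, 2%Z); (24, 34, -1%Z); (27, 46, 1%Z); (28, 40, -1%Z); (31, 43, 1%Z); (32, 16, 1%Z); (33, 26, -1%Z); (35, 13, -1%Z); (36, 30, -1%Z); (37, 48, 1%Z); (37, 49, -1%Z); (37, 50, 1%Z); (37, 51, -1%Z); (38, 22, -1%Z); (39, 29, 1%Z); (41, 2, -1%Z); (44, 10, -1%Z); (45, 25, 1%Z); (47, 7, 1%Z); (48, 42, -1%Z); (49, 42, -1%Z); (50, 42, -2%Z)];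
  [:: (1, 37, -2%Z); (5, 35, -2%Z); (8, 32, -2%Z); (15, 47, -2%Z); (18, 44, -2%Z); (22, 42, 2%Z); (24, 33, -1%Z); (27, 45, -1%Z); (29, 43, 1%Z); (30, 40, 1%Z); (32, 12, 1%Z); (34, 26, 1%Z); (35, 17, 1%Z); (36, 28, -1%Z); (37, 21, -1%Z); (38, 48, -1%Z); (38, 49, 1%Z); (38, 51, -1%Z); (39, 31, -1%Z); (42, 2, 1%Z); (44, 6, 1%Z); (46, 25, 1%Z); (47, 11, 1%Z); (48, 41, 1%Z); (49, 41, 1%Z); (50, 41, 2%Z); (51, 41, 2%Z)];
  [:: (1, 36, 2%Z); (5, 34, 2%Z); (9, 33, 2%Z); (15, 46, 2%Z); (19, 45, 2%Z); (23, 43, 2%Z); (24, 32, 1%Z); (27, 44, 1%Z); (29, 42, -1%Z); (31, 41, 1%Z); (33, 12, -1%Z); (34, 16, -1%Z); (35, 26, -1%Z); (36, 20, -1%Z); (37, 28, 1%Z); (38, 30, -1%Z); (39, 49, 1%Z); (39, 51, -1%Z); (43, 2, -1%Z); (45, 6, -1%Z); (46, 10, -1%Z); (47, 25, -1%Z); (48, 40, -1%Z); (49, 40, -2%Z); (50, 40, -2%Z)];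
  [:: (2, 43, -2%Z); (6, 45, -2%Z); (10, 46, -2%Z); (12, 33, -2%Z); (16, 34, -2%Z); (20, 36, -2%Z); (25, 47, -1%Z); (26, 35, -1%Z); (28, 37, 1%Z); (30, 38, -1%Z); (32, 24, 1%Z); (33, 9, 1%Z); (34, 5, 1%Z); (36, 1, 1%Z); (40, 49, -1%Z); (40, 51, 1%Z); (41, 31, 1%Z); (42, 29, -1%Z); (43, 23, 1%Z); (44, 27, 1%Z); (45, 19, 1%Z); (46, 15, 1%Z); (48, 39, 1%Z); (49, 39, 2%Z); (50, 39, 2%Z)];
  [:: (2, 42, 2%Z); (6, 44, 2%Z); (11, 47, 2%Z); (12, 32, 2%Z); (17, 35, 2%Z); (21, 37, -2%Z); (25, 46, 1%Z); (26, 34, 1%Z); (28, 36, -1%Z); (31, 39, -1%Z); (32, 8, -1%Z); (33, 24, -1%Z); (35, 5, -1%Z); (37, 1, -1%Z); (40, 30, 1%Z); (41, 48, 1%Z); (41, 49, -1%Z); (41, 51, 1%Z); (42, 22, 1%Z); (43, 29, 1%Z); (44, 18, -1%Z); (45, 27, -1%Z); (47, 15, -1%Z); (48, 38, -1%Z); (49, 38, -1%Z); (50, 38, -2%Z); (51, 38, -2%Z)];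
  [:: (2, 41, -2%Z); (7, 47, 2%Z); (10, 44, -2%Z); (13, 35, -2%Z); (16, 32, 2%Z); (22, 38, -2%Z); (25, 45, 1%Z); (26, 33, -1%Z); (29, 39, 1%Z); (30, 36, -1%Z); (32, 4, -1%Z); (34, 24, -1%Z); (35, 9, 1%Z); (38, 1, 1%Z); (40, 28, -1%Z); (41, 21, 1%Z); (42, 48, -1%Z); (42, 49, 1%Z); (42, 50, -1%Z); (42, 51, 1%Z); (43, 31, 1%Z); (44, 14, 1%Z); (46, 27, 1%Z); (47, 19, -1%Z); (48, 37, 1%Z); (49, 37, 1%Z); (50, 37, 2%Z)];
  [:: (2, 40, 2%Z); (7, 46, 2%Z); (11, 45, -2%Z); (13, 34, -2%Z); (17, 33, 2%Z); (23, 39, -2%Z); (25, 44, 1%Z); (26, 32, -1%Z); (29, 38, -1%Z); (31, 37, -1%Z); (33, 4, -1%Z); (34, 8, 1%Z); (35, 24, -1%Z); (39, 1, -1%Z); (40, 20, 1%Z); (41, 28, 1%Z); (42, 30, 1%Z); (43, 49, 1%Z); (43, 50, -1%Z); (43, 51, 1%Z); (45, 14, 1%Z); (46, 18, -1%Z); (47, 27, 1%Z); (48, 36, -1%Z); (49, 36, -2%Z); (50, 36, -2%Z); (51, 36, -2%Z)];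
  [:: (3, 47, 2%Z); (6, 41, -2%Z); (10, 42, 2%Z); (14, 37, -2%Z); (18, 38, 2%Z); (20, 32, -2%Z); (25, 43, -1%Z); (27, 39, -1%Z); (28, 33, -1%Z); (30, 34, -1%Z); (32, 0, -1%Z); (36, 24, 1%Z); (37, 9, -1%Z); (38, 5, 1%Z); (40, 26, 1%Z); (41, 17, -1%Z); (42, 13, 1%Z); (44, 48, -1%Z); (44, 49, -1%Z); (44, 50, 1%Z); (45, 31, 1%Z); (46, 29, 1%Z); (47, 23, 1%Z); (48, 35, 1%Z); (49, 35, 1%Z)];
  [:: (3, 46, 2%Z); (6, 40, 2%Z); (11, 43, 2%Z); (14, 36, -2%Z); (19, 39, -2%Z); (21, 33, 2%Z); (25, 42, -1%Z); (27, 38, 1%Z); (28, 32, -1%Z); (31, 35, -1%Z); (33, 0, -1%Z); (36, 8, -1%Z); (37, 24, 1%Z); (39, 5, -1%Z); (40, 16, 1%Z); (41, 26, -1%Z); (43, 13, 1%Z); (44, 30, 1%Z); (45, 49, -1%Z); (45, 50, 1%Z); (46, 22, -1%Z); (47, 29, 1%Z); (48, 34, -1%Z); (49, 34, -2%Z); (50, 34, -4%Z); (51, 34, -2%Z)];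
  [:: (3, 45, -2%Z); (7, 43, -2%Z); (10, 40, 2%Z); (15, 39, -2%Z); (18, 36, 2%Z); (22, 34, 2%Z); (25, 41, -1%Z); (27, 37, -1%Z); (29, 35, -1%Z); (30, 32, 1%Z); (34, 0, 1%Z); (36, 4, 1%Z); (38, 24, 1%Z); (39, 9, -1%Z); (40, 12, 1%Z); (42, 26, 1%Z); (43, 17, -1%Z); (44, 28, 1%Z); (45, 21, -1%Z); (46, 48, -2%Z); (46, 49, 1%Z); (47, 31, -1%Z); (48, 33, 1%Z)];
  [:: (3, 44, -2%Z); (7, 42, -2%Z); (11, 41, -2%Z); (15, 38, 2%Z); (19, 37, 2%Z); (23, 35, -2%Z); (25, 40, 1%Z); (27, 36, -1%Z); (29, 34, -1%Z); (31, 33, 1%Z); (35, 0, 1%Z); (37, 4, 1%Z); (38, 8, 1%Z); (39, 24, -1%Z); (41, 12, -1%Z); (42, 16, -1%Z); (43, 26, 1%Z); (44, 20, 1%Z); (45, 28, 1%Z); (46, 30, -1%Z); (47, 48, -1%Z); (47, 49, 1%Z); (48, 32, -1%Z); (49, 32, -3%Z); (50, 32, -4%Z); (51, 32, -2%Z)]].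

Definition adX2_data : seq (seq (nat * nat * int)) := [::
  [:: (0, 3, -1%Z)];
  [:: (1, 2, -1%Z)];
  [:: (2, 1, -1%Z)];
  [:: (3, 0, -1%Z)];
  [:: (4, 7, -1%Z)];
  [:: (5, 6, -1%Z)];
  [:: (6, 5, -1%Z)];
  [:: (7, 4, -1%Z)];
  [:: (8, 11, -1%Z)];
  [:: (9, 10, -1%Z)];
  [:: (10, 9, -1%Z)];
  [:: (11, 8, -1%Z)];
  [:: (12, 15, -1%Z)];
  [:: (13, 14, -1%Z)];
  [:: (14, 13, -1%Z)];
  [:: (15, 12, -1%Z)];
  [:: (16, 19, -1%Z)];
  [:: (17, 18, -1%Z)];
  [:: (18, 17, -1%Z)];
  [:: (19, 16, -1%Z)];
  [:: (20, 23, -1%Z)];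
  [:: (21, 22, -1%Z)];
  [:: (22, 21, -1%Z)];
  [:: (23, 20, -1%Z)];
  [:: (0, 2, 1%Z); (1, 3, 1%Z); (4, 6, -1%Z); (5, 7, -1%Z); (8, 10, -1%Z); (9, 11, -1%Z); (24, 25, -1%Z)];
  [:: (2, 0, 1%Z); (3, 1, 1%Z); (6, 4, -1%Z); (7, 5, -1%Z); (10, 8, -1%Z); (11, 9, -1%Z); (25, 24, -1%Z)];
  [:: (0, 1, -1%Z); (2, 3, -1%Z); (12, 14, -1%Z); (13, 15, -1%Z); (16, 18, -1%Z); (17, 19, -1%Z); (26, 27, -1%Z)];
  [:: (1, 0, -1%Z); (3, 2, -1%Z); (14, 12, -1%Z); (15, 13, -1%Z); (18, 16, -1%Z); (19, 17, -1%Z); (27, 26, -1%Z)];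
  [:: (4, 5, 1%Z); (6, 7, 1%Z); (12, 13, 1%Z); (14, 15, 1%Z); (20, 22, 1%Z); (21, 23, 1%Z); (28, 29, -1%Z)];
  [:: (5, 4, 1%Z); (7, 6, 1%Z); (13, 12, 1%Z); (15, 14, 1%Z); (22, 20, 1%Z); (23, 21, 1%Z); (29, 28, -1%Z)];
  [:: (8, 9, 1%Z); (10, 11, 1%Z); (16, 17, 1%Z); (18, 19, 1%Z); (20, 21, -1%Z); (22, 23, -1%Z); (30, 31, -1%Z)];
  [:: (9, 8, 1%Z); (11, 10, 1%Z); (17, 16, 1%Z); (19, 18, 1%Z); (21, 20, -1%Z); (23, 22, -1%Z); (31, 30, -1%Z)];
  [:: (0, 23, -1%Z); (4, 19, 1%Z); (8, 15, 1%Z); (12, 11, 1%Z); (16, 7, 1%Z); (20, 3, -1%Z); (32, 47, -1%Z)];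
  [:: (0, 22, 1%Z); (4, 18, 1%Z); (9, 15, 1%Z); (12, 10, 1%Z); (17, 7, 1%Z); (21, 3, 1%Z); (33, 46, -1%Z)];
  [:: (0, 21, -1%Z); (5, 19, 1%Z); (8, 14, 1%Z); (13, 11, 1%Z); (16, 6, 1%Z); (22, 3, -1%Z); (34, 45, -1%Z)];
  [:: (0, 20, 1%Z); (5, 18, 1%Z); (9, 14, 1%Z); (13, 10, 1%Z); (17, 6, 1%Z); (23, 3, 1%Z); (35, 44, -1%Z)];
  [:: (1, 23, 1%Z); (4, 17, -1%Z); (8, 13, -1%Z); (14, 11, -1%Z); (18, 7, -1%Z); (20, 2, 1%Z); (36, 43, -1%Z)];
  [:: (1, 22, -1%Z); (4, 16, -1%Z); (9, 13, -1%Z); (14, 10, -1%Z); (19, 7, -1%Z); (21, 2, -1%Z); (37, 42, -1%Z)];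
  [:: (1, 21, 1%Z); (5, 17, -1%Z); (8, 12, -1%Z); (15, 11, -1%Z); (18, 6, -1%Z); (22, 2, 1%Z); (38, 41, -1%Z)];
  [:: (1, 20, -1%Z); (5, 16, -1%Z); (9, 12, -1%Z); (15, 10, -1%Z); (19, 6, -1%Z); (23, 2, -1%Z); (39, 40, -1%Z)];
  [:: (2, 23, -1%Z); (6, 19, -1%Z); (10, 15, -1%Z); (12, 9, -1%Z); (16, 5, -1%Z); (20, 1, -1%Z); (40, 39, -1%Z)];
  [:: (2, 22, 1%Z); (6, 18, -1%Z); (11, 15, -1%Z); (12, 8, -1%Z); (17, 5, -1%Z); (21, 1, 1%Z); (41, 38, -1%Z)];
  [:: (2, 21, -1%Z); (7, 19, -1%Z); (10, 14, -1%Z); (13, 9, -1%Z); (16, 4, -1%Z); (22, 1, -1%Z); (42, 37, -1%Z)];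
  [:: (2, 20, 1%Z); (7, 18, -1%Z); (11, 14, -1%Z); (13, 8, -1%Z); (17, 4, -1%Z); (23, 1, 1%Z); (43, 36, -1%Z)];
  [:: (3, 23, 1%Z); (6, 17, 1%Z); (10, 13, 1%Z); (14, 9, 1%Z); (18, 5, 1%Z); (20, 0, 1%Z); (44, 35, -1%Z)];
  [:: (3, 22, -1%Z); (6, 16, 1%Z); (11, 13, 1%Z); (14, 8, 1%Z); (19, 5, 1%Z); (21, 0, -1%Z); (45, 34, -1%Z)];
  [:: (3, 21, 1%Z); (7, 17, 1%Z); (10, 12, 1%Z); (15, 9, 1%Z); (18, 4, 1%Z); (22, 0, 1%Z); (46, 33, -1%Z)];
  [:: (3, 20, -1%Z); (7, 16, 1%Z); (11, 12, 1%Z); (15, 8, 1%Z); (19, 4, 1%Z); (23, 0, -1%Z); (47, 32, -1%Z)]].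

Notation dim_adj := 52%N.

Section Chevalley.
Variable L : fieldType.

Definition sparse_mx (l : seq (nat * nat * int)) : 'M[L]_dim_adj :=
  \matrix_(i, j) \sum_(e <- l | (e.1.1 == i :> nat) && (e.1.2 == j :> nat))
                    (e.2)%:~R.

Definition adX (r : F4root) : 'M[L]_dim_adj := sparse_mx (nth [::] adX_data r).
Definition adX2 (r : F4root) : 'M[L]_dim_adj := sparse_mx (nth [::] adX2_data r).

Definition u_el (r : F4root) (t : L) : 'M[L]_dim_adj :=
  1 + t *: adX r + t ^+ 2 *: adX2 r.

Definition n_el (r : F4root) (t : L) : 'M[L]_dim_adj :=
  u_el r t * u_el (opp_root r) t^-1 * u_el r t.

Definition h_el (r : F4root) (t : L) : 'M[L]_dim_adj := n_el r t * n_el r 1.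

Definition n_e4 : 'M[L]_dim_adj :=
  u_el e4 1 * u_el (opp_root e4) 1 * u_el e4 1.

Inductive gen (S : 'M[L]_dim_adj -> Prop) : 'M[L]_dim_adj -> Prop :=
| gen_one : gen S 1
| gen_mul s g : S s -> gen S g -> gen S (s * g)
| gen_inv s g : S s -> gen S g -> gen S (s^-1 * g).

Definition is_subfield (S : L -> Prop) : Prop :=
  S 0 /\ S 1 /\ (forall x y, S x -> S y -> S (x + y)) /\
  (forall x, S x -> S (- x)) /\ (forall x y, S x -> S y -> S (x * y)) /\
  (forall x, S x -> S x^-1).

Definition poly_over (S : L -> Prop) (p : {poly L}) : Prop :=
  forall i, S p`_i.

Definition irreducible_over (S : L -> Prop) (p : {poly L}) : Prop :=
  poly_over S p /\ (1 < size p)%N /\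
  forall q r : {poly L}, poly_over S q -> poly_over S r -> p = q * r ->
    size q = 1%N \/ size r = 1%N.

(* K = k(gamma) inside L *)
Definition Kset (k : L -> Prop) (gamma : L) (x : L) : Prop :=
  exists a b, k a /\ k b /\ x = a + b * gamma.

Variables (k : L -> Prop) (gamma : L).

Definition admissible (r : F4root) (t : L) : Prop :=
  if long_root r then Kset k gamma t else True.

Definition U_root (r : F4root) (x : 'M[L]_dim_adj) : Prop :=
  exists t, admissible r t /\ x = u_el r t.

Definition F4KL : 'M[L]_dim_adj -> Prop := gen (fun x => exists r, U_root r x).

Definition UJ : 'M[L]_dim_adj -> Prop :=
  gen (fun x => exists r t, positive_root r /\ ~~ in_PhiJ r /\ x = u_el r t).
Definition UJm : 'M[L]_dim_adj -> Prop :=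
  gen (fun x => exists r t, negative_root r /\ ~~ in_PhiJ r /\ x = u_el r t).
Definition LJ : 'M[L]_dim_adj -> Prop :=
  gen (fun x => (exists r t, t != 0 /\ x = h_el r t) \/
                (exists r t, in_PhiJ r /\ x = u_el r t)).
Definition PJ (x : 'M[L]_dim_adj) : Prop :=
  exists a b, UJ a /\ LJ b /\ x = a * b.

Definition UJ_KL x := UJ x /\ F4KL x.
Definition UJm_KL x := UJm x /\ F4KL x.
Definition LJ_KL x := LJ x /\ F4KL x.
Definition PJ_KL x := PJ x /\ F4KL x.

Definition Uw_minus : 'M[L]_dim_adj -> Prop :=
  gen (fun x => exists r, positive_root r /\ ~~ in_PhiJ r /\
                          negative_root (w_e4 r) /\ U_root r x).

Variable sigma : 'M[L]_dim_adj -> 'M[L]_dim_adj.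

Definition Fix (x : 'M[L]_dim_adj) : Prop := F4KL x /\ sigma x = x.

Definition U1 x := UJ_KL x /\ Fix x.
Definition V1 x := UJm_KL x /\ Fix x.
Definition G1 : 'M[L]_dim_adj -> Prop := gen (fun x => U1 x \/ V1 x).
Definition B1 x := PJ_KL x /\ G1 x.

End Chevalley.

(* Main.v *)
Require Import Defs.
From HB Require Import structures.
From mathcomp Require Import all_boot all_order all_algebra.
From mathcomp Require Import ring.
From Stdlib Require BinNat.

Set Implicit Arguments.
Unset Strict Implicit.
Unset Printing Implicit Defensive.

Import Order.TTheory GRing.Theory Num.Theory.
Local Open Scope ring_scope.

(** In characteristic 2 every root element is an involution and the adjoint
    root elements act through matrices over F_2[t], so identities between
    words in root elements (commutator formulas, action of the n_r, relations
    of the Weyl group) are decided by letting both words act on a generic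
    vector with coordinates in a polynomial ring over F_2.

    A BN-pair argument along the simple roots writes every g in F4(K,L) as
    u n_s p h with u a product of positive root elements, p in the parabolic
    subgroup of J, h in the torus, and n_s mapping the highest short root e4
    to a short root s.  Then x := g X_{e4} is proportional to u X_s.
    The automorphism sigma is conjugation by a bar-semilinear map permuting the root lines,
    so sigma g = g makes x a fixed vector.  The component of x of lowest
    e4-degree is a null vector of the spin module (degree +-1/2) or of the
    vector module (degree 0) of B3 that satisfies K-rationality constraints
    preserved by the mixed group; for sigma-fixed vectors the null condition is
    a zero of the anisotropic form q.  Hence s = e4, that is g in P_J, or
    s = -e4, and then g lies in the big cell.  There the decomposition is
    unique by the e4-grading, so its factors are sigma-fixed. *)

(** * Reflection of identities over F_2 *)

(** Anisotropy of q is available on ell + K^3 only, whereas the fixed vector x has coordinates in L;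
    hence rationality over K must be carried along the orbit of X_{e4}. In degree +-1/2 the K-valued
    quantities are quadratic forms whose weights are long roots, and L^2 inside K makes them
    insensitive to scaling x. In degree 0 they are the coordinates themselves, so x is rational only
    up to a common scalar of L; sigma-invariance and Hilbert 90 for K/k write that scalar as an
    element of ell times one of K.

    X_{e4} is the right vector because e4 is the dominant short root: root elements of P_J fix it,
    torus elements scale it, and the double cosets of U^+ and P_J correspond to the short roots. The
    constants c_r are prescribed on simple roots; applying sigma to n_{-i}(1) = n_i(1) gives them on
    the negatives, and these root groups together generate the whole mixed group. *)

Notation bnat := BinNums.N.
Notation bn k := (BinNat.N.of_nat k).

Definition mono := seq bnat.
Definition poly2 := seq mono.

(* Variables 0..51 are the coordinates of a vector, 52 and 53 are free
   parameters, and (54, 55), (56, 57) are pairs of mutually inverse parameters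
   (see [env] below); monomials are kept sorted and free of such pairs. *)
Definition cancels (v w : bnat) : bool :=
  has (fun e => BinNat.N.eqb v e.1 && BinNat.N.eqb w e.2)
    [:: (bn 54, bn 55); (bn 55, bn 54); (bn 56, bn 57); (bn 57, bn 56)].

Fixpoint mins (v : bnat) (m : mono) : mono :=
  if m is w :: m' then
    if cancels v w then m'
    else if BinNat.N.leb v w then v :: m else w :: mins v m'
  else [:: v].

Definition mmul (m1 m2 : mono) : mono := foldr mins m2 m1.

Fixpoint meq (m1 m2 : mono) : bool :=
  match m1, m2 with
  | [::], [::] => true
  | v :: m1', w :: m2' => BinNat.N.eqb v w && meq m1' m2'
  | _, _ => false
  end.

Fixpoint toggle (m : mono) (p : poly2) : poly2 :=
  if p is m' :: p' then if meq m m' then p' else m' :: toggle m p' else [:: m].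

Definition padd (p q : poly2) : poly2 := foldr toggle q p.
Definition peq (p q : poly2) : bool := nilp (padd p q).
Definition pscale (m : mono) (p : poly2) : poly2 :=
  if p is [::] then [::] else foldr (fun m' => toggle (mmul m m')) [::] p.
Definition pmul (p q : poly2) : poly2 :=
  foldr (fun m acc => padd (pscale m q) acc) [::] p.
Definition psum (ps : seq poly2) : poly2 := foldr padd [::] ps.

Definition row_support (l : seq (nat * nat * int)) (i : nat) : seq nat :=
  [seq e.1.2 | e <- l & (e.1.1 == i) && odd `|e.2|%N].

(** Stored in evaluated form, so that the many later checks do not recompute the supports;
    [rows_adXE] and [rows_adX2E] tie the tables back to the data. *)
Definition rows_adX : seq (seq (seq nat)) :=
  Eval vm_compute in [seq mkseq (row_support l) 52 | l <- adX_data].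
Definition rows_adX2 : seq (seq (seq nat)) :=
  Eval vm_compute in [seq mkseq (row_support l) 52 | l <- adX2_data].

Definition vec := seq poly2.
Definition gather (V : vec) (js : seq nat) : poly2 :=
  psum [seq nth [::] V j | j <- js].

Definition sact (r : nat) (m : mono) (V : vec) : vec :=
  let A := nth [::] rows_adX r in let B := nth [::] rows_adX2 r in
  let m2 := mmul m m in
  mkseq (fun i => padd (pscale m (gather V (nth [::] A i)))
          (padd (pscale m2 (gather V (nth [::] B i))) (nth [::] V i))) 52.

Definition prog := seq (nat * mono).
Definition run (p : prog) (V : vec) : vec := foldr (fun e => sact e.1 e.2) V p.
Definition generic : vec := mkseq (fun i => [:: [:: bn i]]) 52.
Definition veq (V W : vec) : bool :=
  all (fun i => peq (nth [::] V i) (nth [::] W i)) (iota 0 52).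
(** The variables 0..51 take values depending on the vector acted upon; excluding them makes the
    matrix of a program independent of that vector ([mat_env]). *)
Definition param_only (p : prog) : bool :=
  all (fun e => all (fun n => BinNat.N.leb (bn 52) n) e.2) p.
Definition progeq (p q : prog) : bool :=
  [&& param_only p, param_only q & veq (run p generic) (run q generic)].
Definition basis (j : nat) : vec := mkseq (fun i => if i == j then [:: [::]] else [::]) 52.

(** * Combinatorics of the root system on root numbers *)

Definition root_ix (v : seq int) : nat := index v F4_roots.
Definition vadd (u v : seq int) : seq int := [seq x.1 + x.2 | x <- zip u v].
Definition vscale (c : int) (v : seq int) : seq int := [seq c * x | x <- v].
Definition dot (u v : seq int) : int :=
  foldr (fun x acc => x.1 * x.2 + acc) 0 (zip u v).
Definition opp_tab : seq nat :=
  Eval vm_compute in [seq root_ix [seq - x | x <- v] | v <- F4_roots].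
(* Roots are handled through their numbers in [F4_roots]; 48 stands for
   "not a root". *)
Definition oppn r := nth 48 opp_tab r.
Definition refl_tab : seq (seq nat) :=
  Eval vm_compute in
  [seq [seq root_ix (vadd s (vscale (- ((2 * dot s r)%R %/ dot r r)%Z) r))
       | s <- F4_roots] | r <- F4_roots].
Definition refl r s := nth 48 (nth [::] refl_tab r) s.
Definition sum_tab : seq (seq nat) :=
  Eval vm_compute in
  [seq [seq root_ix (vadd r s) | s <- F4_roots] | r <- F4_roots].
Definition rsum r s := nth 48 (nth [::] sum_tab r) s.
Definition sig_tab : seq nat :=
  Eval vm_compute in
  [seq root_ix [:: - v`_0; - v`_1; - v`_2; v`_3] | v : seq int <- F4_roots].
Definition sigr r := nth 48 sig_tab r.
Definition we4_tab : seq nat :=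
  Eval vm_compute in
  [seq root_ix [:: v`_0; v`_1; v`_2; - v`_3] | v : seq int <- F4_roots].
Definition we4n r := nth 48 we4_tab r.
Definition deg_tab : seq nat :=
  Eval vm_compute in [seq absz (v`_3 + 2) | v : seq int <- F4_roots].
(* Twice the e4-coordinate plus 2, so that the toral basis vectors get degree 2. *)
Definition deg i := nth 2 deg_tab i.
(** Lexicographic positivity with respect to the order e4, e1, e2, e3 of the coordinates. The four
    simple roots are positive in this sense, so this is the positive system they generate. *)
Definition pos_tab : seq bool :=
  Eval vm_compute in
  [seq has (fun k => (0 < v`_k) && all (fun j => v`_j == 0) [seq j <- [:: 3; 0; 1; 2]%N | (index j [:: 3; 0; 1; 2] < index k [:: 3; 0; 1; 2])%N]) [:: 3; 0; 1; 2]%N | v <- F4_roots].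
Definition posn r := nth false pos_tab r.
Definition longn (r : nat) := (r < 24)%N.
Definition shortn (r : nat) := (24 <= r < 48)%N.

Definition simple : seq nat := [:: 46; 28; 13; 1]%N.

(** A short root other than the dominant one, e4, has a negative product with some simple root, and
    reflecting in that root raises it. The lengths are at most 15, the number of positive roots
    outside Phi_J, so fuel 20 is enough. *)
Fixpoint word_fuel n (s : nat) : seq nat :=
  if n is n'.+1 then
    if s == 30 then [::] else
    let i := nth 0%N simple
      (find (fun i => dot (nth [::] F4_roots i) (nth [::] F4_roots s) < 0) simple) in
    i :: word_fuel n' (refl i s)
  else [::].
(* For a short root s, [word s] spells the shortest Weyl group element that
   maps e4 (root 30) to s. *)
Definition word_tab : seq (seq nat) :=
  Eval vm_compute in mkseq (fun s => if shortn s then word_fuel 20 s else [::]) 48.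
Definition word s := nth [::] word_tab s.

(** Positive roots are lowered and negative ones raised until a simple root is reached; a negative
    root ends with the reflection from -alpha_i to alpha_i. *)
Fixpoint root_word_fuel n (r : nat) : seq nat * nat :=
  if n is n'.+1 then
    if r \in simple then ([::], r) else
    let i := nth 0%N simple
      (find (fun i => let d := dot (nth [::] F4_roots i) (nth [::] F4_roots r) in
                      if posn r then 0 < d else d < 0) simple) in
    let p := root_word_fuel n' (refl i r) in (i :: p.1, p.2)
  else ([::], r).
Definition root_word_tab : seq (seq nat * nat) :=
  Eval vm_compute in mkseq (root_word_fuel 20) 48.
Definition root_word r := nth ([::], 0%N) root_word_tab r.

(** * Soundness of the reflection *)

Section Soundness.
Variable L : fieldType.
Hypothesis char2 : (2%:R : L) = 0.
Implicit Types (rho : bnat -> L).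

Lemma addrr2 (V : lmodType L) (x : V) : x + x = 0.
Proof. by rewrite -mulr2n -scaler_nat char2 scale0r. Qed.

Lemma oppr2 (V : lmodType L) (x : V) : - x = x.
Proof. by apply/eqP; rewrite -subr_eq0 -opprD addrr2 oppr0. Qed.

Lemma addff (x : L) : x + x = 0.
Proof. exact: (addrr2 (x : L^o)). Qed.

Lemma intr2 (z : int) : z%:~R = (odd `|z|%N)%:R :> L.
Proof.
have E n : n%:R = (odd n)%:R :> L.
  by rewrite -{1}(odd_double_half n) natrD -muln2 natrM char2 mulr0 addr0.
case: z => n /=; first by rewrite -E.
rewrite NegzE mulrNz; have /= -> := oppr2 (n.+1%:R : L^o); exact: E.
Qed.

Definition env_ok rho := forall v w, cancels v w -> rho v * rho w = 1.

Definition meval rho (m : mono) : L := \prod_(v <- m) rho v.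
Definition peval rho (p : poly2) : L := \sum_(m <- p) meval rho m.
Definition veval rho (V : vec) : 'cV[L]_52 :=
  \col_i peval rho (nth [::] V i).

Lemma meval_cons rho v m : meval rho (v :: m) = rho v * meval rho m.
Proof. exact: big_cons. Qed.

Lemma meval_mins rho v m : env_ok rho -> meval rho (mins v m) = rho v * meval rho m.
Proof.
move=> ok; elim: m => [|w m IH] /=; first by rewrite meval_cons.
case: ifP => [c|_]; first by rewrite meval_cons mulrA ok // mul1r.
by case: ifP => _; rewrite !meval_cons // IH mulrCA.
Qed.

Lemma meval_mul rho m1 m2 :
  env_ok rho -> meval rho (mmul m1 m2) = meval rho m1 * meval rho m2.
Proof.
move=> ok; elim: m1 => [|v m1 IH] /=; first by rewrite /meval big_nil mul1r.
by rewrite meval_mins // IH meval_cons mulrA.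
Qed.

Lemma meqP m1 m2 : meq m1 m2 -> m1 = m2.
Proof.
elim: m1 m2 => [|v m1 IH] [|w m2] //= /andP[/BinNat.N.eqb_eq -> /IH ->] //.
Qed.

Lemma peval_cons rho m p : peval rho (m :: p) = meval rho m + peval rho p.
Proof. exact: big_cons. Qed.

Lemma peval_nil rho : peval rho [::] = 0. Proof. exact: big_nil. Qed.

Lemma peval_toggle rho m p : peval rho (toggle m p) = meval rho m + peval rho p.
Proof.
elim: p => [|m' p IH] /=; first by rewrite peval_cons.
case: ifP => [/meqP ->|_]; last by rewrite !peval_cons IH addrCA.
by rewrite peval_cons addrA addff add0r.
Qed.

Lemma peval_add rho p q : peval rho (padd p q) = peval rho p + peval rho q.
Proof.
elim: p => [|m p IH] /=; first by rewrite peval_nil add0r.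
by rewrite -/(padd p q) peval_toggle IH peval_cons addrA.
Qed.

Lemma peval_scale rho m p :
  env_ok rho -> peval rho (pscale m p) = meval rho m * peval rho p.
Proof.
move=> ok; have -> : pscale m p = foldr (fun m' => toggle (mmul m m')) [::] p by case: p.
elim: p => [|m' p IH] /=; first by rewrite peval_nil mulr0.
by rewrite peval_toggle IH peval_cons meval_mul // mulrDr.
Qed.

Lemma peval_mul rho p q :
  env_ok rho -> peval rho (pmul p q) = peval rho p * peval rho q.
Proof.
move=> ok; elim: p => [|m p IH] /=; first by rewrite peval_nil mul0r.
by rewrite peval_add -/(pmul p q) IH peval_scale // peval_cons mulrDl.
Qed.

Lemma peval_sum rho ps : peval rho (psum ps) = \sum_(p <- ps) peval rho p.
Proof.
elim: ps => [|p ps IH]; first by rewrite big_nil peval_nil.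
by rewrite big_cons -IH -peval_add.
Qed.

Lemma peqP rho p q : peq p q -> peval rho p = peval rho q.
Proof.
move=> /nilP E; have := peval_add rho p q; rewrite E peval_nil => /esym/eqP.
by rewrite addr_eq0 => /eqP ->; exact: (oppr2 (peval rho q : L^o)).
Qed.

Definition U (r : nat) (t : L) : 'M[L]_52 :=
  1 + t *: sparse_mx L (nth [::] adX_data r)
    + t ^+ 2 *: sparse_mx L (nth [::] adX2_data r).

Lemma sparse_mulE (l : seq (nat * nat * int)) n (X : 'M[L]_(52, n)) i j :
  all (fun e => e.1.2 < 52)%N l ->
  (sparse_mx L l *m X) i j = \sum_(k <- row_support l i) X (inord k) j.
Proof.
move=> lt52; rewrite mxE.
transitivity (\sum_(e <- l | e.1.1 == i) e.2%:~R * X (inord e.1.2) j).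
  under eq_bigr => k _ do rewrite mxE big_distrl /= big_mkcond /=.
  rewrite exchange_big /= [RHS]big_mkcond /= big_seq [RHS]big_seq.
  apply: eq_bigr => e el; have le := allP lt52 _ el.
  rewrite (bigD1 (inord e.1.2)) //= inordK // eqxx andbT big1 ?addr0 // => k /eqP ne.
  case: andP => [[_ /eqP E]|//]; case: ne; apply: val_inj; by rewrite /= inordK.
rewrite big_map big_filter [LHS]big_mkcond [RHS]big_mkcond /=.
apply: eq_bigr => e _; case: ifP => //= _; rewrite intr2.
by case: odd; rewrite ?mul1r ?mul0r.
Qed.

Lemma cols_lt52 :
  all (all (fun e : nat * nat * int => e.1.2 < 52)%N) adX_data &&
  all (all (fun e : nat * nat * int => e.1.2 < 52)%N) adX2_data.
Proof. by vm_compute. Qed.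

Lemma rows_adXE : rows_adX = [seq mkseq (row_support l) 52 | l <- adX_data].
Proof. by vm_compute. Qed.
Lemma rows_adX2E : rows_adX2 = [seq mkseq (row_support l) 52 | l <- adX2_data].
Proof. by vm_compute. Qed.

Lemma nth_rows data r (i : 'I_52) :
  nth [::] (nth [::] [seq mkseq (row_support l) 52 | l <- data] r) i
  = row_support (nth [::] data r) i.
Proof.
case: (ltnP r (size data)) => h; first by rewrite (nth_map [::]) // nth_mkseq.
by rewrite !nth_default ?size_map //= .
Qed.

Lemma sparse_nth data r n (X : 'M[L]_(52, n)) i j :
  all (all (fun e : nat * nat * int => e.1.2 < 52)%N) data ->
  (sparse_mx L (nth [::] data r) *m X) i j =
  \sum_(k <- nth [::] (nth [::] [seq mkseq (row_support l) 52 | l <- data] r) i)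
     X (inord k) j.
Proof.
move=> h; rewrite nth_rows; apply: sparse_mulE.
case: (ltnP r (size data)) => hr; last by rewrite nth_default.
exact: (allP h) (mem_nth _ hr).
Qed.

Lemma adX_mulE r n (X : 'M[L]_(52, n)) i j :
  (sparse_mx L (nth [::] adX_data r) *m X) i j =
  \sum_(k <- nth [::] (nth [::] rows_adX r) i) X (inord k) j.
Proof. by have /andP[h _] := cols_lt52; rewrite rows_adXE; apply: sparse_nth. Qed.

Lemma adX2_mulE r n (X : 'M[L]_(52, n)) i j :
  (sparse_mx L (nth [::] adX2_data r) *m X) i j =
  \sum_(k <- nth [::] (nth [::] rows_adX2 r) i) X (inord k) j.
Proof. by have /andP[_ h] := cols_lt52; rewrite rows_adX2E; apply: sparse_nth. Qed.

Lemma U_mulE r t n (X : 'M[L]_(52, n)) i j :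
  (U r t *m X) i j =
  t * (\sum_(k <- nth [::] (nth [::] rows_adX r) i) X (inord k) j)
  + (t ^+ 2 * (\sum_(k <- nth [::] (nth [::] rows_adX2 r) i) X (inord k) j) + X i j).
Proof.
rewrite -adX_mulE -adX2_mulE /U.
move: (sparse_mx L _) (sparse_mx L _) => A B.
rewrite !mulmxDl mul1mx -!scalemxAl !mxE.
by rewrite [RHS]addrA [RHS]addrC [RHS]addrA.
Qed.

Lemma rows_bound : all (all (all (fun k => k < 52)%N)) rows_adX &&
  all (all (all (fun k => k < 52)%N)) rows_adX2.
Proof. by vm_compute. Qed.

Lemma peval_gather rho V (js : seq nat) : all (fun k => k < 52)%N js ->
  peval rho (gather V js) = \sum_(k <- js) veval rho V (inord k) 0.
Proof.
move=> /allP h; rewrite peval_sum big_map big_seq [RHS]big_seq.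
by apply: eq_bigr => k kj; rewrite mxE inordK // h.
Qed.

Lemma all_nth (T : Type) (P : pred T) x0 s i : P x0 -> all P s -> P (nth x0 s i).
Proof.
move=> P0 /all_nthP h; case: (ltnP i (size s)) => hi; first exact: h.
by rewrite nth_default.
Qed.

Lemma veval_sact rho r m V : env_ok rho ->
  veval rho (sact r m V) = U r (meval rho m) *m veval rho V.
Proof.
move=> ok; apply/matrixP => i j; rewrite (ord1 j) U_mulE mxE nth_mkseq //.
have /andP[h1 h2] := rows_bound.
rewrite !peval_add !peval_scale // !meval_mul // -expr2 !peval_gather ?mxE //;
  by do 2!apply: all_nth => //.
Qed.

Definition mat rho (p : prog) : 'M[L]_52 :=
  foldr (fun e acc => U e.1 (meval rho e.2) * acc) 1 p.

Lemma veval_run rho p V : env_ok rho ->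
  veval rho (run p V) = mat rho p *m veval rho V.
Proof.
move=> ok; elim: p => [|e p IH] /=; first by rewrite mul1mx.
by rewrite veval_sact // -/(run p V) IH mulmxA.
Qed.

Lemma veqP rho V W : veq V W -> veval rho V = veval rho W.
Proof.
move=> /allP h; apply/matrixP => i j; rewrite !mxE; apply: peqP; apply: h.
by rewrite mem_iota /=.
Qed.

Definition env (x : nat -> L) (t v a b : L) : bnat -> L := fun n =>
  let n := BinNat.N.to_nat n in
  if (n < 52)%N then x n else nth 1 [:: t; v; a; a^-1; b; b^-1] (n - 52).

Lemma env_okP x t v a b : a != 0 -> b != 0 -> env_ok (env x t v a b).
Proof.
move=> a0 b0 p q /hasP[e]; rewrite !inE => /or4P[] /eqP -> /andP[];
  by move=> /BinNat.N.eqb_eq -> /BinNat.N.eqb_eq ->;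
     rewrite /env /= ?mulfV ?mulVf.
Qed.

Lemma veval_generic (x : 'cV[L]_52) t v a b :
  veval (env (fun i => x (inord i) 0) t v a b) generic = x.
Proof.
apply/matrixP => i j; rewrite (ord1 j) mxE nth_mkseq // peval_cons peval_nil addr0.
rewrite meval_cons /meval big_nil mulr1 /env Nnat.Nat2N.id ltn_ord inord_val //.
Qed.

Definition params (t v a b : L) := env (fun=> 0) t v a b.

Lemma mat_env x t v a b p : param_only p ->
  mat (env x t v a b) p = mat (params t v a b) p.
Proof.
elim: p => [//|e p IH] /= /andP[pe /IH ->]; congr (U _ _ * _).
apply: eq_big_seq => n /(allP pe) /BinNat.N.leb_le le.
rewrite /params /env; case: ltnP => // lt52; move: le.
rewrite /BinNat.N.le Nnat.N2Nat.inj_compare.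
move/PeanoNat.Nat.compare_le_iff/ssrnat.leP => le.
by have : (52 <= BinNat.N.to_nat n)%N := le; rewrite leqNgt lt52.
Qed.

Lemma mulmx_ext (A B : 'M[L]_52) : (forall x : 'cV_52, A *m x = B *m x) -> A = B.
Proof.
by move=> h; apply/matrixP => i j; have /matrixP/(_ i 0) := h (delta_mx j 0);
  rewrite -!colE !mxE.
Qed.

(** The generic vector specialises to every column x, and matrices that agree on all columns are
    equal; the parameters stay the same for all x. *)
Lemma progeqP p q t v a b : a != 0 -> b != 0 -> progeq p q ->
  mat (params t v a b) p = mat (params t v a b) q.
Proof.
move=> a0 b0 /and3P[pp pq /veqP E]; apply: mulmx_ext => x.
have := E (env (fun i => x (inord i) 0) t v a b).
by rewrite !veval_run ?veval_generic ?mat_env //; exact: env_okP.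
Qed.

Lemma mat_cat rho p q : mat rho (p ++ q) = mat rho p * mat rho q.
Proof. by elim: p => [|e p IH] /=; rewrite ?mul1r // IH mulrA. Qed.

Lemma veval_basis rho j : (j < 52)%N -> veval rho (basis j) = delta_mx (inord j) 0.
Proof.
move=> j52; apply/matrixP => i k; rewrite (ord1 k) !mxE nth_mkseq // eqxx andbT.
rewrite -val_eqE /= inordK //; case: eqP => _; last by rewrite peval_nil.
by rewrite peval_cons peval_nil addr0 /meval big_nil.
Qed.

Lemma mat_entry rho p i j : env_ok rho ->
  mat rho p i j = peval rho (nth [::] (run p (basis j)) i).
Proof.
move=> ok; have /matrixP/(_ i 0) := veval_run p (basis j) ok.
by rewrite veval_basis // inord_val -colE !mxE => <-.
Qed.

End Soundness.

(** * Decidable facts about root elements *)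

Definition isroot r := (r < 48)%N.
Definition root_range := iota 0 48.

Lemma all_rootsP (P : pred nat) : all P root_range -> forall r, isroot r -> P r.
Proof. by move=> /allP h r hr; apply: h; rewrite mem_iota. Qed.

(* u_r(t) u_s(v) u_r(t) as a product of root elements.  In characteristic 2 the
   factor for r + s disappears when s - r is a root as well, because the
   structure constant is then 2 up to sign. *)
Definition conj_prog (r s : nat) : prog :=
  let rs := rsum r s in
  (s, [:: bn 53]) ::
  (if isroot rs && ~~ isroot (rsum (oppn r) s) then
    [:: (rs, [:: bn 52; bn 53])] ++
    (if isroot (rsum r rs) then [:: (rsum r rs, [:: bn 52; bn 52; bn 53])] else [::]) ++
    (if isroot (rsum rs s) then [:: (rsum rs s, [:: bn 52; bn 53; bn 53])] else [::])
  else [::]).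

Definition sgsimple : seq nat := Eval vm_compute in simple ++ map oppn simple.

(** The two situations in which commutator formulas are used: a rank one group acting on the
    remaining positive roots, for the BN-pair argument, and the Levi factor acting on the unipotent
    radical of P_J. *)
Definition conj_case (r s : nat) :=
  [&& r \in sgsimple, posn s, s != r & s != oppn r] || ((deg r == 2) && (2 < deg s)%N).

(** The middle condition makes the formulas respect the mixed group. The parameters are t v, t^2 v
    and t v^2, and K contains all squares, so membership in K only has to be known for the factor
    occurring to the first power, or for both in t v. *)
Definition conj_check r s := if ~~ conj_case r s then true else
  [&& progeq [:: (r, [:: bn 52]); (s, [:: bn 53]); (r, [:: bn 52])] (conj_prog r s),
   [|| ~~ isroot (rsum r s), isroot (rsum (oppn r) s) |
     [&& longn (rsum r s) ==> longn r && longn s,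
         longn (rsum r (rsum r s)) ==> longn s &
         longn (rsum (rsum r s) s) ==> longn r]],
   (r \in sgsimple) && posn s ==> all (fun e => posn e.1 && (e.1 != r) && (e.1 != oppn r)) (conj_prog r s),
   (deg r == 2) && (2 < deg s)%N ==> all (fun e => 2 < deg e.1)%N (conj_prog r s) &
   all (fun e => isroot e.1) (conj_prog r s)].

Lemma conj_checks : all (fun r => all (conj_check r) root_range) root_range.
Proof. by vm_compute. Qed.

Definition nprog r x xi : prog := [:: (r, [:: x]); (oppn r, [:: xi]); (r, [:: x])].
Definition nx r := nprog r (bn 54) (bn 55).
Definition n1 r : prog := [:: (r, [::]); (oppn r, [::]); (r, [::])].
Definition nword w : prog := flatten (map n1 w).

Definition cart_tab : seq (seq int) := Eval vm_compute in
  [seq [seq ((2 * dot s r)%R %/ dot r r)%Z | s <- F4_roots] | r <- F4_roots].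
Definition cart r s := nth 0 (nth [::] cart_tab r) s.
Definition xpow (k : int) : mono :=
  match k with Posz n => nseq n (bn 54) | Negz n => nseq n.+1 (bn 55) end.

(** The last condition keeps parameters of long roots in K: x ^ (- cart r s) lies in K either
    because r is long and x is in K, or because the exponent is even and squares lie in K. *)
Definition nconj_check r s :=
  [&& progeq (nx r ++ [:: (s, [:: bn 52])])
    ((refl r s, bn 52 :: xpow (- cart r s)) :: nx r),
    isroot (refl r s), longn (refl r s) == longn s, refl r (refl r s) == s,
    oppn (refl r s) == refl r (oppn s) &
    longn s ==> longn r || ~~ odd `|cart r s|%N].

Lemma nconj_checks : all (fun r => all (nconj_check r) root_range) simple.
Proof. by vm_compute. Qed.

Definition n_involutive_check r := progeq (nx r) (nprog (oppn r) (bn 55) (bn 54)).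
Lemma ninv_checks : all n_involutive_check simple.
Proof. by vm_compute. Qed.

(* Deodhar: a simple reflection times a minimal coset representative modulo W_J
   is again minimal, up to one simple reflection of J on the right. *)
Definition levi_words : seq (seq nat) := [:: [::]; [:: 28]; [:: 13]; [:: 1]]%N.

Definition step_check i s :=
  shortn (refl i s) && has (fun w => progeq (nword (i :: word s)) (nword (word (refl i s) ++ w))) levi_words.
Lemma step_checks : all (fun i => all (step_check i) (filter shortn root_range)) simple.
Proof. by vm_compute. Qed.

Definition highest_check i s :=
  veq (run (nx i) (basis s)) (map (pscale (xpow (- cart i s))) (basis (refl i s))).
Lemma highest_checks : all (fun i => all (highest_check i) (filter shortn root_range)) simple.
Proof. by vm_compute. Qed.

Definition word_check s := veq (run (nword (word s)) (basis 30)) (basis s).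
Lemma word_checks : all word_check (filter shortn root_range).
Proof. by vm_compute. Qed.

Definition act_word (w : seq nat) (r : nat) : nat := foldr refl r w.

Definition root_word_check r :=
  let p := root_word r in
  [&& all (fun i => i \in simple) p.1, p.2 \in simple & act_word p.1 p.2 == r].
Lemma root_word_checks : all root_word_check root_range.
Proof. by vm_compute. Qed.

(** Parameters of programs are monomials, so u_r(t + v) is not a program. In characteristic 2 it
    equals u_r(t) + u_r(v) + 1, and this sum is what the product is compared with. *)
Definition U_add_check r :=
  veq (run [:: (r, [:: bn 52]); (r, [:: bn 53])] generic)
    (mkseq (fun i => padd (nth [::] (sact r [:: bn 52] generic) i)
       (padd (nth [::] (sact r [:: bn 53] generic) i) (nth [::] generic i))) 52).
Lemma U_add_checks : all U_add_check root_range.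
Proof. by vm_compute. Qed.

(** The longest element of the Weyl group is -1, hence w_{e4} is the longest element times that of
    W_J, that is, the minimal representative sending e4 to -e4. In characteristic 2 the lifts agree
    without a torus correction. *)
Definition word_e4_check := progeq (n1 30) (nword (word 31)).
Lemma word_e4_checkT : word_e4_check. Proof. by vm_compute. Qed.

(** * Root elements in characteristic 2 *)

(** Root elements are involutions in characteristic 2, so the groups they generate are already
    generated as monoids, and inductions have no inverse case. *)
Inductive mon (L : fieldType) (S : 'M[L]_52 -> Prop) : 'M[L]_52 -> Prop :=
| mon1 : mon S 1
| monM s g : S s -> mon S g -> mon S (s * g).

Section Monoids.
Variable L : fieldType.
Implicit Types (S : 'M[L]_52 -> Prop) (g h : 'M[L]_52).

Lemma mon_mul S g h : mon S g -> mon S h -> mon S (g * h).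
Proof. by move=> Sg Sh; elim: Sg => [|s k Ss _ IH]; rewrite ?mul1r // -mulrA; apply: monM. Qed.

Lemma mon_gen S g : S g -> mon S g.
Proof. by move=> Sg; rewrite -(mulr1 g); apply: monM => //; apply: mon1. Qed.

Lemma mon_sub S S' g : (forall s, S s -> mon S' s) -> mon S g -> mon S' g.
Proof.
move=> h; elim=> [|s k Ss _ IH]; first exact: mon1.
by apply: mon_mul => //; apply: h.
Qed.

Lemma mon_gen_sub S S' g : (forall s, S s -> gen S' s) -> mon S g -> gen S' g.
Proof.
have gM a b : gen S' a -> gen S' b -> gen S' (a * b).
  by move=> ga gb; elim: ga => [|s k Ss _ IH|s k Ss _ IH]; rewrite ?mul1r // -mulrA;
    [apply: gen_mul | apply: gen_inv].
by move=> h; elim=> [|s k Ss _ IH]; [apply: gen_one | apply: gM => //; apply: h].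
Qed.

Lemma gen_gen S g : S g -> gen S g.
Proof. by move=> Sg; rewrite -(mulr1 g); apply: gen_mul => //; apply: gen_one. Qed.

Lemma involution_unit g : g * g = 1 -> g \is a GRing.unit /\ g^-1 = g.
Proof.
move=> gg; have u : g \is a GRing.unit by apply/unitrP; exists g.
by split => //; rewrite -[RHS](mulKr u) gg mulr1.
Qed.

Lemma gen_mon S g : (forall s, S s -> s * s = 1) -> gen S g -> mon S g.
Proof.
move=> h; elim=> [|s k Ss _ IH|s k Ss _ IH]; first exact: mon1.
  exact: monM.
by rewrite (involution_unit (h _ Ss)).2; apply: monM.
Qed.

Lemma mon_inv S g : (forall s, S s -> exists2 s', mon S s' & s * s' = 1) ->
  mon S g -> exists2 g', mon S g' & g * g' = 1.
Proof.
move=> h; elim=> [|s k /h[s' Ss' E] _ [k' Sk' E']]; first by exists 1; [apply: mon1 | rewrite mulr1].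
exists (k' * s'); first exact: mon_mul.
by rewrite mulrA -(mulrA s k k') E' mulr1.
Qed.

End Monoids.

Section RootGroups.
Variable L : fieldType.
Hypothesis char2 : (2%:R : L) = 0.
Implicit Types (t v x : L).
Local Notation U := (@U L).

Lemma U0 r : U r 0 = 1.
Proof. by rewrite /U scale0r expr2 mul0r scale0r !addr0. Qed.

Lemma U_add r t v : isroot r -> U r t * U r v = U r (t + v).
Proof.
move=> /(all_rootsP U_add_checks) /(veqP char2) E; apply: mulmx_ext => x.
pose rho := env (fun i => x (inord i) 0) t v 1 1.
have ok : env_ok rho by apply: env_okP; rewrite oner_neq0.
have e m : veval rho (sact r [:: m] generic) = U r (rho m) *m x.
  by rewrite (veval_sact char2) // veval_generic /meval big_cons big_nil mulr1.
transitivity (veval rho (run [:: (r, [:: bn 52]); (r, [:: bn 53])] generic)).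
  rewrite (veval_run char2) // veval_generic /= /meval !big_cons !big_nil !mulr1.
  by rewrite -!mulmxA.
rewrite E; apply/matrixP => i j; rewrite mxE nth_mkseq // !(peval_add char2).
have /matrixP/(_ i j) := e (bn 52); rewrite mxE => ->.
have /matrixP/(_ i j) := e (bn 53); rewrite mxE => ->.
have /matrixP/(_ i j) := veval_generic x t v 1 1; rewrite mxE => ->.
rewrite !(U_mulE char2).
move: (\sum_(k <- _) _) (\sum_(k <- _) _) (x i j) => P Q X.
have -> : rho (bn 52) = t by [].
have -> : rho (bn 53) = v by [].
have /eqP := addff char2 X; rewrite addr_eq0 => /eqP XE.
have tv : (t + v) ^+ 2 = t ^+ 2 + v ^+ 2 by rewrite sqrrD mulr2n addff // addr0.
(* [ring] does not know that 2 = 0, so one of the three copies of X is replaced by -X. *)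
rewrite tv [X in _ + (_ + X)]XE; ring.
Qed.

Lemma U_sq r t : isroot r -> U r t * U r t = 1.
Proof. by move=> hr; rewrite U_add // addff // U0. Qed.

Fact n_key : unit. Proof. exact: tt. Qed.
(* Locked, so that rewriting with associativity does not see through it. *)
Definition n (r : nat) (x : L) : 'M[L]_52 :=
  locked_with n_key (fun r x => U r x * U (oppn r) x^-1 * U r x) r x.

Lemma nE r x : n r x = U r x * U (oppn r) x^-1 * U r x.
Proof. by rewrite /n unlock. Qed.

Lemma oppn_root r : isroot r -> isroot (oppn r).
Proof. by apply: (all_rootsP (P := fun r => isroot (oppn r))); vm_compute. Qed.

Lemma oppnK r : isroot r -> oppn (oppn r) = r.
Proof. by move=> h; apply/eqP; move: r h; apply: all_rootsP; vm_compute. Qed.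

Lemma n_sq r x : isroot r -> n r x * n r x = 1.
Proof.
move=> hr; rewrite nE -!mulrA (mulrA (U r x) (U r x)) U_sq // mul1r.
by rewrite (mulrA (U (oppn r) _)) U_sq ?oppn_root // mul1r U_sq.
Qed.

Lemma U_conj r s t v : isroot r -> isroot s -> conj_case r s ->
  U r t * U s v * U r t = mat (params t v 1 1) (conj_prog r s).
Proof.
move=> hr hs c; have := all_rootsP (all_rootsP conj_checks hr) hs.
rewrite /conj_check c => /and5P[/(progeqP char2 t v) E _ _ _ _].
have {E} := E 1 1 (oner_neq0 _) (oner_neq0 _) => <-.
by rewrite /mat /= /meval !big_cons !big_nil !mulr1 /params /env /= mulrA.
Qed.

Lemma simple_root i : i \in simple -> isroot i.
Proof. by rewrite !inE => /or4P[] /eqP ->. Qed.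

Lemma meval_xpow t v x y k : meval (params t v x y) (xpow k) = x ^ k.
Proof.
case: k => k; rewrite /meval /xpow big_nseq iter_mulr_1 //.
by rewrite /params /env /= exprVn.
Qed.

Lemma mat_cons rho e p : mat rho (e :: p) = U e.1 (meval rho e.2) * mat rho p.
Proof. by []. Qed.

Lemma mat_nil rho : mat rho [::] = 1 :> 'M[L]_52.
Proof. by []. Qed.

Lemma mat_nx t v x y r : mat (params t v x y) (nx r) = n r x.
Proof. by rewrite /mat /= /meval !big_cons !big_nil !mulr1 nE mulrA. Qed.

Lemma mat_n1 rho r : mat rho (n1 r) = n r 1.
Proof. by rewrite /mat /= /meval !big_nil !mulr1 nE invr1 mulrA. Qed.

Lemma nconj_facts i s : i \in simple -> isroot s ->
  [/\ isroot (refl i s), longn (refl i s) = longn s, refl i (refl i s) = s,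
      oppn (refl i s) = refl i (oppn s) &
      longn s -> longn i || ~~ odd `|cart i s|%N].
Proof.
move=> hi hs; have /and5P[_ h1 /eqP h2 /eqP h3 /andP[/eqP h4 /implyP h5]] :=
  all_rootsP (allP nconj_checks i hi) hs.
by [].
Qed.

Lemma n_conj i s x t : i \in simple -> isroot s -> x != 0 ->
  n i x * U s t = U (refl i s) (t * x ^ (- cart i s)) * n i x.
Proof.
move=> hi hs x0; have /andP[E _] := all_rootsP (allP nconj_checks i hi) hs.
have := progeqP char2 t 0 x0 (oner_neq0 _) E.
rewrite mat_cat [mat _ [:: _]]mat_cons mat_nil mulr1 [mat _ (_ :: nx i)]mat_cons !mat_nx.
by rewrite /= !meval_cons meval_xpow /meval big_nil mulr1.
Qed.

Lemma n1_conj i s t : i \in simple -> isroot s ->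
  n i 1 * U s t = U (refl i s) t * n i 1.
Proof. by move=> hi hs; rewrite n_conj ?oner_neq0 // exp1rz mulr1. Qed.

Lemma n_opp i x : i \in simple -> x != 0 -> n (oppn i) x = n i x^-1.
Proof.
move=> hi x0; have xi : x^-1 != 0 by rewrite invr_eq0.
have := progeqP char2 0 0 xi (oner_neq0 _) (allP ninv_checks i hi).
rewrite mat_nx => ->.
by rewrite nE /mat /= /meval !big_cons !big_nil !mulr1 /params /env /= invrK mulrA.
Qed.

Definition nw (w : seq nat) : 'M[L]_52 := foldr (fun i acc => n i 1 * acc) 1 w.

Lemma mat_nword rho w : mat rho (nword w) = nw w.
Proof.
elim: w => [//|i w IH].
by rewrite [LHS](mat_cat rho (n1 i) (nword w)) mat_n1 IH.
Qed.

Lemma nw_cat w w' : nw (w ++ w') = nw w * nw w'.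
Proof. by elim: w => [|i w IH] /=; rewrite ?mul1r // IH mulrA. Qed.

Lemma nw_rev w : all (mem simple) w -> nw w * nw (rev w) = 1.
Proof.
elim: w => [|i w IH] /= => [_|/andP[hi /IH E]]; first by rewrite mulr1.
rewrite rev_cons -cats1 nw_cat /= mulr1 -mulrA (mulrA (nw w)) E mul1r.
by rewrite n_sq ?simple_root.
Qed.

Lemma act_word_facts w s : all (mem simple) w -> isroot s ->
  [/\ isroot (act_word w s), longn (act_word w s) = longn s,
      act_word w (act_word (rev w) s) = s,
      oppn (act_word w s) = act_word w (oppn s) &
      forall t, nw w * U s t = U (act_word w s) t * nw w].
Proof.
elim: w s => [|i w IH] s /= => [_ hs|/andP[hi hw] hs].
  by split=> // t; rewrite mul1r mulr1.
have hiw := hw; have /(IH _ hw) [h1 h2 _ h4 h5] := hs.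
have [g1 g2 g3 g4 _] := nconj_facts hi h1.
split=> //; first by rewrite g2.
- rewrite rev_cons -cats1 /act_word foldr_cat /= -/(act_word (rev w) _) -/(act_word w _).
  have [k1 _ _ _ _] := nconj_facts hi hs.
  by have [_ _ -> _ _] := IH _ hw k1; have [_ _ -> _ _] := nconj_facts hi hs.
- by rewrite g4 h4.
by move=> t; rewrite -mulrA h5 mulrA n1_conj // mulrA.
Qed.

End RootGroups.

(** * Bruhat decomposition *)

Lemma mulE2 (R : pzRingType) (a b c d : R) :
  a * b = c * d -> forall x, a * (b * x) = c * (d * x).
Proof. by move=> E x; rewrite mulrA E mulrA. Qed.

Lemma mulE1 (R : pzRingType) (a b c : R) : a * b = c -> forall x, a * (b * x) = c * x.
Proof. by move=> E x; rewrite mulrA E. Qed.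

Section Bruhat.
Variable L : fieldType.
Hypothesis char2 : (2%:R : L) = 0.
Variable K : L -> Prop.
Hypothesis K1 : K 1.
Hypothesis KD : forall x y, K x -> K y -> K (x + y).
Hypothesis KM : forall x y, K x -> K y -> K (x * y).
Hypothesis KV : forall x, K x -> K x^-1.
Hypothesis Ksq : forall x, K (x ^+ 2).
Local Notation U := (@U L).
Local Notation n := (@n L).
Local Notation nw := (@nw L).

Definition adm r t := if longn r then K t else True.

Lemma admD r t v : adm r t -> adm r v -> adm r (t + v).
Proof. by rewrite /adm; case: longn => //; apply: KD. Qed.
Lemma admV r t : adm r t -> adm r t^-1.
Proof. by rewrite /adm; case: longn => //; apply: KV. Qed.
Lemma adm1 r : adm r 1.
Proof. by rewrite /adm; case: longn. Qed.

Lemma KX x m : K x -> K (x ^+ m).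
Proof. by move=> Kx; elim: m => [|m IH]; rewrite ?expr0 // exprS; apply: KM. Qed.

Lemma K_even_exp (x : L) (c : int) : ~~ odd `|c|%N -> K (x ^ c).
Proof.
have E m : ~~ odd m -> K (x ^+ m).
  by move=> /even_halfK <-; rewrite -muln2 exprM; apply: Ksq.
by case: c => m /= h; [apply: E | apply/KV/E].
Qed.

Lemma K_exp (x : L) (c : int) : K x -> K (x ^ c).
Proof. by move=> Kx; case: c => m; [apply: KX | apply/KV/KX]. Qed.

Definition Ugen (phi : pred nat) (g : 'M[L]_52) : Prop :=
  exists r t, [/\ isroot r, phi r, adm r t & g = U r t].
Definition Umon phi := mon (Ugen phi).

Lemma Umon_U (phi : pred nat) r t : isroot r -> phi r -> adm r t -> Umon phi (U r t).
Proof. by move=> *; apply: mon_gen; exists r, t. Qed.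

Lemma Umon_sub (phi psi : pred nat) g : {subset phi <= psi} -> Umon phi g -> Umon psi g.
Proof.
move=> sub; apply: mon_sub => _ [r [t [hr /sub pr ht ->]]].
exact: Umon_U.
Qed.

Lemma Ugen_sq phi g : Ugen phi g -> g * g = 1.
Proof. by case=> r [t [hr _ _ ->]]; rewrite U_sq. Qed.

Lemma Umon_inv phi g : Umon phi g -> exists2 g', Umon phi g' & g * g' = 1.
Proof.
apply: mon_inv => s hs; exists s; first exact: mon_gen.
exact: Ugen_sq hs.
Qed.

Lemma mon_normal (S S' : 'M[L]_52 -> Prop) g z :
  (forall s, S s -> exists2 s', mon S' s' & g * s = s' * g) ->
  mon S z -> exists2 z', mon S' z' & g * z = z' * g.
Proof.
move=> h; elim=> [|s k /h[s' Ss' E] _ [k' Sk' E']].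
  by exists 1; [apply: mon1 | rewrite mulr1 mul1r].
by exists (s' * k'); [apply: mon_mul | rewrite mulrA E -mulrA E' mulrA].
Qed.

Lemma mat_Umon (phi : pred nat) rho (p : prog) :
  (forall e, e \in p -> [/\ isroot e.1, phi e.1 & adm e.1 (meval rho e.2)]) ->
  Umon phi (mat rho p).
Proof.
elim: p => [_|e p IH h]; first exact: mon1.
apply: monM; last by apply: IH => f hf; apply: h; rewrite inE hf orbT.
by have [] := h e (mem_head _ _); exists e.1, (meval rho e.2).
Qed.

Lemma conj_adm r s t v (e : nat * mono) : isroot r -> isroot s -> conj_case r s ->
  adm r t -> adm s v -> e \in conj_prog r s ->
  adm e.1 (meval (params t v 1 1) e.2).
Proof.
move=> hr hs c ar as_; have := all_rootsP (all_rootsP conj_checks hr) hs.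
rewrite /conj_check c => /and5P[_ hl _ _ _].
rewrite /conj_prog inE => /orP[/eqP ->|] /=.
  by rewrite /meval big_cons big_nil mulr1.
case: ifP => // /andP[h1 h2]; rewrite h1 (negPf h2) /= in hl.
have /and3P[/implyP l1 /implyP l2 /implyP l3] := hl.
rewrite inE mem_cat => /or3P[/eqP ->| |].
- rewrite /adm /= /meval !big_cons !big_nil mulr1; case: ifP => // /l1 /andP[lr ls].
  by move: ar as_; rewrite /adm lr ls; apply: KM.
- case: ifP => // _; rewrite inE => /eqP ->.
  rewrite /adm /= /meval !big_cons !big_nil mulr1; case: ifP => // /l2 ls.
  by move: as_; rewrite /adm ls mulrA -expr2; apply: KM.
case: ifP => // _; rewrite inE => /eqP ->.
rewrite /adm /= /meval !big_cons !big_nil mulr1; case: ifP => // /l3 lr.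
by move: ar; rewrite /adm lr -expr2 => ar; apply: KM.
Qed.

Lemma U_normal (phi : pred nat) r s t v : isroot r -> isroot s -> conj_case r s ->
  adm r t -> adm s v -> all (fun e => phi e.1) (conj_prog r s) ->
  exists2 z, Umon phi z & U r t * U s v = z * U r t.
Proof.
move=> hr hs c ar as_ /allP ph; exists (mat (params t v 1 1) (conj_prog r s)).
  apply: mat_Umon => e he; split; [|exact: ph|exact: conj_adm he].
  have := all_rootsP (all_rootsP conj_checks hr) hs.
  by rewrite /conj_check c => /and5P[_ _ _ _ /allP]; apply.
by rewrite -(U_conj char2) // -!mulrA U_sq // mulr1.
Qed.

Definition posn_except i : pred nat := fun s => posn s && (s != i).

Lemma sgsimple_normal r t g i : i \in simple -> r = i \/ r = oppn i ->
  adm r t -> Umon (posn_except i) g ->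
  exists2 z, Umon (posn_except i) z & U r t * g = z * U r t.
Proof.
move=> hi ri ar; apply: mon_normal => _ [s [v [hs /andP[ps si] av ->]]].
have hr : isroot r by case: ri => ->; rewrite ?oppn_root // simple_root.
have rsg : r \in sgsimple.
  by case: ri => ->; rewrite [sgsimple](_ : _ = simple ++ map oppn simple) //
    mem_cat ?hi ?map_f ?orbT.
have soi : s != oppn i.
  apply: contraTneq ps => ->.
  by move: hi; rewrite !inE => /or4P[] /eqP ->.
have c : conj_case r s.
  by rewrite /conj_case rsg ps; case: ri => ->; rewrite ?oppnK ?simple_root // si soi.
apply: U_normal => //.
have := all_rootsP (all_rootsP conj_checks hr) hs.
rewrite /conj_check c rsg ps => /and5P[_ _ /allP h _ _].
apply/allP => e /h /andP[/andP[p1 p2] p3]; rewrite /posn_except p1 /=.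
by case: ri p2 p3 => ->; rewrite ?oppnK ?simple_root.
Qed.

Lemma pos_decomp i u : i \in simple -> Umon posn u ->
  exists u' v, [/\ Umon (posn_except i) u', adm i v & u = u' * U i v].
Proof.
move=> hi; elim=> [|_ k [r [t [hr pr ar ->]]] _ [u' [v [hu hv ->]]]].
  exists 1, 0; split; [exact: mon1| |by rewrite U0 mulr1].
  by rewrite /adm; case: longn => //; rewrite -(addff char2 1); apply: KD.
have [ri|ri] := eqVneq r i.
  rewrite ri in ar *; have [u'' hu'' E] := sgsimple_normal hi (or_introl (erefl i)) ar hu.
  exists u'', (t + v); split => //; first exact: admD.
  by rewrite mulrA E -mulrA U_add ?simple_root.
exists (U r t * u'), v; split => //; last by rewrite mulrA.
by apply: monM => //; exists r, t; rewrite /posn_except pr.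
Qed.

(** For r = w(i) this is n_r(x) n_r(y) = h_r(x) h_r(y)^-1. Writing it through a simple root needs
    the action of n_i for simple i only and makes stability under conjugation by [nw] immediate. *)
Definition Tgen (g : 'M[L]_52) : Prop := exists w i x y,
  [/\ all (mem simple) w, i \in simple, (x != 0) && (y != 0), adm i x /\ adm i y &
      g = nw w * (n i x * n i y) * nw (rev w)].
Definition Tmon := mon Tgen.

Lemma n_conj_adm i s x t : i \in simple -> isroot s -> x != 0 -> adm i x -> adm s t ->
  exists2 t', adm (refl i s) t' & n i x * U s t = U (refl i s) t' * n i x.
Proof.
move=> hi hs x0 ax at_; exists (t * x ^ (- cart i s)); last exact: n_conj.
have [_ e _ _ h] := nconj_facts hi hs; move: at_; rewrite /adm e.
case: ifP => // /h /orP[li|ev] Kt; apply: KM => //.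
  by apply: K_exp; move: ax; rewrite /adm li.
by apply: K_even_exp; rewrite abszN.
Qed.

Lemma Tgen_conj h s t : Tgen h -> isroot s -> adm s t ->
  exists2 t', adm s t' & h * U s t = U s t' * h.
Proof.
move=> [w [i [x [y [hw hi /andP[x0 y0] [ax ay] ->]]]]] hs at_.
have hrw : all (mem simple) (rev w) by rewrite all_rev.
have [g1 g2 _ _ g5] := act_word_facts char2 hrw hs.
have a1 : adm (act_word (rev w) s) t by rewrite /adm g2.
have [t1 at1 E1] := n_conj_adm hi g1 y0 ay a1.
have [k1 _ k3 _ _] := nconj_facts hi g1.
have [t2 at2 E2] := n_conj_adm hi k1 x0 ax at1.
rewrite k3 in at2 E2.
have [_ f2 _ _ f5] := act_word_facts char2 hw g1.
have [_ _ f3 _ _] := act_word_facts char2 hw hs.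
exists t2; first by move: at2; rewrite /adm g2.
by rewrite -!mulrA g5 (mulE2 E1) (mulE2 E2) (mulE2 (f5 _)) f3.
Qed.

Lemma T_normal phi h g : Tmon h -> Umon phi g ->
  exists2 z, Umon phi z & h * g = z * h.
Proof.
move=> Th Ug; elim: Th => [|s k Ts _ [z hz E]].
  by exists g; rewrite ?mul1r ?mulr1.
have [z' hz' E'] : exists2 z', Umon phi z' & s * z = z' * s.
  apply: mon_normal hz => _ [r [t [hr pr at_ ->]]].
  by have [t' at' ->] := Tgen_conj Ts hr at_; exists (U r t') => //; apply: Umon_U.
by exists z' => //; rewrite -mulrA E !mulrA E'.
Qed.

Lemma nw_T w h : all (mem simple) w -> Tmon h ->
  exists2 h', Tmon h' & nw w * h = h' * nw w.
Proof.
move=> hw; apply: mon_normal => _ [w1 [i [x [y [hw1 hi xy0 axy ->]]]]].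
have hrw : all (mem simple) (rev w) by rewrite all_rev.
exists (nw (w ++ w1) * (n i x * n i y) * nw (rev (w ++ w1))).
  by apply: mon_gen; exists (w ++ w1), i, x, y; split; rewrite ?all_cat ?hw.
have := nw_rev char2 hrw; rewrite revK => E.
by rewrite rev_cat !nw_cat -!mulrA E mulr1.
Qed.

Lemma T_nw w h : all (mem simple) w -> Tmon h ->
  exists2 h', Tmon h' & h * nw w = nw w * h'.
Proof.
move=> hw Th; have hrw : all (mem simple) (rev w) by rewrite all_rev.
have [h' Th' E] := nw_T hrw Th; exists h' => //.
have E1 := nw_rev char2 hrw; rewrite revK in E1.
by rewrite -[LHS]mul1r -(nw_rev char2 hw) -!mulrA (mulE2 E) E1 mulr1.
Qed.

Definition Pphi : pred nat := fun r => (2 <= deg r)%N.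

(** The double cosets of U^+ and P_J are indexed by W/W_J, that is, by the short roots s. The torus
    factor is kept apart because the root elements allowed in p fix X_{e4}, while h may scale it. *)
Definition cell (g : 'M[L]_52) : Prop := exists u s p h,
  [/\ Umon posn u, shortn s, Umon Pphi p, Tmon h & g = u * nw (word s) * p * h].

Lemma word_simple s : isroot s -> all (mem simple) (word s).
Proof. by apply: (all_rootsP (P := fun s => all (mem simple) (word s))); vm_compute. Qed.

Lemma shortn_root s : shortn s -> isroot s.
Proof. by case/andP. Qed.

Lemma levi_Umon w : w \in levi_words -> Umon Pphi (nw w).
Proof.
have H j : j \in [:: 28; 13; 1]%N -> Umon Pphi (n j 1).
  move=> hj; have jr : isroot j by move: hj; rewrite !inE => /or3P[] /eqP ->.
  have dj : Pphi j && Pphi (oppn j) by move: hj; rewrite !inE => /or3P[] /eqP ->.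
  case/andP: dj => d1 d2; rewrite nE invr1.
  by do !apply: mon_mul; apply: Umon_U; rewrite ?oppn_root //; apply: adm1.
by rewrite !inE => /or4P[] /eqP -> /=; rewrite ?mulr1; [apply: mon1 | apply: H..].
Qed.

Lemma nw_step i s : i \in simple -> shortn s ->
  exists2 m, Umon Pphi m & shortn (refl i s) /\ n i 1 * nw (word s) = nw (word (refl i s)) * m.
Proof.
move=> hi hs; have /andP[h1 /hasP[w hw E]] : step_check i s.
  by apply: (allP (allP step_checks i hi)); rewrite mem_filter hs mem_iota; case/andP: hs.
exists (nw w); first exact: levi_Umon.
split=> //; have := progeqP char2 0 0 (oner_neq0 _) (oner_neq0 _) E.
by rewrite !mat_nword nw_cat.
Qed.

Lemma cell_T h g : Tmon h -> cell g -> cell (h * g).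
Proof.
move=> Th [u [s [p [h0 [hu hs hp Th0 ->]]]]].
have [u' hu' E1] := T_normal Th hu.
have [h' Th' E2] := T_nw (word_simple (shortn_root hs)) Th.
have [p' hp' E3] := T_normal Th' hp.
exists u', s, p', (h' * h0); split => //; first exact: mon_mul.
by rewrite -!mulrA (mulE2 E1) (mulE2 E2) (mulE2 E3).
Qed.

Lemma cell_U r t g : isroot r -> posn r -> adm r t -> cell g -> cell (U r t * g).
Proof.
move=> hr pr at_ [u [s [p [h [hu hs hp Th ->]]]]].
exists (U r t * u), s, p, h; split; rewrite ?mulrA //.
by apply: monM => //; exists r, t.
Qed.

Lemma cell_Up u g : Umon posn u -> cell g -> cell (u * g).
Proof.
move=> hu cg; elim: hu => [|_ k [r [t [hr pr ar ->]]] _ IH]; first by rewrite mul1r.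
by rewrite -mulrA; apply: cell_U.
Qed.

Lemma simple_pos i : i \in simple -> posn i.
Proof. by rewrite !inE => /or4P[] /eqP ->. Qed.

Lemma simple_n_T i x y : i \in simple -> x != 0 -> y != 0 -> adm i x -> adm i y ->
  Tmon (n i x * n i y).
Proof.
move=> hi x0 y0 ax ay; apply: mon_gen; exists [::], i, x, y.
by split; rewrite ?x0 // mul1r mulr1.
Qed.

Lemma cell_n i x s p h : i \in simple -> x != 0 -> adm i x -> shortn s ->
  Umon Pphi p -> Tmon h -> cell (n i x * (nw (word s) * p * h)).
Proof.
move=> hi x0 ax hs hp Th.
have [m hm [hs' E]] := nw_step hi hs.
have -> : n i x = n i x * n i 1 * n i 1 by rewrite -mulrA n_sq ?mulr1 // simple_root.
rewrite -mulrA; apply: cell_T; first by apply: simple_n_T; rewrite ?oner_neq0 //; apply: adm1.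
exists 1, (refl i s), (m * p), h; split; rewrite ?mul1r //; first exact: mon1.
  exact: mon_mul.
by rewrite -!mulrA (mulE2 E).
Qed.

Lemma deg_opp r : isroot r -> (deg r + deg (oppn r) = 4)%N.
Proof. by move=> h; apply/eqP; move: r h; apply: all_rootsP; vm_compute. Qed.

(** This is the exchange step of the BN-pair. After the positive roots other than alpha_i are moved
    to the left, a rank one computation remains. The degrees of w^-1(alpha_i) and w^-1(-alpha_i) add
    up to 4, so at least one of the two root groups passes through [nw (word s)] into the parabolic
    factor. *)
Lemma cell_neg i t g : i \in simple -> adm i t -> cell g -> cell (U (oppn i) t * g).
Proof.
move=> hi at_ [u [s [p [h [hu hs hp Th ->]]]]].
have ir := simple_root hi; have oir := oppn_root ir.
have oadm x : adm i x <-> adm (oppn i) x.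
  by rewrite /adm (_ : longn (oppn i) = longn i) //; move: hi; rewrite !inE => /or4P[] /eqP ->.
have [u' [v [hu' av ->]]] := pos_decomp hi hu.
have [u'' hu'' E] := sgsimple_normal hi (or_intror (erefl (oppn i))) ((oadm _).1 at_) hu'.
rewrite !mulrA E -!mulrA; apply: cell_Up.
  by apply: Umon_sub hu'' => r; rewrite !unfold_in => /andP[].
have ws := word_simple (shortn_root hs).
have hrw : all (mem simple) (rev (word s)) by rewrite all_rev.
have Ecomm r y : isroot r -> U r y * nw (word s) = nw (word s) * U (act_word (rev (word s)) r) y.
  move=> hr; have [h1 _ _ _ h5] := act_word_facts char2 hrw hr.
  have [_ _ e3 _ _] := act_word_facts char2 ws hr.
  by have [_ _ _ _ ->] := act_word_facts char2 ws h1; rewrite e3.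
have [r1 lr1 _ oar _] := act_word_facts char2 hrw ir.
have [t0|t0] := eqVneq t 0.
  rewrite t0 U0 mul1r; apply: cell_U => //; first exact: simple_pos.
  by exists 1, s, p, h; split; rewrite ?mul1r ?mulrA //; exact: mon1.
have x0 : t^-1 != 0 by rewrite invr_eq0.
have ax := admV at_.
(* The definition of n_i(t^-1), solved for its middle factor. *)
have -> : U (oppn i) t = U i t^-1 * (n i t^-1 * U i t^-1).
  by rewrite nE invrK -!mulrA (mulE1 (U_sq _ _ _)) // U_sq // mul1r mulr1.
rewrite -!mulrA; apply: cell_U; [exact: ir|exact: simple_pos|by []|].
rewrite (mulE1 (U_add _ _ _ _)) //; set v' := _ + v.
have av' : adm i v' by apply: admD.
have mv r y q : isroot r -> (2 <= deg (act_word (rev (word s)) r))%N -> adm r y ->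
  exists2 q', Umon Pphi q' & U r y * (nw (word s) * (p * q)) = nw (word s) * q' * q.
  move=> hr dr ay; have [h1 h2 _ _ _] := act_word_facts char2 hrw hr.
  exists (U (act_word (rev (word s)) r) y * p); last by rewrite (mulE2 (Ecomm _ _ hr)) -!mulrA.
  by apply: mon_mul => //; apply: Umon_U => //; rewrite /adm h2.
have [v0|v0] := eqVneq v' 0.
  by rewrite v0 U0 mul1r (mulrA (nw _)); apply: cell_n.
have [le2|lt2] := leqP 2 (deg (act_word (rev (word s)) i)).
  by have [q hq ->] := mv i v' h ir le2 av'; apply: cell_n.
have y0 : v'^-1 != 0 by rewrite invr_eq0.
have ay := (oadm _).1 (admV av').
(* The relation n_{-i}(v'^-1) = n_i(v'), solved for its middle factor. The left outer factor becomes
   positive on passing n_i, the right one enters the parabolic factor, and the two n_i combine to a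
   torus element. *)
have -> : U i v' = U (oppn i) v'^-1 * (n i v' * U (oppn i) v'^-1).
  have := n_opp char2 hi y0; rewrite invrK => <-.
  by rewrite nE invrK oppnK // -!mulrA (mulE1 (U_sq _ _ _)) // U_sq // mul1r mulr1.
have [y' ay' Ey] := n_conj_adm hi oir x0 ax ay.
have rii : refl i (oppn i) = i by move: hi; rewrite !inE => /or4P[] /eqP ->.
rewrite rii in ay' Ey.
rewrite -!mulrA (mulE2 Ey); apply: cell_U; [exact: ir|exact: simple_pos|by []|].
have [q hq ->] : exists2 q, Umon Pphi q &
    U (oppn i) v'^-1 * (nw (word s) * (p * h)) = nw (word s) * q * h.
  apply: mv => //; rewrite -oar.
  by have := deg_opp r1; move: lt2; case: (deg _) => [|[|//]] _;
     case: (deg _) => [|[|[]]].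
rewrite (mulrA (n i _)); apply: cell_T; first exact: simple_n_T.
by exists 1, s, q, h; split; rewrite ?mul1r //; exact: mon1.
Qed.

Lemma cell_simple_n i g : i \in simple -> cell g -> cell (n i 1 * g).
Proof.
move=> hi cg; have ir := simple_root hi; rewrite nE invr1 -!mulrA.
apply: cell_U; rewrite ?simple_pos //; first exact: adm1.
apply: cell_neg => //; first exact: adm1.
by apply: cell_U; rewrite ?simple_pos //; apply: adm1.
Qed.

Lemma root_wordP r : isroot r -> exists w i,
  [/\ all (mem simple) w, i \in simple, longn i = longn r &
      forall t, U r t = nw w * U i t * nw (rev w)].
Proof.
move=> hr; have /and3P[hw hi /eqP E] := all_rootsP root_word_checks hr.
exists (root_word r).1, (root_word r).2.
have [_ h2 _ _ h5] := act_word_facts char2 hw (simple_root hi).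
rewrite E in h2 h5; split => // t.
by rewrite h5 -mulrA nw_rev // mulr1.
Qed.

Lemma cell_nw w g : all (mem simple) w -> cell g -> cell (nw w * g).
Proof.
move=> hw cg; elim: w hw => [|i w IH] /= => [_|/andP[hi hw]]; first by rewrite mul1r.
by rewrite -mulrA; apply: cell_simple_n => //; apply: IH.
Qed.

Lemma bruhat g : Umon predT g -> cell g.
Proof.
elim=> [|_ k [r [t [hr _ ar ->]]] _ IH].
  by exists 1, 30, 1, 1; split; rewrite ?mulr1 //; apply: mon1.
have [w [i [hw hi li ->]]] := root_wordP hr.
rewrite -!mulrA; apply: cell_nw => //; apply: cell_U; rewrite ?simple_root ?simple_pos //.
  by move: ar; rewrite /adm li.
by apply: cell_nw; rewrite ?all_rev.
Qed.

End Bruhat.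

(** * Anisotropy *)

Section Anisotropy.
Variables (L : fieldType) (ell k : L -> Prop).
Hypotheses (Hell : is_subfield ell) (Hk : is_subfield k).
Hypothesis (Hk_ell : forall x, k x -> ell x).
Hypothesis (Hsq : forall x, ell x -> k (x ^+ 2)).
Hypothesis (char2 : (2%:R : L) = 0).
Variables (delta gamma : L).
Hypothesis (Hdelta : k delta).
Hypothesis (Hgamma : gamma ^+ 2 + gamma + delta = 0).
Hypothesis (HL : forall x : L, exists a b, ell a /\ ell b /\ x = a + b * gamma).
Variable bar : {rmorphism L -> L}.
Hypotheses (Hbar_fix : forall x, ell x -> bar x = x) (Hbar_nontriv : bar gamma <> gamma).
Variables (a b : L).
Hypotheses (Ha : k a) (Ha0 : a <> 0) (Hb : k b) (Hb0 : b <> 0).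
Hypothesis (Haniso : forall y1 y2 y3 y4 : L,
      ell y1 -> Kset k gamma y2 -> Kset k gamma y3 -> Kset k gamma y4 ->
      y1 ^+ 2 + a * (y2 * bar y2) + b * (y3 * bar y3)
        + a * b * (y4 * bar y4) = 0 ->
      [/\ y1 = 0, y2 = 0, y3 = 0 & y4 = 0]).
Local Notation K := (Kset k gamma).

Let opp2 (x : L) : - x = x.
Proof. by apply/eqP; rewrite eq_sym -addr_eq0 -mulr2n -mulr_natl char2 mul0r. Qed.
Let add2 (x : L) : x + x = 0.
Proof. by rewrite -mulr2n -mulr_natl char2 mul0r. Qed.

Let k0 : k 0. Proof. by case: Hk. Qed.
Let k1 : k 1. Proof. by case: Hk => _ []. Qed.
Let kD x y : k x -> k y -> k (x + y). Proof. by case: Hk => _ [_ [h _]]; apply: h. Qed.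
Let kM x y : k x -> k y -> k (x * y).
Proof. by case: Hk => _ [_ [_ [_ [h _]]]]; apply: h. Qed.
Let kV x : k x -> k x^-1. Proof. by case: Hk => _ [_ [_ [_ [_ h]]]]; apply: h. Qed.

Lemma gamma_sq : gamma ^+ 2 = gamma + delta.
Proof. by apply/eqP; rewrite -subr_eq0 opp2 addrA Hgamma. Qed.

Lemma bar_gamma : bar gamma = gamma + 1.
Proof.
have E : (bar gamma + gamma) * (bar gamma + gamma + 1) = 0.
  have e : bar gamma ^+ 2 = bar gamma + delta.
    by rewrite -rmorphXn gamma_sq rmorphD (Hbar_fix (Hk_ell Hdelta)).
  transitivity (bar gamma ^+ 2 + gamma ^+ 2 + (bar gamma + gamma)
     + (bar gamma * gamma + bar gamma * gamma)); first by ring.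
  rewrite e gamma_sq add2 addr0.
  transitivity ((bar gamma + bar gamma) + (gamma + gamma) + (delta + delta)); first by ring.
  by rewrite !add2.
move/eqP: E; rewrite mulf_eq0 => /orP[] /eqP E.
  by case: Hbar_nontriv; rewrite -[LHS]addr0 -(add2 gamma) addrA E add0r.
by rewrite -[RHS]add0r -E -[LHS]addr0 -[X in _ + X](add2 (gamma + 1)); ring.
Qed.

Lemma K_of_k x : k x -> K x.
Proof. by move=> kx; exists x, 0; rewrite mul0r addr0. Qed.

Lemma K_one : K 1. Proof. exact: K_of_k. Qed.

Lemma K_add x y : K x -> K y -> K (x + y).
Proof.
move=> [p [q [kp [kq ->]]]] [r [s [kr [ks ->]]]]; exists (p + r), (q + s).
by split; [apply: kD | split; [apply: kD | ring]].
Qed.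

Lemma K_mul x y : K x -> K y -> K (x * y).
Proof.
move=> [p [q [kp [kq ->]]]] [r [s [kr [ks ->]]]].
exists (p * r + q * s * delta), (p * s + q * r + q * s).
split; [|split].
- by apply: kD; [apply: kM | apply: kM => //; apply: kM].
- by apply: kD; [apply: kD; apply: kM | apply: kM].
transitivity (p * r + (p * s + q * r) * gamma + q * s * gamma ^+ 2); first by ring.
by rewrite gamma_sq; ring.
Qed.

Lemma bar_K x : K x -> K (bar x).
Proof.
move=> [p [q [kp [kq ->]]]].
rewrite rmorphD rmorphM (Hbar_fix (Hk_ell kp)) (Hbar_fix (Hk_ell kq)) bar_gamma.
by exists (p + q), q; split; [apply: kD | split => //; ring].
Qed.

Lemma norm_k x : K x -> k (x * bar x).
Proof.
move=> [p [q [kp [kq ->]]]].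
rewrite rmorphD rmorphM (Hbar_fix (Hk_ell kp)) (Hbar_fix (Hk_ell kq)) bar_gamma.
have -> : (p + q * gamma) * (p + q * (gamma + 1)) = p ^+ 2 + p * q + q ^+ 2 * delta.
  transitivity (p ^+ 2 + p * q + (p * q * gamma + p * q * gamma)
    + q ^+ 2 * (gamma ^+ 2 + gamma)); first by ring.
  by rewrite add2 addr0 (_ : gamma ^+ 2 + gamma = delta) // gamma_sq addrAC add2 add0r.
by do 2?apply: kD; rewrite ?expr2; do 2?apply: kM.
Qed.

Lemma K_inv x : K x -> K x^-1.
Proof.
move=> Kx; have [->|x0] := eqVneq x 0; first by rewrite invr0; apply: K_of_k.
have -> : x^-1 = bar x * (x * bar x)^-1.
  by rewrite invfM mulrCA mulfV ?mulr1 // fmorph_eq0.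
by apply: K_mul; [apply: bar_K | apply/K_of_k/kV/norm_k].
Qed.

Lemma K_sq x : K (x ^+ 2).
Proof.
have [p [q [ep [eq ->]]]] := HL x.
exists (p ^+ 2 + q ^+ 2 * delta), (q ^+ 2); split; [|split; [exact: Hsq|]].
  by apply: kD; [apply: Hsq | apply: kM => //; apply: Hsq].
transitivity (p ^+ 2 + q ^+ 2 * gamma ^+ 2 + (p * q * gamma + p * q * gamma)); first by ring.
by rewrite add2 addr0 gamma_sq; ring.
Qed.

Lemma barK x : bar (bar x) = x.
Proof.
have [p [q [ep [eq ->]]]] := HL x.
rewrite !rmorphD !rmorphM !(Hbar_fix ep) !(Hbar_fix eq) bar_gamma rmorphD rmorph1 bar_gamma.
by rewrite -addrA add2 addr0.
Qed.

Lemma bar_fixed_ell x : bar x = x -> ell x.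
Proof.
have [p [q [ep [eq ->]]]] := HL x.
rewrite rmorphD rmorphM (Hbar_fix ep) (Hbar_fix eq) bar_gamma => /addrI/eqP.
rewrite mulrDr mulr1 -subr_eq0 addrAC subrr add0r => /eqP ->.
by rewrite mul0r addr0.
Qed.

Lemma bar_a : bar a = a. Proof. exact/Hbar_fix/Hk_ell. Qed.

Let a0 : a != 0. Proof. exact/eqP. Qed.
Let b0 : b != 0. Proof. exact/eqP. Qed.

(* The spinor with coordinates y_i is annihilated by a totally singular subspace
   of the 7-dimensional orthogonal space, which contains a vector f quadratic in
   the y_i; (z, v1, v2, v3) are the coordinates of kap f + sigma(kap f).  The
   signs make the identity valid in every characteristic. *)
Lemma spinor_identity (kap y0 y1 y2 y3 z v1 v2 v3 : L) :
  z = kap * (y0 * y1) - bar (kap * (y0 * y1)) ->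
  v1 = kap * y1 ^+ 2 + bar (kap * y0 ^+ 2) / a ->
  v2 = kap * (y0 * bar y3 - y1 * y2) ->
  v3 = kap * (y0 * bar y2 / a + y1 * y3) ->
  - z ^+ 2 + a * (v1 * bar v1) + b * (v2 * bar v2) + a * b * (v3 * bar v3) =
  kap * bar kap * b * (y0 * bar y0 + a * (y1 * bar y1)) *
  (y0 * bar y0 / (a * b) + y1 * bar y1 / b + y2 * bar y2 / a + y3 * bar y3).
Proof.
move=> -> -> -> ->.
rewrite !(rmorphD, rmorphM, rmorphB, rmorphXn, fmorphV) /= !barK !bar_a.
by field; rewrite a0 b0.
Qed.

(** The Hermitian condition makes the right side of [spinor_identity] vanish for every kap in K, and
    the rationality conditions put (z, v1, v2, v3) into ell + K^3, where q is anisotropic. *)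
Lemma spinor_anisotropic (y0 y1 y2 y3 : L) :
  y0 * bar y0 / (a * b) + y1 * bar y1 / b + y2 * bar y2 / a + y3 * bar y3 = 0 ->
  K (y0 * bar y3 + y1 * y2) -> K (y0 * bar y2 / a + y1 * y3) ->
  K (y0 * bar y1 / b + y2 * y3) ->
  [/\ y0 = 0, y1 = 0, y2 = 0 & y3 = 0].
Proof.
move=> Q K12 K13 K23.
have v1 kap : K kap -> kap * y1 ^+ 2 + bar (kap * y0 ^+ 2) / a = 0.
  move=> Kk.
  have := spinor_identity (erefl (kap * (y0 * y1) - bar (kap * (y0 * y1)))) (erefl _)
     (erefl _) (erefl (kap * (y0 * bar y2 / a + y1 * y3))).
  rewrite Q mulr0 [- _ ^+ 2]opp2 => /Haniso[] //.
  - apply: bar_fixed_ell; rewrite rmorphB barK.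
    by rewrite -[LHS]opp2 opprB.
  - apply: K_add; first by apply: K_mul => //; apply: K_sq.
    apply: K_mul; last exact/K_of_k/kV.
    by apply/bar_K/K_mul => //; apply: K_sq.
  - by apply: K_mul => //; rewrite opp2.
  - exact: K_mul.
(* The multipliers 1 and gamma separate the two terms of v1, because bar gamma = gamma + 1 differs
   from gamma. *)
have Kg : K gamma by exists 0, 1; rewrite mul1r add0r.
have e1 := v1 1 K_one; have e2 := v1 gamma Kg.
have y1z : y1 ^+ 2 = 0.
  have : (gamma * y1 ^+ 2 + bar (gamma * y0 ^+ 2) / a)
     - (gamma + 1) * (1 * y1 ^+ 2 + bar (1 * y0 ^+ 2) / a) = 0.
    by rewrite e1 e2 mulr0 subrr.
  rewrite rmorphM bar_gamma mul1r => E; rewrite -[LHS]opp2 -[RHS]E; ring.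
have y1_0 : y1 = 0 by move/eqP: y1z; rewrite expf_eq0 => /eqP.
have y0_0 : y0 = 0.
  move/eqP: e1; rewrite y1z mulr0 add0r mul1r mulf_eq0 invr_eq0 (negPf a0) orbF.
  by rewrite fmorph_eq0 expf_eq0 => /eqP.
move: Q K12 K13 K23; rewrite y0_0 y1_0 !mul0r !add0r => Q _ _ K23.
(* With y0 = y1 = 0, multiplying the Hermitian condition by a b y2 bar(y2) turns it into q(0, 0,
   y2^2, y2 y3) = 0, with entries in K. *)
have : [/\ (0 : L) = 0, (0 : L) = 0, y2 ^+ 2 = 0 & y2 * y3 = 0].
  apply: Haniso; [exact/Hk_ell|exact: K_of_k|exact: K_sq|by []|].
  rewrite expr0n /= !mul0r mulr0 !add0r !rmorphM.
  transitivity (a * b * (y2 * bar y2) * (y2 * bar y2 / a + y3 * bar y3)); first by field.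
  by rewrite Q mulr0.
case=> _ _ /eqP; rewrite expf_eq0 /= => /eqP y2_0 _.
move: Q; rewrite y2_0 !mul0r add0r => /eqP; rewrite mulf_eq0 fmorph_eq0 orbb => /eqP.
by [].
Qed.

(** The scalar lam is arbitrary in L, so q does not apply directly. The relations between the p_i
    and the q_i force bar lam / lam into K, after which lam is corrected by an element of K to
    become fixed by bar. *)
Lemma vector_anisotropic (lam z x1 x2 x3 : L) (p1 p2 p3 q1 q2 q3 : L) :
  lam != 0 -> bar z = z ->
  K p1 -> K p2 -> K p3 -> K q1 -> K q2 -> K q3 ->
  x1 = lam * p1 -> x2 = lam * p2 -> x3 = lam * p3 ->
  lam * q1 = a * bar x1 -> lam * q2 = b * bar x2 -> lam * q3 = a * b * bar x3 ->
  z ^+ 2 + a * (x1 * bar x1) + b * (x2 * bar x2) + a * b * (x3 * bar x3) = 0 ->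
  [/\ z = 0, x1 = 0, x2 = 0 & x3 = 0].
Proof.
move=> lam0 zz Kp1 Kp2 Kp3 Kq1 Kq2 Kq3 -> -> -> E1 E2 E3 Q.
have bl0 : bar lam != 0 by rewrite fmorph_eq0.
(* One nonzero coordinate suffices: lam q = c bar(lam p) gives bar lam / lam = q / (c bar p). *)
have Kab c p q : K c -> c != 0 -> K p -> K q -> p != 0 ->
    lam * q = c * bar (lam * p) -> K (bar lam / lam).
  move=> Kc c0 Kp Kq p0; rewrite rmorphM => E.
  have bp0 : bar p != 0 by rewrite fmorph_eq0.
  have -> : bar lam / lam = q / (c * bar p).
    apply/eqP; rewrite eqr_div ?mulf_neq0 //; apply/eqP.
    by rewrite [RHS]mulrC E; ring.
  by apply: K_mul => //; apply/K_inv/K_mul => //; apply: bar_K.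
have Ka := K_of_k Ha; have Kb := K_of_k Hb.
have key : K (bar lam / lam) -> [/\ z = 0, p1 = 0, p2 = 0 & p3 = 0].
  set mu := bar lam / lam => Kmu.
  have bmu : bar mu = mu^-1.
    by rewrite /mu rmorphM fmorphV barK invfM invrK mulrC.
  have mu0 : mu != 0 by rewrite mulf_neq0 ?invr_eq0.
  (* Hilbert 90 for K/k *)
  have [nu [Knu nu0 nuE]] : exists nu, [/\ K nu, nu != 0 & bar nu * lam = nu * bar lam].
    have [m1|m1] := eqVneq mu 1.
      exists 1; split; [exact: K_one|exact: oner_neq0|].
      rewrite rmorph1 !mul1r; move/eqP: m1; rewrite -(inj_eq (mulIf lam0)) mul1r.
      by rewrite /mu divfK // => /eqP.
    have s0 : 1 + mu != 0 by rewrite addr_eq0 opp2 eq_sym.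
    (* From mu * bar mu = 1 follows bar (1 + mu)^-1 = mu (1 + mu)^-1; the case mu = 1, where 1 + mu
       vanishes, was treated apart. *)
    exists (1 + mu)^-1; split.
    - by apply/K_inv/K_add => //; apply: K_one.
    - by rewrite invr_eq0.
    rewrite fmorphV rmorphD rmorph1 bmu.
    have -> : bar lam = mu * lam by rewrite /mu divfK.
    by field; rewrite ?s0 ?mu0.
  (* rho is fixed by bar, so division by rho puts z into ell and leaves the coordinates nu p_i in
     K. *)
  pose rho := lam / nu.
  have rr : bar rho = rho.
    rewrite /rho rmorphM fmorphV; apply/eqP.
    by rewrite eqr_div ?fmorph_eq0 //; rewrite mulrC -nuE mulrC.
  have rho0 : rho != 0 by rewrite mulf_neq0 ?invr_eq0.
  have lE : lam = rho * nu by rewrite /rho divfK.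
  clearbody rho.
  have : [/\ z / rho = 0, nu * p1 = 0, nu * p2 = 0 & nu * p3 = 0].
    apply: Haniso; try exact: K_mul.
      by apply: bar_fixed_ell; rewrite rmorphM fmorphV zz rr.
    rewrite !rmorphM -[RHS](mul0r (rho ^- 2)) -Q lE !rmorphM rr.
    by field; rewrite rho0.
  case=> /eqP; rewrite mulf_eq0 invr_eq0 (negPf rho0) orbF => /eqP ->.
  by do 3!(move/eqP; rewrite mulf_eq0 (negPf nu0) => /eqP ->).
suff [-> -> -> ->] : [/\ z = 0, p1 = 0, p2 = 0 & p3 = 0] by rewrite mulr0.
have [p10|p1n] := eqVneq p1 0; last exact/key/(Kab _ _ _ Ka a0 Kp1 Kq1).
have [p20|p2n] := eqVneq p2 0; last exact/key/(Kab _ _ _ Kb b0 Kp2 Kq2).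
have [p30|p3n] := eqVneq p3 0; last first.
  by apply/key/(Kab _ _ _ (K_mul Ka Kb) _ Kp3 Kq3) => //; rewrite mulf_neq0.
move: Q; rewrite p10 p20 p30 !mulr0 !mul0r !mulr0 !addr0 => /eqP.
by rewrite expf_eq0 => /eqP ->.
Qed.

End Anisotropy.

(** * Invariants of lowest-degree components *)

(* c_r = a ^ e.1 * b ^ e.2 extends the given values on the simple roots to a
   character of the root lattice. *)
Definition chi_data (r : nat) : int * int :=
  let v := nth [::] F4_roots r in
  ((v`_0 + v`_2) %/ 2, (v`_1 + v`_2) %/ 2)%Z.
Definition chi_tab := Eval vm_compute in map chi_data root_range.
Definition ypow (k : int) : mono :=
  match k with Posz n => nseq n (bn 56) | Negz n => nseq n.+1 (bn 57) end.
Definition chi (r : nat) : mono :=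
  let e := nth (0%R, 0%R) chi_tab r in xpow e.1 ++ ypow e.2.

(** On the toral part, sigma negates the coroots of alpha_2, alpha_3, alpha_4 and sends that of
    alpha_1 to alpha_1^v + 3 alpha_2^v + 4 alpha_3^v + 2 alpha_4^v. Modulo 2 only the extra
    contribution of coordinate 48 to coordinate 49 survives. *)
Definition mact (V : vec) : vec :=
  mkseq (fun i =>
    if (i < 48)%N then pscale (chi (sigr i)) (nth [::] V (sigr i))
    else if i == 49%N then padd (nth [::] V 48) (nth [::] V 49) else nth [::] V i) 52.

Definition intertwine_check r :=
  veq (mact (sact r [:: bn 52] generic)) (sact (sigr r) (bn 52 :: chi r) (mact generic)).
Lemma intertwine_checks : all intertwine_check root_range. Proof. by vm_compute. Qed.
Lemma mact_involutive : veq (mact (mact generic)) generic. Proof. by vm_compute. Qed.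

(** Some matrix entry is t^2 v in u_i(t) u_{-i}(v) u_i(t) and t in u_{-i}(v) u_i(t) u_{-i}(v), so
    for t != 0 equality of the two products forces t v = 1. *)
Definition braid_check i :=
  has (fun j =>
     let V := run [:: (i, [:: bn 52]); (oppn i, [:: bn 53]); (i, [:: bn 52])] (basis j) in
     let W := run [:: (oppn i, [:: bn 53]); (i, [:: bn 52]); (oppn i, [:: bn 53])] (basis j) in
     has (fun k => peq (nth [::] V k) [:: [:: bn 52; bn 52; bn 53]] &&
                   peq (nth [::] W k) [:: [:: bn 52]]) (iota 0 52)) (iota 0 52).
Lemma braid_checks : all (fun i => braid_check (sigr i)) simple. Proof. by vm_compute. Qed.

Definition quad_sym (l : seq (nat * nat)) (V : vec) : poly2 :=
  psum [seq pmul (nth [::] V p.1) (nth [::] V p.2) | p <- l].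

(* The short roots of e4-degree 1/2 (e = 0) and -1/2 (e = 1) have numbers
   [i + e] for [i] in [spin_ix]; [spin_norm] pairs roots with sum e4 or -e4,
   and the members of [spin_pairs] pair roots with sum +-e_j + e4 or
   +-e_j - e4. *)
Definition spin_ix : seq nat := [:: 46; 38; 42; 44; 34; 36; 40; 32]%N.
Definition spin_pairs : seq (seq (nat * nat)) :=
  [:: [:: (46, 34); (38, 42)]; [:: (46, 36); (38, 44)]; [:: (46, 40); (42, 44)];
      [:: (32, 44); (36, 40)]; [:: (32, 42); (34, 40)]; [:: (32, 38); (34, 36)]]%N.
Definition shift_pairs (e : nat) (l : seq (nat * nat)) := [seq (p.1 + e, p.2 + e)%N | p <- l].
Definition spin_norm (e : nat) := shift_pairs e [:: (46, 32); (38, 40); (42, 36); (44, 34)]%N.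

Definition low_generic (d : nat) : vec :=
  mkseq (fun i => if (deg i < d)%N then [::] else [:: [:: bn i]]) 52.

(** The possible changes of a form A from [spin_pairs]. A short root element adds t Q + t^2 A',
    where Q vanishes on the vectors at hand. A long one, with t in K, adds t A' or t y^2 for a
    coordinate y. Since K contains L^2, rationality of all the A is preserved. *)
Definition spin_candidates (e r : nat) (V : vec) : seq poly2 :=
  let Q := quad_sym (spin_norm e) V in
  let As := [seq quad_sym (shift_pairs e l) V | l <- spin_pairs] in
  if longn r then
    [::] :: [seq pscale [:: bn 52] p | p <- As] ++
    [seq pscale [:: bn 52] (pmul (nth [::] V (i + e)%N) (nth [::] V (i + e)%N)) | i <- spin_ix]
  else [::] :: [seq padd (pscale [:: bn 52] Q) (pscale [:: bn 52; bn 52] p) | p <- As].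

Definition spin_check e r :=
  let V := low_generic (3 - 2 * e)%N in let W := sact r [:: bn 52] V in
  let cs := spin_candidates e r V in
  peq (quad_sym (spin_norm e) W) (quad_sym (spin_norm e) V) &&
  all (fun l => let p := quad_sym (shift_pairs e l) W in
                let q := quad_sym (shift_pairs e l) V in
                has (fun c => peq p (padd q c)) cs) spin_pairs.
Lemma spin_checks : all (fun e => all (spin_check e) (filter posn root_range)) [:: 0; 1]%N.
Proof. by vm_compute. Qed.

(* The roots +-e_1, +-e_2, +-e_3; index 49 is the toral vector that together
   with them spans the short part of degree 0. *)
Definition vec_ix : seq nat := [:: 24; 25; 26; 27; 28; 29]%N.
Definition vec_norm : seq (nat * nat) := [:: (49, 49); (24, 25); (26, 27); (28, 29)]%N.
Definition vec_zero i := (deg i < 2)%N || ((deg i == 2) && (i \notin 49%N :: vec_ix)).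
Definition vec_generic : vec :=
  mkseq (fun i => if vec_zero i then [::] else [:: [:: bn i]]) 52.
(** A coordinate at +-e_j changes by t y_j for a long root element, where t is in K, and by t^2 y_j
    for a short one. The toral coordinate 49 does not enter these changes, so rationality of the six
    others is preserved by itself. *)
Definition vec_check r :=
  let V := vec_generic in let W := sact r [:: bn 52] V in
  [&& all (fun i => vec_zero i ==> nilp (nth [::] W i)) (iota 0 52),
      peq (quad_sym vec_norm W) (quad_sym vec_norm V) &
      all (fun i => has (fun c => peq (nth [::] W i) (padd (nth [::] V i) c))
        ([::] :: [seq pscale (if longn r then [:: bn 52] else [:: bn 52; bn 52]) (nth [::] V j) | j <- vec_ix]))
        vec_ix].
Lemma vec_checks : all vec_check (filter posn root_range). Proof. by vm_compute. Qed.

Definition degree_check (lt : rel nat) r :=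
  all (fun i => all (fun k => lt (deg k) (deg i))
     (nth [::] (nth [::] rows_adX r) i ++ nth [::] (nth [::] rows_adX2 r) i)) (iota 0 52).
Lemma degree_checks :
  all (degree_check leq) [seq r <- root_range | 2 <= deg r]%N &&
  all (degree_check ltn) [seq r <- root_range | 2 < deg r]%N.
Proof. by vm_compute. Qed.

Lemma degree_eq_checks :
  all (degree_check (fun m n => m == n)) [seq r <- root_range | deg r == 2]%N.
Proof. by vm_compute. Qed.

Definition fixes_highest_check r := ~~ has (fun i => 30%N \in
     (nth [::] (nth [::] rows_adX r) i ++ nth [::] (nth [::] rows_adX2 r) i)) (iota 0 52).
Lemma fixes_highest_checks :
  all fixes_highest_check [seq r <- root_range | 2 <= deg r]%N.
Proof. by vm_compute. Qed.

(** * Invariance under positive root elements *)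

Section Invariants.
Variable L : fieldType.
Hypothesis char2 : (2%:R : L) = 0.
Variable K : L -> Prop.
Hypothesis K1 : K 1.
Hypothesis KD : forall x y, K x -> K y -> K (x + y).
Hypothesis KM : forall x y, K x -> K y -> K (x * y).
Hypothesis KV : forall x, K x -> K x^-1.
Hypothesis Ksq : forall x, K (x ^+ 2).
Local Notation U := (@U L).
Local Notation adm := (adm K).
Implicit Types (x : 'cV[L]_52).

Let K0 : K 0. Proof. by rewrite -(addff char2 1); apply: KD. Qed.

Definition cf x (i : nat) : L := x (inord i) 0.
Definition quad (l : seq (nat * nat)) x : L := \sum_(p <- l) cf x p.1 * cf x p.2.

Lemma cf_veval rho V i : (i < 52)%N -> cf (veval rho V) i = peval rho (nth [::] V i).
Proof. by move=> hi; rewrite /cf mxE inordK. Qed.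

Lemma cf_ext x y : (forall i, (i < 52)%N -> cf x i = cf y i) -> x = y.
Proof.
move=> h; apply/matrixP => i j; rewrite (ord1 j).
by have := h i (ltn_ord i); rewrite /cf inord_val.
Qed.

Lemma quad_symP rho l V : env_ok rho -> all (fun p => (p.1 < 52) && (p.2 < 52))%N l ->
  peval rho (quad_sym l V) = quad l (veval rho V).
Proof.
move=> ok /allP hl; rewrite (peval_sum char2) big_map /quad big_seq [RHS]big_seq.
apply: eq_bigr => p /hl /andP[h1 h2].
by rewrite (peval_mul char2) // !cf_veval.
Qed.

Definition low d x := forall i, (i < 52)%N -> (deg i < d)%N -> cf x i = 0.

Lemma in_root_range r : isroot r -> r \in root_range.
Proof. by rewrite mem_iota. Qed.

Lemma degree_rows lt r i k : degree_check lt r -> (i < 52)%N ->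
  k \in nth [::] (nth [::] rows_adX r) i ++ nth [::] (nth [::] rows_adX2 r) i -> lt (deg k) (deg i).
Proof. by move=> /allP h hi; move: k; apply/allP/h; rewrite mem_iota. Qed.

Lemma rows_lt52 r i :
  all (fun k => k < 52)%N (nth [::] (nth [::] rows_adX r) i ++ nth [::] (nth [::] rows_adX2 r) i).
Proof.
have /andP[b1 b2] := rows_bound; rewrite all_cat.
by apply/andP; split; do 2!apply: all_nth => //.
Qed.

Lemma low_U d r t x : isroot r -> (2 <= deg r)%N -> low d x -> low d (U r t *m x).
Proof.
move=> hr dr lx i hi di; have /andP[/allP h _] := degree_checks.
have c : degree_check leq r by apply: h; rewrite mem_filter dr in_root_range.
have dk := degree_rows c hi.
have bound : forall k, k \in nth [::] (nth [::] rows_adX r) i ++ nth [::] (nth [::] rows_adX2 r) i ->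
    x (inord k) 0 = 0.
  move=> k hk; apply: lx; last exact: leq_ltn_trans (dk k hk) di.
  exact: (allP (rows_lt52 r i)).
rewrite /cf (U_mulE char2) !inordK // !big_seq !big1 ?mulr0 ?add0r; first exact: lx.
  by move=> k hk; apply: bound; rewrite mem_cat hk orbT.
by move=> k hk; apply: bound; rewrite mem_cat hk.
Qed.

Lemma veval_low_generic d x t : low d x ->
  veval (env (cf x) t 0 1 1) (low_generic d) = x.
Proof.
move=> lx; apply: cf_ext => i hi; rewrite cf_veval // nth_mkseq //.
case: ifP => di; first by rewrite peval_nil lx.
by rewrite peval_cons peval_nil addr0 /meval big_cons big_nil mulr1 /env Nnat.Nat2N.id hi.
Qed.

Lemma veval_vec_generic x t : (forall i, (i < 52)%N -> vec_zero i -> cf x i = 0) ->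
  veval (env (cf x) t 0 1 1) vec_generic = x.
Proof.
move=> lx; apply: cf_ext => i hi; rewrite cf_veval // nth_mkseq //.
case: ifP => di; first by rewrite peval_nil lx.
by rewrite peval_cons peval_nil addr0 /meval big_cons big_nil mulr1 /env Nnat.Nat2N.id hi.
Qed.

Definition spin_inv e x :=
  [/\ low (3 - 2 * e) x, quad (spin_norm e) x = 0 &
      forall l, l \in spin_pairs -> K (quad (shift_pairs e l) x)].

Definition vec_inv x :=
  [/\ forall i, (i < 52)%N -> vec_zero i -> cf x i = 0, quad vec_norm x = 0 &
      forall i, i \in vec_ix -> K (cf x i)].

Lemma posn_deg r : isroot r -> posn r -> (2 <= deg r)%N.
Proof.
move=> hr; apply/implyP; move: r hr.
by apply: (all_rootsP (P := fun r => posn r ==> (2 <= deg r)%N)); vm_compute.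
Qed.

Lemma spin_inv_U e r t x : (e <= 1)%N -> isroot r -> posn r -> adm r t ->
  spin_inv e x -> spin_inv e (U r t *m x).
Proof.
move=> he hr pr at_ [lx Qx Ax]; split; first exact: low_U (posn_deg hr pr) lx.
all: have /andP[cQ /allP cA] : spin_check e r
  by apply: (allP (allP spin_checks e _));
     [rewrite !inE; case: e he {lx Qx Ax} => [|[|]] | rewrite mem_filter pr in_root_range].
all: set rho := env (cf x) t 0 1 1.
all: have ok : env_ok rho by apply: env_okP; rewrite oner_neq0.
all: have Vx := veval_low_generic t lx; rewrite -/rho in Vx.
all: have Wx : veval rho (sact r [:: bn 52] (low_generic (3 - 2 * e))) = U r t *m x
  by rewrite (veval_sact char2) // Vx /meval big_cons big_nil mulr1.
all: have bQ : all (fun p => (p.1 < 52) && (p.2 < 52))%N (spin_norm e)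
  by case: e he {lx Qx Ax cQ cA Vx Wx} => [|[|]].
  have := peqP char2 rho cQ; rewrite !quad_symP // Wx Vx => ->; exact: Qx.
have bA l : l \in spin_pairs -> all (fun p => (p.1 < 52) && (p.2 < 52))%N (shift_pairs e l).
  move: l; apply/allP; by case: e he {lx Qx Ax cQ cA Vx Wx bQ} => [|[|]].
move=> l hl; have /hasP[c hc /(peqP char2 rho)] := cA l hl.
rewrite (peval_add char2) !quad_symP ?bA // Wx Vx => ->; apply: KD; first exact: Ax.
have m1 q : peval rho (pscale [:: bn 52] q) = t * peval rho q.
  by rewrite (peval_scale char2) // /meval big_cons big_nil mulr1.
move: hc; rewrite /spin_candidates; case: ifP => hlong; rewrite inE => /orP[/eqP ->|].
- by rewrite peval_nil.
- have Kt : K t by move: at_; rewrite /adm hlong.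
  rewrite mem_cat => /orP[/mapP[q /mapP[l' hl' ->] ->]|/mapP[i hi ->]].
    by rewrite m1 quad_symP ?bA // Vx; apply: KM => //; apply: Ax.
  by rewrite m1 (peval_mul char2) // -expr2; apply: KM.
- by rewrite peval_nil.
move=> /mapP[q /mapP[l' hl' ->] ->].
rewrite (peval_add char2) m1 quad_symP // Vx Qx mulr0 add0r.
rewrite (peval_scale char2) // /meval !big_cons big_nil mulr1 -expr2.
by rewrite quad_symP ?bA // Vx; apply: KM => //; apply: Ax.
Qed.

Lemma vec_inv_U r t x : isroot r -> posn r -> adm r t ->
  vec_inv x -> vec_inv (U r t *m x).
Proof.
move=> hr pr at_ [lx Qx Ax].
have /and3P[/allP cz cQ /allP cA] : vec_check r.
  by apply: (allP vec_checks); rewrite mem_filter pr in_root_range.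
set rho := env (cf x) t 0 1 1.
have ok : env_ok rho by apply: env_okP; rewrite oner_neq0.
have Vx := veval_vec_generic t lx; rewrite -/rho in Vx.
have Wx : veval rho (sact r [:: bn 52] vec_generic) = U r t *m x.
  by rewrite (veval_sact char2) // Vx /meval big_cons big_nil mulr1.
split.
- move=> i hi zi; rewrite -Wx cf_veval //.
  by have := cz i; rewrite mem_iota zi => /(_ hi) /nilP ->; rewrite peval_nil.
- by have := peqP char2 rho cQ; rewrite !quad_symP // Wx Vx => ->; exact: Qx.
move=> i hi; have i52 : (i < 52)%N by move: hi; rewrite !inE => /or4P[||| /or3P[]] /eqP ->.
have /hasP[c hc /(peqP char2 rho)] := cA i hi.
rewrite (peval_add char2) -!cf_veval // Wx Vx => ->; apply: KD; first exact: Ax.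
move: hc; rewrite inE => /orP[/eqP ->|/mapP[j hj ->]]; first by rewrite peval_nil.
have j52 : (j < 52)%N by move: hj; rewrite !inE => /or4P[||| /or3P[]] /eqP ->.
rewrite (peval_scale char2) // -cf_veval // Vx; apply: KM; last exact: Ax.
move: at_; rewrite /adm; case: longn => [Kt|_].
  by rewrite /meval big_cons big_nil mulr1.
by rewrite /meval !big_cons big_nil mulr1 -expr2.
Qed.

Lemma Umon_inv_vec (I : 'cV[L]_52 -> Prop) (phi : pred nat) u x :
  (forall r t y, isroot r -> phi r -> adm r t -> I y -> I (U r t *m y)) ->
  Umon K phi u -> I x -> I (u *m x).
Proof.
move=> h; elim=> [|_ k [r [t [hr pr ar ->]]] _ IH] Ix; first by rewrite mul1mx.
by rewrite -mulmxA; apply: h => //; apply: IH.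
Qed.

Definition ev (s : nat) : 'cV[L]_52 := delta_mx (inord s) 0.

Lemma cf_ev s i : (s < 52)%N -> (i < 52)%N -> cf (ev s) i = (i == s)%:R.
Proof.
by move=> hs hi; rewrite /cf mxE eqxx andbT -val_eqE /= !inordK.
Qed.

Lemma spin_inv_ev e s : (e <= 1)%N -> shortn s -> deg s = (3 - 2 * e)%N -> spin_inv e (ev s).
Proof.
move=> he /andP[hs1 hs2] ds; have s52 : (s < 52)%N by apply: ltn_trans hs2 _.
have bnd : all (all (fun p => [&& p.1 < 52, p.2 < 52 & p.1 != p.2])%N)
    (spin_norm e :: map (shift_pairs e) spin_pairs).
  by case: e he {ds} => [|[|]].
have q0 l : l \in (spin_norm e :: map (shift_pairs e) spin_pairs) -> quad l (ev s) = 0.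
  move=> /(allP bnd) /allP hl; rewrite /quad big_seq big1 // => p /hl /and3P[h1 h2 ne].
  rewrite !cf_ev //; have [e1|] := eqVneq p.1 s; last by rewrite mul0r.
  by rewrite -e1 eq_sym (negPf ne) mulr0.
split; last 2 first.
- by apply: q0; rewrite mem_head.
- by move=> l hl; rewrite q0 // inE map_f ?orbT.
move=> i hi di; rewrite cf_ev //; case: eqP => // ei.
by move: di; rewrite ei ds ltnn.
Qed.

Lemma vec_inv_ev s : s \in vec_ix -> vec_inv (ev s).
Proof.
move=> hs; have s52 : (s < 52)%N by move: hs; rewrite !inE => /or4P[||| /or3P[]] /eqP ->.
split.
- move=> i hi zi; rewrite cf_ev //; case: eqP => // ei; move: zi hs; rewrite ei => {ei}.
  by rewrite !inE => + /or4P[||| /or3P[]] /eqP e; rewrite e.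
- rewrite /quad /vec_norm !big_cons big_nil !cf_ev //=.
  by move: hs; rewrite !inE => /or4P[||| /or3P[]] /eqP -> /=; rewrite ?mulr0 ?mul0r ?addr0.
move=> i hi; have i52 : (i < 52)%N by move: hi; rewrite !inE => /or4P[||| /or3P[]] /eqP ->.
by rewrite cf_ev //; case: eqP.
Qed.

(** The inverse of u is again a product of positive root elements and preserves [low], so vanishing
    for u X_s would carry over to X_s. This is what the anisotropy of q will contradict for s other
    than +-e4. *)
Lemma low_not_all0 u s d : shortn s -> deg s = d -> Umon K posn u -> ~ low d.+1 (u *m ev s).
Proof.
move=> /andP[_ hs] ds hu lo; have s52 : (s < 52)%N by apply: ltn_trans hs _.
have [u' hu' E] := Umon_inv char2 hu.
have [u'' hu'' E'] := Umon_inv char2 hu'.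
have uu : u' *m u = 1.
  have uE : u = u'' by rewrite -[LHS]mulr1 -E' mulrA E mul1r.
  by rewrite uE; exact: E'.
have := lo; move/(Umon_inv_vec (I := low d.+1) (fun r t y hr pr _ => @low_U _ r t y hr (posn_deg hr pr)) hu').
rewrite mulmxA uu mul1mx => /(_ s s52); rewrite ds ltnSn cf_ev // eqxx => /(_ isT) /eqP.
by rewrite oner_eq0.
Qed.

Lemma fixes_highest r t : isroot r -> (2 <= deg r)%N -> U r t *m ev 30 = ev 30.
Proof.
move=> hr dr; have c : fixes_highest_check r.
  by apply: (allP fixes_highest_checks); rewrite mem_filter dr in_root_range.
apply/matrixP => i j; rewrite (ord1 j) (U_mulE char2).
have z k : (k < 52)%N -> k != 30%N -> ev 30 (inord k) 0 = 0.
  by move=> hk k30; have := cf_ev (isT : 30 < 52)%N hk; rewrite (negPf k30) /cf => ->.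
move: c => /hasPn/(_ i); rewrite mem_iota => /(_ (ltn_ord i)); rewrite mem_cat negb_or.
have := rows_lt52 r i; rewrite all_cat => /andP[bb1 bb2].
move=> /andP[n1 n2]; rewrite !big_seq !big1 ?mulr0 ?add0r // => k hk; apply: z.
- exact: (allP bb2).
- by move: hk; apply: contraTneq => ->; exact: n2.
- exact: (allP bb1).
- by move: hk; apply: contraTneq => ->; exact: n1.
Qed.

Lemma P_fixes_highest p : Umon K Pphi p -> p *m ev 30 = ev 30.
Proof.
by move=> hp; apply: (Umon_inv_vec (I := fun y => y = ev 30) _ hp) => // r t y hr dr _ ->;
  apply: fixes_highest.
Qed.

End Invariants.

(** * The semilinear map inducing sigma *)

Lemma root_ofE v d : (root_ix v < 48)%N -> root_of v d = root_ix v :> nat.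
Proof.
move=> lt; have un : uniq F4_roots by vm_compute.
rewrite /root_of; case: pickP => [i /eqP /= <-|/(_ (Ordinal lt)) /=].
  by rewrite /root_ix /rvec index_uniq.
by rewrite /rvec /= nth_index ?eqxx // -index_mem.
Qed.

Lemma F4root_isroot (r : F4root) : isroot r. Proof. exact: ltn_ord. Qed.

Lemma eqb_eq (p q : bool) : p == q -> p = q.
Proof. by move/eqP. Qed.

Lemma long_rootE (r : F4root) : long_root r = longn r.
Proof.
apply: eqb_eq; rewrite /long_root !big_ord_recl big_ord0 /rcoord /rvec /=.
have := F4root_isroot r; move: (nat_of_ord r).
apply: all_rootsP.
by vm_compute.
Qed.

Lemma opp_rootE (r : F4root) : opp_root r = oppn r :> nat.
Proof.
have /andP[h /eqP <-] : (root_ix [seq - x | x <- rvec r] < 48)%N &&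
    (root_ix [seq - x | x <- rvec r] == oppn r).
  have := F4root_isroot r; rewrite /rvec; move: (nat_of_ord r).
  by apply: all_rootsP; vm_compute.
exact: root_ofE.
Qed.

Lemma sigma_rootE (r : F4root) : sigma_root r = sigr r :> nat.
Proof.
rewrite /sigma_root; set v := [:: _; _; _; _].
have /andP[h /eqP <-] : (root_ix v < 48)%N && (root_ix v == sigr r).
  rewrite /v /rcoord /rvec; have := F4root_isroot r; move: (nat_of_ord r).
  by apply: all_rootsP; vm_compute.
exact: root_ofE.
Qed.

Lemma w_e4E (r : F4root) : w_e4 r = we4n r :> nat.
Proof.
rewrite /w_e4; set v := [:: _; _; _; _].
have /andP[h /eqP <-] : (root_ix v < 48)%N && (root_ix v == we4n r).
  rewrite /v /rcoord /rvec; have := F4root_isroot r; move: (nat_of_ord r).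
  by apply: all_rootsP; vm_compute.
exact: root_ofE.
Qed.

Lemma e4E : e4 = 30%N :> nat.
Proof. by rewrite root_ofE //; vm_compute. Qed.

Lemma alphaE (i : 'I_4) : alpha i = nth 0%N simple i :> nat.
Proof.
have /andP[h /eqP E] : (root_ix (simple_vec i) < 48)%N && (root_ix (simple_vec i) == nth 0%N simple i).
  by case: i => [[|[|[|[|]]]] hi] //; vm_compute.
by rewrite /alpha root_ofE.
Qed.

Lemma in_PhiJE (r : F4root) : in_PhiJ r = (deg r == 2).
Proof.
apply: eqb_eq; rewrite /in_PhiJ /rcoord /rvec.
have := F4root_isroot r; move: (nat_of_ord r).
by apply: all_rootsP; vm_compute.
Qed.

(** The triangular system expressing v in the simple roots, solved in doubled coordinates. The
    absolute values are harmless because the coefficients are nonnegative for the positive roots to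
    which it is applied. *)
Definition simple_coefs (v : seq int) : seq nat :=
  [:: absz v`_3; absz ((v`_0 + v`_1 + v`_2 + 3 * v`_3) %/ 2)%Z;
      absz ((v`_0 + v`_1 + 2 * v`_3) %/ 2)%Z; absz ((v`_0 + v`_3) %/ 2)%Z]%R.

Lemma positive_rootP (r : F4root) : (2 < deg r)%N -> positive_root r.
Proof.
move=> dr; exists (fun i => nth 0%N (simple_coefs (rvec r)) i) => j.
rewrite !big_ord_recl big_ord0 /rcoord /rvec /simple_vec; apply/eqP.
move: dr (F4root_isroot r) => /[swap]; move: (nat_of_ord r) => m hm; apply/implyP; move: m hm.
by case: j => [[|[|[|[|j]]]] hj] //=; apply: all_rootsP; vm_compute.
Qed.

Lemma negative_root_w_e4 (r : F4root) : (2 < deg r)%N -> negative_root (w_e4 r).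
Proof.
move=> dr; exists (fun i => nth 0%N (simple_coefs [seq - x | x <- nth [::] F4_roots (we4n r)]) i) => j.
rewrite !big_ord_recl big_ord0 /rcoord /rvec w_e4E /simple_vec; apply/eqP.
move: dr (F4root_isroot r) => /[swap]; move: (nat_of_ord r) => m hm; apply/implyP; move: m hm.
by case: j => [[|[|[|[|j]]]] hj] //=; apply: all_rootsP; vm_compute.
Qed.

Section Intertwiner.
Variable L : fieldType.
Hypothesis char2 : (2%:R : L) = 0.
Variables a b : L.
Hypotheses (a0 : a != 0) (b0 : b != 0).
Local Notation U := (@U L).

Definition chival (r : nat) : L :=
  let e := nth (0%R, 0%R) chi_tab r in a ^ e.1 * b ^ e.2.

Lemma meval_chi x t v r : meval (env x t v a b) (chi r) = chival r.
Proof.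
rewrite /chi /chival /meval big_cat /=; congr (_ * _).
  case: (_.1) => m; rewrite /xpow big_nseq iter_mulr_1 //.
  by rewrite /env /= exprVn.
case: (_.2) => m; rewrite /ypow big_nseq iter_mulr_1 //.
by rewrite /env /= exprVn.
Qed.

Definition Mx : 'M[L]_52 := \matrix_(i, j)
  if (i < 48)%N then (j == sigr i :> nat)%:R * chival (sigr i)
  else (j == i)%:R + ((i == 49%N :> nat) && (j == 48%N :> nat))%:R.

Lemma sigr_root r : isroot r -> isroot (sigr r).
Proof. by move: r; apply: all_rootsP; vm_compute. Qed.

Lemma Mx_mulE m (X : 'M[L]_(52, m)) i j : (Mx *m X) i j =
  if (i < 48)%N then chival (sigr i) * X (inord (sigr i)) j
  else X i j + (i == 49%N :> nat)%:R * X (inord 48) j.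
Proof.
rewrite mxE; case: ifP => hi.
  have s52 : (sigr i < 52)%N by apply: ltn_trans (sigr_root hi) _.
  rewrite (bigD1 (inord (sigr i))) //= big1 ?addr0 ?mxE ?hi ?inordK ?eqxx ?mul1r // => k ne.
  rewrite mxE hi; case: eqP => [e|]; last by rewrite !mul0r.
  by case/eqP: ne; apply: val_inj; rewrite /= inordK.
under eq_bigr => k _ do rewrite mxE hi mulrDl.
rewrite big_split /=; congr (_ + _).
  rewrite (bigD1 i) //= eqxx mul1r big1 ?addr0 // => k /negPf ne.
  by rewrite ne mul0r.
rewrite (bigD1 (inord 48)) //= inordK // eqxx andbT big1 ?addr0 // => k ne.
case: (k == 48%N :> nat) / eqP => [e|]; last by rewrite andbF mul0r.
by case/eqP: ne; apply: val_inj; rewrite /= inordK.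
Qed.

Lemma veval_mact x t v V :
  let rho := env x t v a b in veval rho (mact V) = Mx *m veval rho V.
Proof.
move=> rho; have ok : env_ok rho by apply: env_okP.
apply/matrixP => i j; rewrite (ord1 j) Mx_mulE mxE nth_mkseq //.
case: ifP => hi.
  rewrite (peval_scale char2) // meval_chi mxE inordK //.
  exact: ltn_trans (sigr_root hi) _.
rewrite !mxE inordK //; case: eqP => [->|_]; last by rewrite mul0r addr0.
by rewrite (peval_add char2) mul1r addrC.
Qed.

Lemma intertwine r t : isroot r -> Mx *m U r t = U (sigr r) (t * chival r) *m Mx.
Proof.
move=> hr; apply: mulmx_ext => x.
have /(veqP char2 (env (fun i => x (inord i) 0) t 0 a b)) := all_rootsP intertwine_checks hr.
set rho := env _ _ _ _ _; have ok : env_ok rho by apply: env_okP.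
rewrite veval_mact !(veval_sact char2) // veval_mact !veval_generic.
rewrite [meval rho (_ :: chi r)]meval_cons (meval_chi (fun i => x (inord i) 0) t 0 r) /meval big_cons big_nil mulr1.
by rewrite !mulmxA.
Qed.

Lemma MxMx : Mx *m Mx = 1.
Proof.
apply: mulmx_ext => x.
have E := veqP char2 (env (fun i => x (inord i) 0) 0 0 a b) mact_involutive.
have E1 := etrans (veval_mact _ _ _ (mact generic)) (congr1 (mulmx Mx) (veval_mact _ _ _ generic)).
by have := etrans (esym (E1 _ _ _)) E; rewrite veval_generic mul1mx -mulmxA.
Qed.

Lemma Mx_highest : Mx *m ev L 30 = ev L 30.
Proof.
apply/matrixP => i j.
have s52 : (sigr i < 52)%N by apply: (all_nth (P := fun k => k < 52)%N); vm_compute.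
rewrite (ord1 j) Mx_mulE !mxE !eqxx !andbT -!val_eqE /= !inordK //.
case: ifP => hi; last by rewrite mulr0 addr0.
have -> : (sigr i == 30%N) = (i == 30%N :> nat).
  by apply: eqb_eq; move: (nat_of_ord i) hi; apply: all_rootsP; vm_compute.
case: eqP => [->|_]; last by rewrite mulr0.
by rewrite mulr1 /chival /= !expr0z mulr1.
Qed.

Lemma map_U (bar : {rmorphism L -> L}) r t : map_mx bar (U r t) = U r (bar t).
Proof.
have S (l : seq (nat * nat * int)) : map_mx bar (sparse_mx L l) = sparse_mx L l.
  apply/matrixP => i j; rewrite !mxE rmorph_sum; apply: eq_bigr => e _; exact: rmorph_int.
by rewrite /U !map_mxD !map_mxZ !S rmorphXn map_mx1.
Qed.

End Intertwiner.

(** * The e4-grading *)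

Definition pattern_check r := all (fun j => all (fun i =>
    (if (j < 48)%N then i == refl r j else (48 <= i)%N) ||
     nilp (nth [::] (run (nx r) (basis j)) i)) (iota 0 52)) (iota 0 52).
Lemma pattern_checks : all pattern_check simple.
Proof. by vm_compute. Qed.

Definition opposite_degree_check := all (fun j =>
    let V := run (n1 30) (basis j) in
    all (fun i => (deg i + deg j == 4)%N || nilp (nth [::] V i)) (iota 0 52)) (iota 0 52).
Lemma opposite_degree_checkT : opposite_degree_check.
Proof. by vm_compute. Qed.

Section Patterns.
Variable L : fieldType.
Hypothesis char2 : (2%:R : L) = 0.
Variable K : L -> Prop.
Hypothesis K1 : K 1.
Hypothesis KD : forall x y, K x -> K y -> K (x + y).
Hypothesis KM : forall x y, K x -> K y -> K (x * y).
Hypothesis KV : forall x, K x -> K x^-1.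
Hypothesis Ksq : forall x, K (x ^+ 2).
Local Notation U := (@U L).
Local Notation n := (@n L).
Local Notation nw := (@nw L).
Local Notation adm := (adm K).
Local Notation Umon := (Umon K).
Local Notation Tmon := (Tmon K).
Local Notation ev := (ev L).
Implicit Types (g h l : 'M[L]_52).

Definition permutes (p : nat -> nat) g := forall i j : 'I_52,
  ~~ (if (j < 48)%N then i == p j :> nat else (48 <= i)%N) -> g i j = 0.

Lemma permutes_n i x : i \in simple -> x != 0 -> permutes (refl i) (n i x).
Proof.
move=> hi x0 k j ne.
have ok : env_ok (params 0 0 x 1) by apply: env_okP; rewrite ?oner_neq0.
have := mat_entry char2 (nx i) k j ok; rewrite mat_nx => ->.
have /allP/(_ j) := allP pattern_checks i hi.
rewrite mem_iota => /(_ (ltn_ord j)) /allP/(_ k).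
by rewrite mem_iota (negPf ne) => /(_ (ltn_ord k)) /nilP ->; rewrite peval_nil.
Qed.

Lemma permutes_mul p q g h : (forall r, isroot r -> isroot (q r)) ->
  permutes p g -> permutes q h -> permutes (fun r => p (q r)) (g * h).
Proof.
move=> hq pg ph i j ne; rewrite [g * h]/(g *m h) mxE big1 // => k _.
have [e|/ph ->] := boolP (if (j < 48)%N then k == q j :> nat else (48 <= k)%N); last by rewrite mulr0.
rewrite pg ?mul0r //; move: e ne; case: ifP => hj.
  by move=> /eqP ->; rewrite (hq _ hj : q j < 48)%N.
by rewrite leqNgt => /negPf ->.
Qed.

Lemma permutes_nw w : all (mem simple) w -> permutes (act_word w) (nw w).
Proof.
elim: w => [_|i w IH /= /andP[hi hw]].
  move=> i j; rewrite mxE -val_eqE /=; case: ifP => [_ /negPf -> //|hj].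
  by case: (i =P j :> nat) => // ->; rewrite leqNgt hj.
apply: (permutes_mul (p := refl i) (q := act_word w)).
- by move=> r hr; have [] := act_word_facts char2 hw hr.
- by apply: permutes_n; rewrite ?oner_neq0.
- exact: IH.
Qed.

Definition graded g := forall i j : 'I_52, deg i != deg j -> g i j = 0.

Lemma graded_mul g h : graded g -> graded h -> graded (g * h).
Proof.
move=> gg gh i j ne; rewrite [g * h]/(g *m h) mxE big1 // => k _.
have [e|/gg ->] := eqVneq (deg i) (deg k); last by rewrite mul0r.
by rewrite gh ?mulr0 // -e.
Qed.

Lemma graded1 : graded 1.
Proof. by move=> i j; rewrite mxE; case: (i =P j) => // ->; rewrite eqxx. Qed.

(** In a generator the permutations of the root lines cancel, as w s_i s_i w^-1 = 1, and the toral
    block, which is mapped to itself, lies entirely in degree 2. *)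
Lemma graded_T h : Tmon h -> graded h.
Proof.
elim=> [|_ k [w [i [x [y [hw hi /andP[x0 y0] _ ->]]]]] _ IH]; first exact: graded1.
apply: graded_mul => {k IH} //.
have hrw : all (mem simple) (rev w) by rewrite all_rev.
have P := permutes_mul (p := act_word w \o (refl i \o refl i)) (q := act_word (rev w))
  (g := nw w * (n i x * n i y)) (h := nw (rev w)).
have {}P : permutes (fun r => act_word w (refl i (refl i (act_word (rev w) r))))
    (nw w * (n i x * n i y) * nw (rev w)).
  apply: P; [|apply: permutes_mul|exact: permutes_nw].
  - by move=> r hr; have [] := act_word_facts char2 hrw hr.
  - by move=> r hr; have [h1 _ _ _ _] := nconj_facts hi hr; have [] := nconj_facts hi h1.
  - exact: permutes_nw.
  apply: permutes_mul; [|exact: permutes_n..].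
  by move=> r hr; have [] := nconj_facts hi hr.
move=> r s ne; apply: P; move: ne; case: ifP => hs; apply: contraNN.
  have [h1 _ _ _ _] := act_word_facts char2 hrw hs.
  have [_ _ -> _ _] := nconj_facts hi h1; have [_ _ -> _ _] := act_word_facts char2 hw hs.
  by move=> /eqP ->.
have toral m : (48 <= m)%N -> deg m = 2 by move=> hm; rewrite /deg nth_default.
by move=> hr; rewrite (toral r hr) (toral s) // leqNgt hs.
Qed.

Definition upper g := forall i j : 'I_52, (deg i <= deg j)%N -> g i j = (i == j)%:R.

Lemma upper_mul g h : upper g -> upper h -> upper (g * h).
Proof.
move=> ug uh i j le; rewrite [g * h]/(g *m h) mxE (bigD1 i) //= ug // eqxx mul1r.
rewrite uh // big1 ?addr0 // => k ki.
have [lk|lk] := leqP (deg k) (deg j); last first.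
  by rewrite ug 1?ltnW ?(leq_ltn_trans le) // eq_sym (negPf ki) mul0r.
have [e|ne] := eqVneq k j; last by rewrite uh // (negPf ne) mulr0.
by rewrite e in ki *; rewrite ug // eq_sym (negPf ki) mul0r.
Qed.

Lemma U_entry (lt : rel nat) r t (i j : 'I_52) : degree_check lt r -> ~~ lt (deg j) (deg i) ->
  U r t i j = (i == j)%:R.
Proof.
move=> c nl; rewrite -[U r t]mulmx1 (U_mulE char2) mxE.
have z (k : nat) : k \in nth [::] (nth [::] rows_adX r) i ++ nth [::] (nth [::] rows_adX2 r) i ->
    (1%:M : 'M[L]_52) (inord k) j = 0.
  move=> hk; have := degree_rows c (ltn_ord i) hk; have := allP (rows_lt52 r i) k hk.
  move=> k52 lk; rewrite mxE -val_eqE /= inordK //; case: eqP => // e.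
  by move: nl; rewrite -e lk.
rewrite !big_seq !big1 ?mulr0 ?add0r // => k hk; apply: z; rewrite mem_cat hk ?orbT //.
Qed.

Lemma upper_Umon g : Umon (fun r => 2 < deg r)%N g -> upper g.
Proof.
elim=> [|_ k [r [t [hr dr _ ->]]] _ IH]; first by move=> i j; rewrite mxE.
apply: upper_mul => // i j le; have /andP[_ /allP h] := degree_checks.
by apply: (U_entry (lt := ltn)); rewrite -?leqNgt //; apply: h; rewrite mem_filter dr in_root_range.
Qed.

Lemma graded_Umon g : Umon (fun r => deg r == 2)%N g -> graded g.
Proof.
elim=> [|_ k [r [t [hr dr _ ->]]] _ IH]; first exact: graded1.
apply: graded_mul => // i j ne.
rewrite (U_entry (lt := fun m n => m == n) (r := r)).
- by case: (i =P j) ne => // ->; rewrite eqxx.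
- by apply: (allP degree_eq_checks); rewrite mem_filter dr in_root_range.
by rewrite eq_sym.
Qed.

Lemma n_e4_degree (i j : 'I_52) : (deg i + deg j)%N != 4 -> n 30 1 i j = 0.
Proof.
move=> ne; have ok : env_ok (params (0 : L) 0 1 1) by apply: env_okP; rewrite oner_neq0.
have := mat_entry char2 (n1 30) i j ok; rewrite mat_n1 => ->.
have /allP/(_ j) := opposite_degree_checkT; rewrite mem_iota => /(_ (ltn_ord j)) /allP/(_ i).
by rewrite mem_iota (negPf ne) => /(_ (ltn_ord i)) /nilP ->; rewrite peval_nil.
Qed.

Lemma deg_le4 i : (deg i <= 4)%N.
Proof. by apply: (all_nth (P := fun k => k <= 4)%N); vm_compute. Qed.

(** n_{e4} exchanges the degrees d and 4 - d and so turns block upper into block lower unitriangular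
    matrices. The entry is compared with that of n_{e4}^2 = 1: only entries of g where it agrees
    with the identity contribute. *)
Lemma n_e4_conj_upper g (i j : 'I_52) : upper g -> (deg j <= deg i)%N ->
  (n 30 1 * g * n 30 1) i j = (i == j)%:R.
Proof.
move=> ug le; have e : (n 30 1 * n 30 1 : 'M[L]_52) i j = (i == j)%:R.
  by rewrite n_sq // mxE.
rewrite -e -mulrA [_ * (_ * _)]/(_ *m (_ *m _)) [_ * _]/(_ *m _) !mxE; apply: eq_bigr => k _.
have [dk|dk] := eqVneq (deg i + deg k)%N 4; last by rewrite n_e4_degree // !mul0r.
congr (_ * _); rewrite mxE (bigD1 k) //= ug // eqxx mul1r big1 ?addr0 // => m mk.
have [dm|dm] := eqVneq (deg m + deg j)%N 4; last by rewrite n_e4_degree // mulr0.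
rewrite ug; last by rewrite -(leq_add2l (deg i)) dk -dm [(deg i + _)%N]addnC leq_add2l.
by rewrite eq_sym (negPf mk) mul0r.
Qed.

(** The left side is block upper triangular with diagonal part l, the right side block lower
    triangular with diagonal part a'; both are therefore block diagonal. *)
Lemma big_cell_unique a a' l w : l \is a GRing.unit -> graded l -> graded a' -> upper a -> upper w ->
  a * l = a' * (n 30 1 * w * n 30 1) -> a = 1 /\ l = a'.
Proof.
move=> ul gl gl' ua uw E.
have e1 (i j : 'I_52) : (deg i <= deg j)%N -> (a * l) i j = l i j.
  move=> le; rewrite [a * l]/(a *m l) mxE (bigD1 i) //= ua // eqxx mul1r big1 ?addr0 // => k ki.
  have [e|ne] := eqVneq (deg k) (deg j); last by rewrite gl ?mulr0.
  by rewrite ua ?e // eq_sym (negPf ki) mul0r.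
have e2 (i j : 'I_52) : (deg j <= deg i)%N -> (a * l) i j = a' i j.
  move=> le; rewrite E [a' * _]/(a' *m _) mxE (bigD1 j) //= n_e4_conj_upper // eqxx mulr1.
  rewrite big1 ?addr0 // => k kj.
  have [e|ne] := eqVneq (deg i) (deg k); last by rewrite gl' ?mul0r.
  by rewrite n_e4_conj_upper -?e // (negPf kj) mulr0.
have ll : l = a'.
  apply/matrixP => i j; have [e|ne] := eqVneq (deg i) (deg j); last by rewrite gl // gl'.
  by rewrite -e1 ?e // e2 ?e.
have al : a * l = l.
  apply/matrixP => i j; case: (leqP (deg i) (deg j)) => h; first exact: e1.
  by rewrite e2 1?ltnW // ll.
by split=> //; apply: (mulIr ul); rewrite al mul1r.
Qed.

Lemma shortnE r : isroot r -> shortn r = ~~ longn r.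
Proof. by rewrite /shortn /longn /isroot -leqNgt => ->; rewrite andbT. Qed.

Lemma refl_short i s : i \in simple -> shortn s -> shortn (refl i s).
Proof.
by move=> hi hs; have hr := shortn_root hs; have [h1 h2 _ _ _] := nconj_facts hi hr;
   rewrite shortnE // h2 -shortnE.
Qed.

Lemma n_short i s x : i \in simple -> shortn s -> x != 0 ->
  n i x *m ev s = x ^ (- cart i s) *: ev (refl i s).
Proof.
move=> hi hs x0; have hr := shortn_root hs.
have s52 : (s < 52)%N by apply: ltn_trans hr _.
have [r1 _ _ _ _] := nconj_facts hi hr.
have r52 : (refl i s < 52)%N by apply: ltn_trans r1 _.
have c : highest_check i s.
  by apply: (allP (allP highest_checks i hi)); rewrite mem_filter hs in_root_range.
have ok : env_ok (params 0 0 x 1) by apply: env_okP; rewrite ?oner_neq0.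
have := veqP char2 (params 0 0 x 1) c.
rewrite (veval_run char2) // mat_nx veval_basis // => ->.
apply/matrixP => k j; rewrite (ord1 j) [LHS]mxE (nth_map [::]) ?size_mkseq //.
rewrite (peval_scale char2) // meval_xpow mxE; congr (_ * _).
by have /matrixP/(_ k 0) := veval_basis (params 0 0 x 1) r52; rewrite mxE => ->.
Qed.

Lemma nw_short w s : all (mem simple) w -> shortn s ->
  shortn (act_word w s) /\ nw w *m ev s = ev (act_word w s).
Proof.
move=> hw hs; elim: w hw => [|i w IH] /= => [_|/andP[hi /IH[s1 E]]]; first by rewrite mul1mx.
split; first exact: refl_short.
by rewrite -mulmxA E n_short ?oner_neq0 // exp1rz scale1r.
Qed.

Lemma T_short h s : Tmon h -> shortn s ->
  exists2 lam : L, lam != 0 & h *m ev s = lam *: ev s.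
Proof.
move=> Th hs; elim: Th => [|_ k [w [i [x [y [hw hi /andP[x0 y0] _ ->]]]]] _ [lam l0 IH]].
  by exists 1; rewrite ?oner_neq0 // mul1mx scale1r.
have hrw : all (mem simple) (rev w) by rewrite all_rev.
have [s1 E1] := nw_short hrw hs.
have s2 := refl_short hi s1.
have [_ _ rr _ _] := nconj_facts hi (shortn_root s1).
have [_ _ ww _ _] := act_word_facts char2 hw (shortn_root hs).
exists (lam * (y ^ (- cart i (act_word (rev w) s)) * x ^ (- cart i (refl i (act_word (rev w) s))))).
  by rewrite !mulf_neq0 // expfz_neq0.
rewrite -mulmxA IH -scalemxAr -scalerA; congr (_ *: _).
rewrite -!mulmxA E1 n_short // -!scalemxAr n_short // rr -!scalemxAr scalerA.
by have [_ ->] := nw_short hw s1; rewrite ww.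
Qed.

Lemma nw_word s : shortn s -> nw (word s) *m ev 30 = ev s.
Proof.
move=> hs; have hr := shortn_root hs.
have c : word_check s by apply: (allP word_checks); rewrite mem_filter hs in_root_range.
have ok : env_ok (params (0 : L) 0 1 1) by apply: env_okP; rewrite oner_neq0.
have := veqP char2 (params 0 0 1 1) c.
rewrite (veval_run char2) // mat_nword !veval_basis //.
exact: ltn_trans hr _.
Qed.

Lemma Umon_simple_n i : i \in simple -> Umon (mem sgsimple) (n i 1).
Proof.
move=> hi; have hr := simple_root hi.
have [g1 g2] : (i \in sgsimple) * (oppn i \in sgsimple).
  by rewrite [sgsimple](_ : _ = simple ++ map oppn simple) // !mem_cat hi map_f ?orbT.
rewrite nE invr1; do !apply: mon_mul;
  by apply: Umon_U; rewrite ?oppn_root //; apply: adm1.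
Qed.

Lemma Umon_nw w : all (mem simple) w -> Umon (mem sgsimple) (nw w).
Proof.
elim: w => [_|i w IH /= /andP[hi hw]]; first exact: mon1.
by apply: mon_mul; [apply: Umon_simple_n | apply: IH].
Qed.

Lemma Umon_generated g : Umon predT g -> Umon (mem sgsimple) g.
Proof.
apply: mon_sub => _ [r [t [hr _ ar ->]]].
have [w [i [hw hi li ->]]] := root_wordP char2 hr.
apply: mon_mul; first apply: mon_mul; [exact: Umon_nw| |by apply: Umon_nw; rewrite all_rev].
apply: Umon_U; [exact: simple_root| |by move: ar; rewrite /adm li].
by rewrite /= [sgsimple](_ : _ = simple ++ map oppn simple) // mem_cat hi.
Qed.

Lemma Umon_predT phi g : Umon phi g -> Umon predT g.
Proof. exact: Umon_sub. Qed.

Lemma Umon_T h : Tmon h -> Umon predT h.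
Proof.
apply: mon_sub => _ [w [i [x [y [hw hi /andP[x0 y0] [ax ay] ->]]]]].
have hr := simple_root hi.
have oadm z : adm i z -> adm (oppn i) z.
  by rewrite /adm (_ : longn (oppn i) = longn i) //; move: hi; rewrite !inE => /or4P[] /eqP ->.
have H z : adm i z -> Umon predT (n i z).
  move=> az; rewrite nE; do !apply: mon_mul; apply: Umon_U => //; first exact: oppn_root.
  exact/oadm/admV.
apply: mon_mul; first apply: mon_mul.
- exact/(Umon_predT (phi := mem sgsimple))/Umon_nw.
- by apply: mon_mul; apply: H.
by apply/(Umon_predT (phi := mem sgsimple))/Umon_nw; rewrite all_rev.
Qed.

Lemma T_inv h : Tmon h -> exists2 h', Tmon h' & h * h' = 1.
Proof.
apply: mon_inv => _ [w [i [x [y [hw hi /andP[x0 y0] [ax ay] ->]]]]].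
exists (nw w * (n i y * n i x) * nw (rev w)).
  by apply: mon_gen; exists w, i, y, x; split => //; rewrite x0 y0.
have := nw_rev char2 (_ : all (mem simple) (rev w)); rewrite all_rev revK => /(_ hw) E.
have ir := simple_root hi.
rewrite -!mulrA (mulE1 E) mul1r (mulE1 (n_sq char2 y ir)) mul1r (mulE1 (n_sq char2 x ir)) mul1r.
exact: nw_rev.
Qed.

Lemma levi_normal r t g : isroot r -> deg r = 2 -> adm r t ->
  Umon (fun r => 2 < deg r)%N g ->
  exists2 z, Umon (fun r => 2 < deg r)%N z & U r t * g = z * U r t.
Proof.
move=> hr dr ar; apply: mon_normal => _ [s [v [hs ds as_ ->]]].
have c : conj_case r s by rewrite /conj_case dr eqxx ds orbT.
apply: U_normal => //.
have := all_rootsP (all_rootsP conj_checks hr) hs.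
by rewrite /conj_check c dr eqxx ds => /and5P[_ _ _ h _].
Qed.

Lemma levi_normal_mon l g : Umon (fun r => deg r == 2)%N l ->
  Umon (fun r => 2 < deg r)%N g ->
  exists2 z, Umon (fun r => 2 < deg r)%N z & l * g = z * l.
Proof.
move=> hl hg; elim: hl => [|_ k [r [t [hr /eqP dr ar ->]]] _ [z hz E]].
  by exists g; rewrite ?mul1r ?mulr1.
have [z' hz' E'] := levi_normal hr dr ar hz.
by exists z' => //; rewrite -mulrA E !mulrA E'.
Qed.

Lemma mulVmon (S : 'M[L]_52 -> Prop) g g' :
  (forall s, mon S s -> exists2 s', mon S s' & s * s' = 1) -> mon S g -> mon S g' ->
  g * g' = 1 -> g' * g = 1.
Proof.
move=> h Sg Sg' E; have [g'' _ E'] := h _ Sg'.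
have -> : g = g'' by rewrite -[LHS]mulr1 -E' mulrA E mul1r.
exact: E'.
Qed.

Lemma normal_right (S : 'M[L]_52 -> Prop) phi g l :
  (forall s, mon S s -> exists2 s', mon S s' & s * s' = 1) ->
  (forall s u, mon S s -> Umon phi u -> exists2 z, Umon phi z & s * u = z * s) ->
  mon S l -> Umon phi g -> exists2 z, Umon phi z & g * l = l * z.
Proof.
move=> hinv hnorm Sl hg; have [l' Sl' E] := hinv _ Sl.
have [z hz E'] := hnorm _ _ Sl' hg; exists z => //.
have E2 := mulVmon hinv Sl Sl' E.
by rewrite -[LHS]mul1r -E -!mulrA (mulE2 E') E2 mulr1.
Qed.

Lemma parabolic_decomp p : Umon Pphi p -> exists a l,
  [/\ Umon (fun r => 2 < deg r)%N a, Umon (fun r => deg r == 2)%N l & p = a * l].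
Proof.
elim=> [|_ k [r [t [hr pr ar ->]]] _ [a [l [ha hl ->]]]].
  by exists 1, 1; split; rewrite ?mulr1 //; apply: mon1.
have [dr|dr] := eqVneq (deg r) 2.
  have [a' ha' E] := levi_normal hr dr ar ha.
  exists a', (U r t * l); split => //; last by rewrite mulrA E mulrA.
  by apply: monM => //; exists r, t; rewrite dr.
exists (U r t * a), l; split; rewrite ?mulrA //.
apply: monM => //; exists r, t; split => //.
by rewrite ltn_neqAle eq_sym dr.
Qed.

Lemma n_e4_word : n 30 1 = nw (word 31).
Proof.
have := progeqP char2 (0 : L) 0 (oner_neq0 _) (oner_neq0 _) word_e4_checkT.
by rewrite mat_n1 mat_nword.
Qed.

Lemma n_e4_levi l : Umon (fun r => deg r == 2)%N l ->
  exists2 z, Umon (fun r => deg r == 2)%N z & n 30 1 * l = z * n 30 1.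
Proof.
have hw : all (mem simple) (word 31) by apply: word_simple.
rewrite n_e4_word; apply: mon_normal => _ [r [t [hr dr ar ->]]].
have [h1 h2 _ _ ->] := act_word_facts char2 hw hr.
exists (U (act_word (word 31) r) t) => //; apply: Umon_U => //; last by rewrite /adm h2.
suff /implyP : (deg r == 2) ==> (deg (act_word (word 31) r) == 2) by apply.
by move: r hr {dr ar h1 h2}; apply: all_rootsP; vm_compute.
Qed.

End Patterns.

(** * Fixed points of sigma *)

Section FrozenGroups.
Variable L : fieldType.
Hypothesis char2 : (2%:R : L) = 0.
Variables (k : L -> Prop) (gamma : L).
Local Notation K := (Kset k gamma).
Hypothesis K1 : K 1.
Hypothesis KD : forall x y, K x -> K y -> K (x + y).
Hypothesis KM : forall x y, K x -> K y -> K (x * y).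
Hypothesis KV : forall x, K x -> K x^-1.
Hypothesis Ksq : forall x, K (x ^+ 2).
Local Notation U := (@U L).
Local Notation n := (@n L).
Local Notation adm := (adm K).
Local Notation Umon := (Umon K).
Local Notation Tmon := (Tmon K).

Definition ixroot (r : nat) : F4root := inord r : 'I_48.

Lemma ixrootE r : isroot r -> ixroot r = r :> nat.
Proof. exact: inordK. Qed.

Lemma admissibleE (r : F4root) t : admissible k gamma r t = adm r t.
Proof. by rewrite /admissible long_rootE. Qed.

Lemma U_root_Ugen x (r : F4root) : U_root k gamma r x -> Ugen K predT x.
Proof.
by move=> [t [ar ->]]; exists r, t; split; rewrite -?admissibleE //; apply: F4root_isroot.
Qed.

Lemma Ugen_U_root r t : isroot r -> adm r t -> U_root k gamma (ixroot r) (U r t).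
Proof.
by move=> hr ar; exists t; rewrite admissibleE /u_el -/(U _ _) ixrootE.
Qed.

Lemma F4KLE g : F4KL k gamma g <-> Umon predT g.
Proof.
split=> [|h].
  rewrite /F4KL => h.
  have {h}: mon (fun x => exists r, U_root k gamma r x) g.
    by apply: gen_mon h => s [r /U_root_Ugen]; apply: Ugen_sq.
  apply: mon_sub => s [r /U_root_Ugen]; exact: mon_gen.
apply: mon_gen_sub h => _ [r [t [hr _ ar ->]]].
by apply: gen_gen; exists (ixroot r); apply: Ugen_U_root.
Qed.

Lemma UJ_Umon g : Umon (fun r => 2 < deg r)%N g -> UJ g.
Proof.
apply: mon_gen_sub => _ [r [t [hr dr ar ->]]]; apply: gen_gen.
exists (ixroot r), t; rewrite in_PhiJE ixrootE // /u_el -/(U _ _) ixrootE //; split.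
  by apply: positive_rootP; rewrite ixrootE.
by split=> //; apply/eqP => e; move: dr; rewrite e.
Qed.

Lemma Uw_minus_Umon g : Umon (fun r => 2 < deg r)%N g -> Uw_minus k gamma g.
Proof.
apply: mon_gen_sub => _ [r [t [hr dr ar ->]]]; apply: gen_gen.
exists (ixroot r); rewrite in_PhiJE ixrootE //; split; last split; last split.
- by apply: positive_rootP; rewrite ixrootE.
- by apply/eqP => e; move: dr; rewrite e.
- by apply: negative_root_w_e4; rewrite ixrootE.
exact: Ugen_U_root.
Qed.

Lemma h_elE r t : isroot r -> h_el (ixroot r) t = n r t * n r 1.
Proof.
move=> hr; rewrite /h_el /n_el /u_el -!/(U _ _) opp_rootE !ixrootE //.
by rewrite !nE.
Qed.

Lemma gen_mulg (S : 'M[L]_52 -> Prop) g h : gen S g -> gen S h -> gen S (g * h).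
Proof.
move=> Sg Sh; elim: Sg => [|s x Ss _ IH|s x Ss _ IH]; rewrite ?mul1r // -mulrA.
  exact: gen_mul.
exact: gen_inv.
Qed.

Lemma LJ_Umon g : Umon (fun r => deg r == 2)%N g -> LJ g.
Proof.
apply: mon_gen_sub => _ [r [t [hr dr ar ->]]]; apply: gen_gen; right.
by exists (ixroot r), t; rewrite in_PhiJE ixrootE // /u_el -/(U _ _) ixrootE.
Qed.

(** Conjugation by [nw w] carries n_i to n_r with r = w(i), and n_r(1)^2 = 1 then rewrites the
    generator as h_r(x) h_r(y)^-1. *)
Lemma LJ_T g : Tmon g -> LJ g.
Proof.
apply: mon_gen_sub => _ [w [i [x [y [hw hi /andP[x0 y0] _ ->]]]]].
have ir := simple_root hi.
have [h1 _ _ h4 h5] := act_word_facts char2 hw ir.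
have [_ _ _ _ h5'] := act_word_facts char2 hw (oppn_root ir).
set r := act_word w i in h1 h4 h5.
have nn z : @nw L w * n i z = n r z * @nw L w.
  by rewrite !nE -!mulrA (mulE2 (h5 _)) (mulE2 (h5' _)) h5 -h4.
have -> : @nw L w * (n i x * n i y) * @nw L (rev w) = h_el (ixroot r) x * (h_el (ixroot r) y)^-1.
  rewrite !h_elE // -!mulrA (mulE2 (nn _)) (mulE2 (nn _)) nw_rev // mulr1.
  have E : (n r y * n r 1) * (n r 1 * n r y) = 1.
    by rewrite -!mulrA (mulE1 (n_sq char2 1 h1)) mul1r n_sq.
  have E' : (n r 1 * n r y) * (n r y * n r 1) = 1.
    by rewrite -!mulrA (mulE1 (n_sq char2 y h1)) mul1r n_sq.
  have u : n r y * n r 1 \is a GRing.unit by apply/unitrP; exists (n r 1 * n r y).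
  have -> : (n r y * n r 1)^-1 = n r 1 * n r y by rewrite -[LHS]mulr1 -E mulKr.
  by rewrite (mulE1 (n_sq char2 1 h1)) mul1r.
apply: gen_mulg; first by apply: gen_gen; left; exists (ixroot r), x.
rewrite -[_^-1]mulr1; apply: gen_inv; last exact: gen_one.
by left; exists (ixroot r), y.
Qed.

Lemma n_e4E : n_e4 L = n 30 1.
Proof.
rewrite /n_e4 /u_el -!/(U _ _) opp_rootE e4E nE invr1 //.
Qed.

End FrozenGroups.

Lemma short_degree2 s : shortn s -> deg s = 2 -> s \in vec_ix.
Proof.
move=> hs ds; have : shortn s && (deg s == 2) by rewrite hs ds.
by apply/implyP; have hr := shortn_root hs; move: s hr {hs ds}; apply: all_rootsP; vm_compute.
Qed.

Lemma short_extreme_degree s : shortn s -> (deg s == 0%N) || (deg s == 4) ->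
  (s == 30) || (s == 31).
Proof.
move=> hs ds; have : shortn s && ((deg s == 0%N) || (deg s == 4)) by rewrite hs ds.
by apply/implyP; have hr := shortn_root hs; move: s hr {hs ds}; apply: all_rootsP; vm_compute.
Qed.

(** * The action of sigma and the big cell *)

Section Twisted.
Variables (L : fieldType) (ell k : L -> Prop).
Hypotheses (Hell : is_subfield ell) (Hk : is_subfield k).
Hypothesis (Hk_ell : forall x, k x -> ell x).
Hypothesis (Hsq : forall x, ell x -> k (x ^+ 2)).
Hypothesis (char2 : (2%:R : L) = 0).
Variables (delta gamma : L).
Hypothesis (Hdelta : k delta).
Hypothesis (Hgamma : gamma ^+ 2 + gamma + delta = 0).
Hypothesis (HL : forall x : L, exists a b, ell a /\ ell b /\ x = a + b * gamma).
Variable bar : {rmorphism L -> L}.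
Hypotheses (Hbar_fix : forall x, ell x -> bar x = x) (Hbar_nontriv : bar gamma <> gamma).
Variables (a b : L).
Hypotheses (Ha : k a) (Ha0 : a <> 0) (Hb : k b) (Hb0 : b <> 0).
Hypothesis (Haniso : forall y1 y2 y3 y4 : L,
      ell y1 -> Kset k gamma y2 -> Kset k gamma y3 -> Kset k gamma y4 ->
      y1 ^+ 2 + a * (y2 * bar y2) + b * (y3 * bar y3)
        + a * b * (y4 * bar y4) = 0 ->
      [/\ y1 = 0, y2 = 0, y3 = 0 & y4 = 0]).
Variable sigma : 'M[L]_52 -> 'M[L]_52.
Hypothesis Hs_mul : forall g h, F4KL k gamma g -> F4KL k gamma h ->
      sigma (g * h) = sigma g * sigma h.
Variable c : F4root -> L.
Hypothesis Hc : forall r, Kset k gamma (c r) /\ c r <> 0.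
Hypotheses (Hc1 : c (alpha 0) = (a * b)^-1) (Hc2 : c (alpha 1) = a * b)
  (Hc3 : c (alpha 2) = a^-1) (Hc4 : c (alpha 3) = a * b^-1).
Hypothesis Hs_stab : forall g, F4KL k gamma g -> F4KL k gamma (sigma g).
Hypothesis Hs_u : forall r t, admissible k gamma r t ->
      sigma (u_el r t) = u_el (sigma_root r) (c r * bar t).

Local Notation K := (Kset k gamma).
Local Notation U := (@U L).
Local Notation n := (@n L).
Local Notation adm := (adm K).
Local Notation Umon := (Umon K).
Local Notation Tmon := (Tmon K).

Let K1 : K 1. Proof. exact: K_one. Qed.
Let KD x y : K x -> K y -> K (x + y). Proof. exact: K_add. Qed.
Let KM x y : K x -> K y -> K (x * y). Proof. exact: (K_mul Hk char2 Hdelta Hgamma). Qed.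
Let KV x : K x -> K x^-1.
Proof. exact: (K_inv Hk Hk_ell char2 Hdelta Hgamma Hbar_fix Hbar_nontriv). Qed.
Let Ksq x : K (x ^+ 2). Proof. exact: (K_sq Hk Hsq char2 Hdelta Hgamma HL). Qed.
Let Kbar x : K x -> K (bar x).
Proof. exact: (bar_K Hk Hk_ell char2 Hdelta Hgamma Hbar_fix Hbar_nontriv). Qed.
Let a0 : a != 0. Proof. exact/eqP. Qed.
Let b0 : b != 0. Proof. exact/eqP. Qed.
Local Notation Mx := (Mx a b).
Local Notation chival := (chival a b).
Let F4E g : F4KL k gamma g <-> Umon predT g. Proof. exact: F4KLE. Qed.

Definition cn r := c (ixroot r).

Lemma cn_adm r t : adm r t -> adm (sigr r) (cn r * bar t).
Proof.
rewrite /adm (_ : longn (sigr r) = longn r); last first.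
  have [hr|hr] := ltnP r 48.
    by apply: eqb_eq; move: r hr; apply: all_rootsP; vm_compute.
  rewrite /sigr nth_default // /longn; apply/esym/negbTE.
  by rewrite -leqNgt; apply: leq_trans hr.
by case: ifP => // _ Kt; apply: KM; [case: (Hc (ixroot r)) | apply: Kbar].
Qed.

Lemma sigma_U r t : isroot r -> adm r t -> sigma (U r t) = U (sigr r) (cn r * bar t).
Proof.
move=> hr ar; have := @Hs_u (ixroot r) t; rewrite admissibleE ixrootE // => /(_ ar).
by rewrite /u_el -!/(U _ _) sigma_rootE ixrootE.
Qed.

Lemma sigma_M g h : Umon predT g -> Umon predT h -> sigma (g * h) = sigma g * sigma h.
Proof. by move=> /F4E hg /F4E hh; apply: Hs_mul. Qed.

Lemma U_predT r t : isroot r -> adm r t -> Umon predT (U r t).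
Proof. by move=> *; apply: Umon_U. Qed.

Lemma sigma1 : sigma 1 = 1.
Proof.
have h1 : Umon predT (1 : 'M[L]_52) by apply: mon1.
have /F4E /Hs_stab /F4E h2 : Umon predT (1 : 'M[L]_52) by [].
have [g _ E] := Umon_inv char2 h2.
have := sigma_M h1 h1; rewrite mulr1 => /(congr1 (fun x => x * g)).
by rewrite -mulrA E mulr1.
Qed.

Lemma cn_simple i : i \in simple -> cn i = chival i.
Proof.
have E (j : 'I_4) : ixroot (nth 0%N simple j) = alpha j.
  apply: val_inj; rewrite /= alphaE ixrootE //.
  by case: j => [[|[|[|[|]]]]].
rewrite !inE => /or4P[] /eqP ->; rewrite /cn.
- by rewrite (E 0) Hc1 /chival /= invfM.
- by rewrite (E 1) Hc2 /chival /= .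
- by rewrite (E 2) Hc3 /chival /= expr0z mulr1.
by rewrite (E 3) Hc4 /chival /= .
Qed.

Lemma sigr_opp r : isroot r -> sigr (oppn r) = oppn (sigr r).
Proof. by move=> h; apply/eqP; move: r h; apply: all_rootsP; vm_compute. Qed.

Lemma sgsimple_inv r : r \in sgsimple -> exists2 i, i \in simple & r = i \/ r = oppn i.
Proof.
rewrite [sgsimple](_ : _ = simple ++ map oppn simple) // mem_cat.
by move=> /orP[hr|/mapP[i hi ->]]; [exists r => //; left | exists i => //; right].
Qed.

(** Apply sigma to n_i(1) = n_{-i}(1) and compare the matrix entry singled out by [braid_check]. *)
Lemma cn_opp i : i \in simple -> cn i * cn (oppn i) = 1.
Proof.
move=> hi; have ir := simple_root hi; have oir := oppn_root ir.
have sr := sigr_root ir.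
have nn : U i 1 * U (oppn i) 1 * U i 1 = U (oppn i) 1 * U i 1 * U (oppn i) 1.
  by have := n_opp char2 hi (oner_neq0 L); rewrite !nE oppnK // !invr1.
have := congr1 sigma nn.
have P r : isroot r -> Umon predT (U r 1) by move=> hr; apply: U_predT => //; apply: adm1.
have PM r s : isroot r -> isroot s -> Umon predT (U r 1 * U s 1).
  by move=> hr hs; apply: mon_mul; apply: P.
rewrite !sigma_M; try by [apply: P | apply: PM].
rewrite !sigma_U //; try exact: adm1.
rewrite rmorph1 !mulr1 sigr_opp //.
set be := sigr i; set t := cn i; set v := cn (oppn i) => E.
have /hasP[j hj /hasP[m hm /andP[p1 p2]]] := allP braid_checks i hi.
have ok : env_ok (params t v 1 1) by apply: env_okP; rewrite oner_neq0.
rewrite !mem_iota in hj hm.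
have e1 := mat_entry char2 [:: (be, [:: bn 52]); (oppn be, [:: bn 53]); (be, [:: bn 52])]
   (Ordinal (hm : m < 52)%N) (Ordinal (hj : j < 52)%N) ok.
have e2 := mat_entry char2 [:: (oppn be, [:: bn 53]); (be, [:: bn 52]); (oppn be, [:: bn 53])]
   (Ordinal (hm : m < 52)%N) (Ordinal (hj : j < 52)%N) ok.
have me : mat (params t v 1 1) [:: (be, [:: bn 52]); (oppn be, [:: bn 53]); (be, [:: bn 52])] =
    mat (params t v 1 1) [:: (oppn be, [:: bn 53]); (be, [:: bn 52]); (oppn be, [:: bn 53])].
  rewrite /mat /= /meval !big_cons !big_nil !mulr1 !mulrA /params /env /=; exact: E.
rewrite me e2 (peqP char2 _ p1) (peqP char2 _ p2) in e1.
move: e1; rewrite /peval !big_cons !big_nil /meval !big_cons !big_nil !mulr1 !addr0 /params /env /=.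
have t0 : t != 0 by apply/eqP; case: (Hc (ixroot i)).
by move/esym; rewrite -[RHS]mulr1 => /(mulfI t0).
Qed.

Lemma cn_sgsimple r : r \in sgsimple -> cn r = chival r.
Proof.
move=> /sgsimple_inv[i hi [->|->]]; first exact: cn_simple.
have t0 : cn i != 0 by apply/eqP; case: (Hc (ixroot i)).
apply: (mulfI t0); rewrite cn_opp // cn_simple //.
have eN (x : L) : x ^ Negz 0 = x^-1 by [].
by move: hi; rewrite !inE => /or4P[] /eqP ->; rewrite /chival /= ?eN ?expr1z ?expr0z;
  field; rewrite ?a0 ?b0.
Qed.

(** Both sides are compatible with products, so it is enough to compare them on the root groups of
    simple roots and their negatives, which generate and on which c_r is known to equal the
    character [chival]. *)
Lemma sigma_intertwine g : Umon predT g -> sigma g * Mx = Mx * map_mx bar g.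
Proof.
move=> /(Umon_generated char2 K1); elim=> [|_ h [r [t [hr rs ar ->]]] hh IH].
  by rewrite sigma1 map_mx1 mulr1 mul1r.
rewrite sigma_M; [|exact: U_predT|exact: Umon_predT hh].
rewrite sigma_U // cn_sgsimple // -mulrA IH.
rewrite [_ * h in RHS]/(_ *m h) map_mxM map_U mulrA [Mx * (_ *m _)]mulrA.
by rewrite [Mx * U _ _]intertwine // mulrC.
Qed.

Definition fixed_vec (x : 'cV[L]_52) := Mx *m map_mx bar x = x.

Lemma fixed_highest g : Umon predT g -> sigma g = g -> fixed_vec (g *m ev L 30).
Proof.
move=> hg sg; rewrite /fixed_vec map_mxM mulmxA -[_ *m map_mx bar g]sigma_intertwine // sg.
have -> : map_mx bar (ev L 30) = ev L 30.
  by apply/matrixP => i j; rewrite !mxE rmorph_nat.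
by rewrite -mulmxA Mx_highest.
Qed.

Lemma fixed_cf x i j d : fixed_vec x -> (i < 48)%N -> sigr i = j -> chival j = d ->
  cf x i = d * bar (cf x j).
Proof.
move=> fx hi <- <-; rewrite /cf -{1}fx Mx_mulE inordK ?hi ?mxE //.
exact: ltn_trans hi _.
Qed.

Lemma cf_scale lam (y : 'cV[L]_52) i : cf (lam *: y) i = lam * cf y i.
Proof. by rewrite /cf mxE. Qed.

Lemma quad_scale lam l (y : 'cV[L]_52) : quad l (lam *: y) = lam ^+ 2 * quad l y.
Proof.
rewrite /quad mulr_sumr; apply: eq_bigr => p _; rewrite !cf_scale; ring.
Qed.

Lemma spin_inv_scale e lam y : spin_inv K e y -> spin_inv K e (lam *: y).
Proof.
move=> [ly Qy Ay]; split; last 2 first.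
- by rewrite quad_scale Qy mulr0.
- by move=> l /Ay; rewrite quad_scale; apply: KM.
by move=> i hi di; rewrite cf_scale ly // mulr0.
Qed.

Lemma spin_fixed_low e x : (e <= 1)%N -> spin_inv K e x -> fixed_vec x -> low (4 - 2 * e) x.
Proof.
move=> he [lx Qx Ax] fx.
have eN (y : L) : y ^ Negz 0 = y^-1 by [].
have F i j d : (i + e < 48)%N -> sigr (i + e) = (j + e)%N -> chival (j + e) = d ->
  cf x (i + e) = d * bar (cf x (j + e)) by exact: fixed_cf.
(* Fixedness expresses half of the spinor through the other half, so that the norm form becomes
   Hermitian and three of the rationality conditions become those of [spinor_anisotropic]. *)
have [F1 F2 F3 F4] : [/\ cf x (32 + e) = (a * b)^-1 * bar (cf x (46 + e)),
    cf x (40 + e) = b^-1 * bar (cf x (38 + e)), cf x (36 + e) = a^-1 * bar (cf x (42 + e)) &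
    cf x (34 + e) = bar (cf x (44 + e))].
  split; last rewrite -[RHS]mul1r; apply: F;
  by case: e he {lx Qx Ax} => [|[|]] //= _;
     rewrite /chival /= ?eN ?expr0z ?mul1r ?mulr1 ?invfM.
have A12 : K (cf x (46 + e) * bar (cf x (44 + e)) + cf x (38 + e) * cf x (42 + e)).
  have := Ax [:: (46, 34); (38, 42)]%N isT.
  by rewrite /quad /shift_pairs /= !big_cons big_nil /= addr0 F4.
have A13 : K (cf x (46 + e) * bar (cf x (42 + e)) / a + cf x (38 + e) * cf x (44 + e)).
  have := Ax [:: (46, 36); (38, 44)]%N isT.
  by rewrite /quad /shift_pairs /= !big_cons big_nil /= addr0 F3 mulrCA mulrC.
have A23 : K (cf x (46 + e) * bar (cf x (38 + e)) / b + cf x (42 + e) * cf x (44 + e)).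
  have := Ax [:: (46, 40); (42, 44)]%N isT.
  by rewrite /quad /shift_pairs /= !big_cons big_nil /= addr0 F2 mulrCA mulrC.
have [z0 z1 z2 z3] : [/\ cf x (46 + e) = 0, cf x (38 + e) = 0, cf x (42 + e) = 0 &
    cf x (44 + e) = 0].
  apply: (spinor_anisotropic Hk Hk_ell Hsq char2 Hdelta Hgamma HL Hbar_fix Hbar_nontriv
    Ha Ha0 Hb0 Haniso) => //.
  rewrite -[RHS]Qx /quad /spin_norm /shift_pairs /= !big_cons big_nil /= F1 F2 F3 F4.
  by field; rewrite ?a0 ?b0.
move: F1 F2 F3 F4; rewrite z0 z1 z2 z3 rmorph0 !mulr0 => F1 F2 F3 F4.
move=> i hi di; have [lt|ge] := ltnP (deg i) (3 - 2 * e); first exact: lx.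
(* The basis vectors of degree exactly 3 - 2e are the eight half-sum roots. *)
have : i \in [seq (j + e)%N | j <- spin_ix].
  move: di ge; case: e he {lx Qx Ax F F1 F2 F3 F4 A12 A13 A23 z0 z1 z2 z3} => [|[|]] //= _ d1 d2;
    have := conj d2 d1 => /andP; move: i hi {d1 d2};
    (move=> i hi; apply/implyP; move: i hi);
    have H (P : pred nat) : all P (iota 0 52) -> forall i, (i < 52)%N -> P i
      by move=> /allP h i hi; apply: h; rewrite mem_iota.
  - by apply: H; vm_compute.
  - by apply: H; vm_compute.
rewrite !inE => /or4P[| | |/or4P[| | |/orP[|]]] /eqP -> //.
Qed.

(** Only y is known to be rational while only lam y is known to be fixed, which is the shape handled
    by [vector_anisotropic]. Coordinate 48 vanishes, so the toral coordinate 49 is fixed by bar. *)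
Lemma vec_fixed_low lam y : lam != 0 -> vec_inv K y -> fixed_vec (lam *: y) -> low 3 (lam *: y).
Proof.
move=> l0 [zy Qy Ay] fx; set x := lam *: y in fx *.
have eN (w : L) : w ^ Negz 0 = w^-1 by [].
have F1 : cf x 25 = a * bar (cf x 24) by apply: fixed_cf => //; rewrite /chival /= ?mulr1.
have F2 : cf x 27 = b * bar (cf x 26) by apply: fixed_cf => //; rewrite /chival /= ?mul1r.
have F3 : cf x 29 = a * b * bar (cf x 28) by apply: fixed_cf => //; rewrite /chival /=.
have z48 : cf x 48 = 0 by rewrite cf_scale zy ?mulr0.
have zz : bar (cf x 49) = cf x 49.
  transitivity ((Mx *m map_mx bar x) (inord 49) 0); last by rewrite fx.
  rewrite Mx_mulE inordK //= mul1r ![map_mx _ _ _ _]mxE -/(cf x 48) -/(cf x 49).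
  by rewrite z48 rmorph0 addr0.
have Qx : quad vec_norm x = 0 by rewrite quad_scale Qy mulr0.
have [z0 z1 z2 z3] : [/\ cf x 49 = 0, cf x 24 = 0, cf x 26 = 0 & cf x 28 = 0].
  apply: (vector_anisotropic Hk Hk_ell char2 Hdelta Hgamma HL Hbar_fix Hbar_nontriv
    Ha Ha0 Hb Hb0 Haniso (lam := lam) (p1 := cf y 24) (p2 := cf y 26) (p3 := cf y 28)
    (q1 := cf y 25) (q2 := cf y 27) (q3 := cf y 29)) => //;
    rewrite -?cf_scale ?F1 ?F2 ?F3 //; try exact: Ay.
  rewrite -[RHS]Qx /quad /vec_norm !big_cons big_nil /= F1 F2 F3; ring.
move: F1 F2 F3; rewrite z1 z2 z3 rmorph0 !mulr0 => F1 F2 F3.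
move=> i hi di; have [zi|nz] := boolP (vec_zero i); first by rewrite cf_scale zy ?mulr0.
have : i \in 49%N :: vec_ix.
  move: nz; rewrite /vec_zero negb_or -leqNgt => /andP[d2].
  by rewrite eqn_leq d2 -ltnS di /= negbK.
by rewrite !inE => /or4P[| | |/or4P[]] /eqP ->.
Qed.

Lemma fixed_cell g : Umon predT g -> sigma g = g ->
  exists u s p h, [/\ Umon posn u, (s == 30) || (s == 31), Umon Pphi p, Tmon h &
    g = u * @nw L (word s) * p * h].
Proof.
move=> hg sg; have [u [s [p [h [hu hs hp Th E]]]]] := bruhat char2 K1 KD KM KV Ksq hg.
exists u, s, p, h; split => //.
have [lam l0 El] := T_short char2 Th (isT : shortn 30).
have xE : g *m ev L 30 = lam *: (u *m ev L s).
  rewrite E -!mulmxA El -!scalemxAr (P_fixes_highest char2 hp).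
  by rewrite nw_word.
have fx := fixed_highest hg sg; rewrite xE in fx.
have lowE d : low d (lam *: (u *m ev L s)) -> low d (u *m ev L s).
  move=> lx i hi di; have := lx i hi di; rewrite cf_scale => /eqP.
  by rewrite mulf_eq0 (negPf l0) => /eqP.
have hu' := low_not_all0 char2 hs _ hu.
have spin e : (e <= 1)%N -> deg s = (3 - 2 * e)%N -> False.
  move=> he ds; apply: (hu' _ ds); apply: lowE.
  rewrite (_ : (3 - 2 * e).+1 = (4 - 2 * e)%N); last by case: e he {ds} => [|[|]].
  apply: spin_fixed_low => //; apply: spin_inv_scale.
  apply: (Umon_inv_vec (I := spin_inv K e) _ hu); last exact: spin_inv_ev.
  by move=> r t y hr pr ar; apply: spin_inv_U.
have vect : deg s = 2 -> False.
  move=> ds; apply: (hu' _ ds); apply: lowE; apply: vec_fixed_low => //.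
  apply: (Umon_inv_vec (I := vec_inv K) _ hu).
    by move=> r t y hr pr ar; apply: vec_inv_U.
  apply: vec_inv_ev => //.
  exact: short_degree2.
(* In degrees 1, 2 and 3 the lowest component would vanish, contrary to [low_not_all0]; degrees 0
   and 4 contain no short roots but -e4 and e4. *)
have : (deg s == 0%N) || (deg s == 4).
  have := deg_le4 s; case e: (deg s) => [|[|[|[|[|]]]]] // _.
  - by case: (spin 1%N isT e).
  - by case: (spin 0%N isT e).
exact: short_extreme_degree.
Qed.

Lemma map_bar_pattern (g : 'M[L]_52) i j : g i j = 0 -> (map_mx bar g) i j = 0.
Proof. by rewrite mxE => ->; rewrite rmorph0. Qed.

Lemma graded_Mx : graded (Mx : 'M[L]_52).
Proof.
move=> i j ne; rewrite mxE; case: ifP => hi.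
  case: eqP => [e|_]; last by rewrite mul0r.
  have ds : deg (sigr i) = deg i.
    by apply/eqP; move: (nat_of_ord i) hi {ne e}; apply: all_rootsP; vm_compute.
  by move: ne; rewrite e ds eqxx.
have toral m : (48 <= m)%N -> deg m = 2 by move=> hm; rewrite /deg nth_default.
have hj : j != i by apply: contra_neq ne => ->.
rewrite (negPf hj) add0r; case: andP => // -[/eqP e1 /eqP e2].
by move: ne; rewrite !toral ?e1 ?e2.
Qed.

Lemma sigma_graded l : Umon predT l -> graded l -> graded (sigma l).
Proof.
move=> hl gl; have -> : sigma l = Mx * map_mx bar l * Mx.
  by rewrite -sigma_intertwine // -mulrA [Mx * Mx]MxMx // mulr1.
apply: graded_mul; last exact: graded_Mx.
apply: graded_mul; first exact: graded_Mx.
by move=> i j ne; apply/map_bar_pattern/gl.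
Qed.

Lemma sigma_unipotent u : Umon (fun r => 2 < deg r)%N u -> Umon (fun r => 2 < deg r)%N (sigma u).
Proof.
elim=> [|_ h [r [t [hr dr ar ->]]] hh IH]; first by rewrite sigma1; apply: mon1.
rewrite sigma_M; [|exact: U_predT|exact: Umon_predT hh].
rewrite sigma_U //; apply: mon_mul => //; apply: Umon_U; [exact: sigr_root| |exact: cn_adm].
suff -> : deg (sigr r) = deg r by [].
by apply/eqP; move: r hr {dr ar}; apply: all_rootsP; vm_compute.
Qed.

Lemma n_e4_predT : Umon predT (n 30 1).
Proof. by rewrite n_e4_word //; apply/(Umon_predT (phi := mem sgsimple))/Umon_nw. Qed.

Lemma sigma_n_e4 : sigma (n 30 1) = n 30 1.
Proof.
have E : sigma (n 30 1) * Mx = n 30 1 * Mx.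
  rewrite (sigma_intertwine n_e4_predT) nE invr1.
  have c30 r : r \in [:: 30; 31]%N -> Mx *m map_mx bar (U r 1) = U r 1 *m Mx.
    move=> hr; rewrite map_U rmorph1 intertwine //; last by move: hr; rewrite !inE => /orP[] /eqP ->.
    have -> : sigr r = r by move: hr; rewrite !inE => /orP[] /eqP ->.
    have -> // : chival r = 1.
      by move: hr; rewrite !inE => /orP[] /eqP ->; rewrite /chival /= !expr0z mulr1.
    by rewrite mul1r.
  have comp (A B : 'M[L]_52) : Mx *m map_mx bar A = A *m Mx ->
      Mx *m map_mx bar B = B *m Mx -> Mx *m map_mx bar (A *m B) = A *m B *m Mx.
    by move=> hA hB; rewrite map_mxM mulmxA hA -mulmxA hB mulmxA.
  by apply: (comp _ _ (comp _ _ _ _)); apply: c30.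
have MM : Mx * Mx = 1 by exact: MxMx.
by rewrite -[LHS]mulr1 -MM mulrA E -mulrA MM mulr1.
Qed.

Lemma big_cell_fixed g u p h : Umon predT g -> sigma g = g -> Umon posn u -> Umon Pphi p ->
  Tmon h -> g = u * n 30 1 * p * h ->
  exists v l w, [/\ Umon (fun r => 2 < deg r)%N v /\ sigma v = v,
    exists l1 l2, [/\ Umon (fun r => deg r == 2)%N l1, Tmon l2 & l = l1 * l2],
    sigma l = l,
    Umon (fun r => 2 < deg r)%N w /\ sigma w = w &
    g = v * l * n 30 1 * w].
Proof.
move=> hg sg hu hp Th E.
have hu' : Umon Pphi u.
  by apply: mon_sub hu => _ [r [t [hr pr ar ->]]]; apply: Umon_U => //; apply: posn_deg.
have [v [l [hv hl uE]]] := parabolic_decomp char2 KM Ksq hu'.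
have [v1 [l1 [hv1 hl1 pE]]] := parabolic_decomp char2 KM Ksq hp.
have linv := fun s => @Umon_inv L char2 K (fun r => deg r == 2)%N s.
have [w1 hw1 E1] := normal_right linv
  (fun s z hs hz => levi_normal_mon char2 KM Ksq hs hz) hl1 hv1.
have [w hw E2] := normal_right (@T_inv L char2 K)
  (fun s z hs hz => T_normal char2 K1 KM KV Ksq hs hz) Th hw1.
have [l1' hl1' E3] := n_e4_levi char2 hl1.
have [h' Th' E4] : exists2 h', Tmon h' & n 30 1 * h = h' * n 30 1.
  by rewrite n_e4_word //; apply: nw_T => //; apply: word_simple.
have gE : g = v * ((l * l1') * h') * n 30 1 * w.
  by rewrite E uE pE E1 -!mulrA E2 (mulE2 E3) (mulE2 E4).
(* The Levi factor is hidden behind a variable, so that rewriting with associativity treats it as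
   one factor. *)
have [m mE] : exists m, m = (l * l1') * h' by eexists.
rewrite -mE in gE.
have hll : Umon (fun r => deg r == 2)%N (l * l1') by apply: mon_mul.
have mP : Umon predT m.
  by rewrite mE; apply: mon_mul; [exact: Umon_predT hll | apply: (Umon_T K1 KV)].
have gm : graded m.
  by rewrite mE; apply: graded_mul; [exact: (graded_Umon char2 hll) | exact: (graded_T char2 Th')].
have [m' _ mm'] := Umon_inv char2 mP.
have um : m \is a GRing.unit.
  by apply/unitrP; exists m'; split=> //; apply: mulmx1C.
have sv := sigma_unipotent hv; have sw := sigma_unipotent hw.
have nP := n_e4_predT.
have vP := Umon_predT hv; have wP := Umon_predT hw.
have vmP := mon_mul vP mP; have vmnP := mon_mul vmP nP.
have sgE : g = sigma v * sigma m * n 30 1 * sigma w.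
  by rewrite -{1}sg gE (sigma_M vmnP wP) (sigma_M vmP nP) (sigma_M vP mP) sigma_n_e4.
have [v' hv' vv'] := Umon_inv char2 sv.
have [w' hw' ww'] := Umon_inv char2 hw.
have v'v : v' * sigma v = 1 by apply: mulmx1C.
(* g and sigma g give two factorizations of one element. Moving sigma(v) to the left and w to the
   right leaves the equation of [big_cell_unique], with block upper and block lower unitriangular
   factors. *)
have E5 : (v' * v) * m = sigma m * (n 30 1 * (sigma w * w') * n 30 1).
  have nn : n 30 1 * n 30 1 = 1 by apply: n_sq.
  have EE : v * m * n 30 1 * w = sigma v * sigma m * n 30 1 * sigma w by rewrite -gE.
  have := congr1 (fun z => v' * (z * (w' * n 30 1))) EE.
  by rewrite -!mulrA (mulE1 ww') mul1r nn mulr1 (mulE1 v'v) mul1r.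
have upv : upper (v' * v) by apply: upper_mul; apply: (upper_Umon char2); eassumption.
have upw : upper (sigma w * w') by apply: upper_mul; apply: (upper_Umon char2); eassumption.
have [v1E sm] := big_cell_unique char2 um gm (sigma_graded mP gm) upv upw E5.
have vE : sigma v = v by rewrite -[LHS]mulr1 -v1E mulrA vv' mul1r.
have wE : sigma w = w.
  have un : n 30 1 \is a GRing.unit by apply: (involution_unit (n_sq char2 1 _)).1.
  have uv : v \is a GRing.unit by apply/unitrP; exists v'; split=> //; apply: mulmx1C.
  apply: (mulrI un); apply: (mulrI um); apply: (mulrI uv).
  by rewrite !mulrA -gE {1}sgE vE -sm.
exists v, m, w; split => //.
by exists (l * l1'), h'.
Qed.

Lemma F4KL_inv g : F4KL k gamma g -> F4KL k gamma g^-1 /\ g * g^-1 = 1.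
Proof.
move=> /F4E hg; have [g' hg' E] := Umon_inv char2 hg.
have u : g \is a GRing.unit by apply/unitrP; exists g'; split=> //; apply: mulmx1C.
have -> : g^-1 = g' by rewrite -[LHS]mulr1 -E mulKr.
by split => //; apply/F4E.
Qed.

Lemma G1_fixed g : G1 k gamma sigma g -> F4KL k gamma g /\ sigma g = g.
Proof.
have S s : U1 k gamma sigma s \/ V1 k gamma sigma s -> F4KL k gamma s /\ sigma s = s.
  by case=> [[_ []] // | [_ []] //].
elim=> [|s h /S[hs ss] _ [hh sh]|s h /S[hs ss] _ [hh sh]].
- by split; [exact: gen_one | exact: sigma1].
- by split; [apply: gen_mulg | rewrite Hs_mul // ss sh].
have [hsi E] := F4KL_inv hs; split; first exact: gen_mulg.
have us : s \is a GRing.unit by apply/unitrP; exists s^-1; split=> //; apply: mulmx1C.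
rewrite Hs_mul // sh; congr (_ * _); apply: (mulrI us).
by rewrite -{1}ss -Hs_mul // E sigma1.
Qed.

Lemma big_cell_decomposition g : G1 k gamma sigma g -> ~ B1 k gamma sigma g ->
  exists u l u',
    (UJ_KL k gamma u /\ Fix k gamma sigma u) /\
    (LJ_KL k gamma l /\ Fix k gamma sigma l) /\
    (Uw_minus k gamma u' /\ Fix k gamma sigma u') /\
    g = u * l * n_e4 L * u'.
Proof.
move=> Gg nB; have [Fg sg] := G1_fixed Gg; have /F4E hg := Fg.
have [u [s [p [h [hu /orP[] /eqP -> hp Th E]]]]] := fixed_cell hg sg.
  (* For s = e4 the word is empty, so g lies in P_J and hence in B^1. *)
  case: nB; split => //; split => //.
  have hup : Umon Pphi (u * p).
    apply: mon_mul => //; apply: mon_sub hu => _ [r [t [hr pr ar ->]]].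
    by apply: Umon_U => //; apply: posn_deg.
  have [v [l [hv hl upE]]] := parabolic_decomp char2 KM Ksq hup.
  exists v, (l * h); split; first exact: UJ_Umon hv.
  split; last by rewrite E mulr1 upE mulrA.
  by apply: gen_mulg; [exact: LJ_Umon hl | exact: LJ_T Th].
rewrite -n_e4_word // in E.
have [v [l [w [[hv sv] [l1 [l2 [hl1 Tl2 lE]]] sl [hw sw] gE]]]] := big_cell_fixed hg sg hu hp Th E.
have Fl : F4KL k gamma l.
  by rewrite lE; apply: gen_mulg; apply/F4E; [exact: Umon_predT hl1 | apply: (Umon_T K1 KV)].
have Fv : F4KL k gamma v by apply/F4E; exact: Umon_predT hv.
have Fw : F4KL k gamma w by apply/F4E; exact: Umon_predT hw.
exists v, l, w; split; first by split=> //; split=> //; exact: UJ_Umon hv.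
split.
  split=> //; split=> //; rewrite lE; apply: gen_mulg; [exact: LJ_Umon hl1 | exact: LJ_T Tl2].
split; first by split=> //; exact: Uw_minus_Umon hw.
by rewrite gE n_e4E.
Qed.

End Twisted.

Theorem mainTheorem9
  (L : fieldType) (ell k : L -> Prop)
  (* k and ell are subfields of L with k ⊆ ell and ell^2 ⊆ k *)
  (Hell : is_subfield ell) (Hk : is_subfield k)
  (Hk_ell : forall x, k x -> ell x)
  (Hsq : forall x, ell x -> k (x ^+ 2))
  (* characteristic 2 *)
  (Hchar : (2%:R : L) = 0)
  (delta gamma : L) (Hdelta : k delta)
  (* x^2 + x + delta is irreducible over ell, gamma is a root *)
  (Hirr : irreducible_over ell ('X^2 + 'X + delta%:P))
  (Hgamma : gamma ^+ 2 + gamma + delta = 0)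
  (* L = ell(gamma) *)
  (HL : forall x : L, exists a b, ell a /\ ell b /\ x = a + b * gamma)
  (* the nontrivial automorphism t |-> bar t of L / ell *)
  (bar : {rmorphism L -> L})
  (Hbar_fix : forall x, ell x -> bar x = x) (Hbar_nontriv : bar gamma <> gamma)
  (a b : L) (Ha : k a) (Ha0 : a <> 0) (Hb : k b) (Hb0 : b <> 0)
  (* the form q is anisotropic on ell ⊕ K^3 *)
  (Haniso : forall y1 y2 y3 y4 : L,
      ell y1 -> Kset k gamma y2 -> Kset k gamma y3 -> Kset k gamma y4 ->
      y1 ^+ 2 + a * (y2 * bar y2) + b * (y3 * bar y3)
        + a * b * (y4 * bar y4) = 0 ->
      [/\ y1 = 0, y2 = 0, y3 = 0 & y4 = 0])
  (* sigma : an involutive automorphism of F4(K,L) ... *)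
  (sigma : 'M[L]_52 -> 'M[L]_52)
  (Hs_stab : forall g, F4KL k gamma g -> F4KL k gamma (sigma g))
  (Hs_mul : forall g h, F4KL k gamma g -> F4KL k gamma h ->
      sigma (g * h) = sigma g * sigma h)
  (Hs_inv : forall g, F4KL k gamma g -> sigma (sigma g) = g)
  (* ... acting on root elements through constants c_r in K^x *)
  (c : F4root -> L)
  (Hc : forall r, Kset k gamma (c r) /\ c r <> 0)
  (Hc1 : c (alpha 0) = (a * b)^-1) (Hc2 : c (alpha 1) = a * b)
  (Hc3 : c (alpha 2) = a^-1) (Hc4 : c (alpha 3) = a * b^-1)
  (Hs_u : forall r t, admissible k gamma r t ->
      sigma (u_el r t) = u_el (sigma_root r) (c r * bar t)) :
  forall g, G1 k gamma sigma g -> ~ B1 k gamma sigma g ->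
  exists u l u',
    (UJ_KL k gamma u /\ Fix k gamma sigma u) /\
    (LJ_KL k gamma l /\ Fix k gamma sigma l) /\
    (Uw_minus k gamma u' /\ Fix k gamma sigma u') /\
    g = u * l * n_e4 L * u'.
Proof.
exact: (big_cell_decomposition Hk Hk_ell Hsq Hchar Hdelta Hgamma HL Hbar_fix Hbar_nontriv
  Ha Ha0 Hb Hb0 Haniso Hs_mul Hc Hc1 Hc2 Hc3 Hc4 Hs_stab Hs_u).
Qed.
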